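(* For every measure $\mu$ and every $1<p<\infty$, the (real or complex) space $L_p(\mu)$ has the BPBp-nu for compact operators.
   Context: Banach spaces are over $\mathbb{K}=\mathbb{R}$ or $\mathbb{C}$. For a Banach space $X$, $S_X$ is its unit sphere, $X^*$ its dual, $\mathcal{K}(X)$ the space of compact linear operators from $X$ to $X$, and $\Pi(X)=\{(x,x^* )\in S_X\times S_{X^*}: x^*(x)=1\}$. The numerical radius of a bounded linear operator $T$ on $X$ is $\nu(T)=\sup\{|x^*(T(x))|:(x,x^* )\in\Pi(X)\}$. A Banach space $X$ has the Bishop-Phelps-Bollobás property for numerical radius for compact operators (BPBp-nu for compact operators) if for every $0<\varepsilon<1$ there exists $\eta(\varepsilon)\in(0,1)$ such that whenever $T\in\mathcal{K}(X)$ and $(x,x^* )\in\Pi(X)$ satisfy $\nu(T)=1$ and $|x^*(T(x))|>1-\eta(\varepsilon)$, there exist $S\in\mathcal{K}(X)$ and $(y,y^* )\in\Pi(X)$ such that $\nu(S)=|y^*(S(y))|=1$, $\|T-S\|<\varepsilon$, $\|x-y\|<\varepsilon$ and $\|x^*-y^*\|<\varepsilon$. *)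

(* Defs.v *)
From HB Require Import structures.
From mathcomp Require Import all_boot all_order all_algebra.
From mathcomp Require Import complex.
From mathcomp Require Import all_classical all_reals all_analysis.
From mathcomp Require Import measurable_realfun ring_quotient.

Set Implicit Arguments.
Unset Strict Implicit.
Unset Printing Implicit Defensive.
Import Order.TTheory GRing.Theory Num.Theory.
Import numFieldNormedType.Exports.
Local Open Scope classical_set_scope.
Local Open Scope ring_scope.

Inductive scalar_kind := real_scalars | complex_scalars.

Definition scalars (R : realType) (k : scalar_kind) : numFieldType :=
  match k with real_scalars => R | complex_scalars => R[i] end.

Section scalars.
Context {R : realType} {k : scalar_kind}.

Definition re : scalars R k -> R :=
  match k with real_scalars => id | complex_scalars => @complex.Re R end.

Definition im : scalars R k -> R :=
  match k with real_scalars => cst 0 | complex_scalars => @complex.Im R end.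

Definition ofR : R -> scalars R k :=
  match k with real_scalars => id | complex_scalars => fun x => (x +i* 0)%C end.

(* The library's norm of a normed space over [scalars R k] takes values in the
   scalar field; [rnorm] is the same number as a real. *)
Definition rnorm (V : normedZmodType (scalars R k)) (x : V) : R := re `|x|.

End scalars.

Section scalars_theory.
Context {R : realType} {k : scalar_kind}.
Local Notation K := (scalars R k).

Lemma reD (x y : K) : re (x + y) = re x + re y.
Proof. by case: k x y => //= -[a b] [c d]. Qed.

Lemma imD (x y : K) : im (x + y) = im x + im y.
Proof. by case: k x y => [x y|[a b] [c d]] //=; rewrite addr0. Qed.

Lemma reM (x y : K) : re (x * y) = re x * re y - im x * im y.
Proof. by case: k x y => [x y|[a b] [c d]] //=; rewrite mulr0 subr0. Qed.

Lemma imM (x y : K) : im (x * y) = re x * im y + im x * re y.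
Proof. by case: k x y => [x y|[a b] [c d]] //=; rewrite mulr0 mul0r addr0. Qed.

Lemma re_ofR (a : R) : re (ofR a : K) = a.
Proof. by case: k. Qed.

Lemma ofRD (a b : R) : ofR (a + b) = ofR a + ofR b :> K.
Proof. by case: k => //=; apply/eqP; rewrite eq_complex /= addr0 !eqxx. Qed.

Lemma ofRM (a b : R) : ofR (a * b) = ofR a * ofR b :> K.
Proof.
by case: k => //=; apply/eqP; rewrite eq_complex /= !(mulr0, mul0r, subr0, addr0) !eqxx.
Qed.

Lemma ler_ofR (a b : R) : ((ofR a : K) <= ofR b) = (a <= b).
Proof. by case: k => //=; rewrite lecE /= eqxx. Qed.

Lemma rnormK (x : K) : ofR (rnorm x) = `|x|.
Proof.
by rewrite /rnorm; case: k x.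
Qed.

Lemma rnormE (x : K) : rnorm x = Num.sqrt (re x ^+ 2 + im x ^+ 2).
Proof.
rewrite /rnorm; case: k x => /= [x|[a b]] //=.
by rewrite expr0n /= addr0 sqrtr_sqr.
Qed.

Lemma rnorm_ge0 (x : K) : 0 <= rnorm x.
Proof. by rewrite rnormE sqrtr_ge0. Qed.

Lemma rnormD (x y : K) : rnorm (x + y) <= rnorm x + rnorm y.
Proof. by rewrite -ler_ofR ofRD !rnormK ler_normD. Qed.

Lemma rnormM (x y : K) : rnorm (x * y) = rnorm x * rnorm y.
Proof.
by apply/le_anti; rewrite -!ler_ofR ofRM !rnormK normrM lexx.
Qed.

Lemma rnormN (x : K) : rnorm (- x) = rnorm x.
Proof. by rewrite /rnorm normrN. Qed.

Lemma rnorm0 : rnorm (0 : K) = 0.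
Proof. by rewrite /rnorm normr0; case: k. Qed.

Lemma rnorm_eq0 (x : K) : rnorm x = 0 -> x = 0.
Proof.
move=> h; apply/eqP; rewrite -normr_eq0 -rnormK h; apply/eqP.
by case: k {x h}.
Qed.

End scalars_theory.

Section Lp_functions.
Context d (T : measurableType d) (R : realType) (k : scalar_kind).
Variables (mu : {measure set T -> \bar R}) (p : R) (p1 : 1 < p).
Local Notation K := (scalars R k).
Implicit Types f g : T -> K^o.

Definition measurable_scalar f :=
  measurable_fun setT (re \o (f : T -> K)) /\
  measurable_fun setT (im \o (f : T -> K)).

Definition pnorm f : \bar R :=
  ('N[mu]_(p%:E)[EFin \o (fun x => rnorm (f x : K))])%E.

(* The proof of [1 < p] is an argument so that the closure instances below,
   which need it, can be inferred from the predicate. *)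
Definition Lp_pred of 1 < p : {pred T -> K^o} :=
  mem [set f | measurable_scalar f /\ (pnorm f < +oo)%E].

Lemma Lp_predP f :
  reflect (measurable_scalar f /\ (pnorm f < +oo)%E) (f \in Lp_pred p1).
Proof. exact: (iffP (@asboolP _)). Qed.

Let p_ge1 : 1 <= p. Proof. exact: ltW. Qed.
Let p_gt0 : 0 < p. Proof. exact: lt_trans p1. Qed.

Lemma measurable_rnorm f : measurable_scalar f ->
  measurable_fun setT (fun x => rnorm (f x : K)).
Proof.
move=> [mr mi]; under eq_fun do rewrite rnormE.
apply: (@measurableT_comp _ _ _ _ _ _ (@Num.sqrt R)).
  by apply: continuous_measurable_fun; exact: sqrt_continuous.
by apply: measurable_funD; apply: measurable_funX.
Qed.

Lemma pnormE f : pnorm f = ((\int[mu]_x ((rnorm (f x : K)) `^ p)%:E) `^ p^-1)%E.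
Proof.
rewrite /pnorm unlock; congr (_ `^ _)%E; apply: eq_integral => x _ /=.
by rewrite ger0_norm ?rnorm_ge0.
Qed.

Lemma measurable_powR_rnorm f : measurable_scalar f ->
  measurable_fun setT (fun x => ((rnorm (f x : K)) `^ p)%:E).
Proof.
move=> mf; apply/measurable_EFinP.
apply: (@measurableT_comp _ _ _ _ _ _ (@powR R ^~ p)) => //.
exact: measurable_rnorm.
Qed.

Lemma pnorm_ge0 f : (0 <= pnorm f)%E.
Proof. exact: Lnorm_ge0. Qed.

Lemma pnormD f g : measurable_scalar f -> measurable_scalar g ->
  measurable_scalar (f + g) -> (pnorm (f + g)%R <= pnorm f + pnorm g)%E.
Proof.
move=> mf mg mfg.
apply: (le_trans _ (minkowski_EFin mu (measurable_rnorm mf)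
  (measurable_rnorm mg) p_ge1)).
rewrite pnormE unlock.
apply: gt0_ler_poweR.
- by rewrite invr_ge0 ltW.
- by rewrite in_itv /= leey andbT integral_ge0// => x _; rewrite lee_fin powR_ge0.
- by rewrite in_itv /= leey andbT integral_ge0// => x _; rewrite poweR_ge0.
apply: ge0_le_integral => //.
- by move=> x _; rewrite lee_fin powR_ge0.
- exact: measurable_powR_rnorm.
- apply/measurable_EFinP.
  apply: (@measurableT_comp _ _ _ _ _ _ (@powR R ^~ p)) => //.
  apply: measurableT_comp => //.
  by apply: measurable_funD; exact: measurable_rnorm.
- move=> x _; rewrite /= lee_fin; apply: ge0_ler_powR.
  + exact: ltW.
  + by rewrite nnegrE rnorm_ge0.
  + by rewrite nnegrE.
  + by rewrite ger0_norm ?addr_ge0 ?rnorm_ge0// rnormD.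
Qed.

Lemma pnormZ (a : K) f : measurable_scalar f ->
  pnorm (a *: f) = ((rnorm a)%:E * pnorm f)%E.
Proof.
move=> mf; rewrite !pnormE.
under eq_integral => x _.
  rewrite rnormM powRM ?rnorm_ge0// EFinM; over.
rewrite ge0_integralZl_EFin ?powR_ge0 //; last 2 first.
- by move=> x _; rewrite lee_fin powR_ge0.
- exact: measurable_powR_rnorm.
rewrite poweRM ?integral_ge0 ?lee_fin ?powR_ge0//; last first.
  by move=> x _; rewrite lee_fin powR_ge0.
by rewrite poweR_EFin -powRrM mulfV ?gt_eqF// powRr1 ?rnorm_ge0.
Qed.

Lemma measurable_scalarD f g : measurable_scalar f -> measurable_scalar g ->
  measurable_scalar (f + g).
Proof.
move=> [fr fi] [gr gi]; split.
- rewrite (_ : _ \o _ = (re \o (f : T -> K)) \+ (re \o (g : T -> K))).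
    exact: measurable_funD.
  by apply/funext => x /=; rewrite reD.
- rewrite (_ : _ \o _ = (im \o (f : T -> K)) \+ (im \o (g : T -> K))).
    exact: measurable_funD.
  by apply/funext => x /=; rewrite imD.
Qed.

Lemma measurable_scalarZ (a : K) f : measurable_scalar f ->
  measurable_scalar (a *: f).
Proof.
move=> [fr fi]; split.
- rewrite (_ : _ \o _ = (fun x => re a * re (f x : K) - im a * im (f x : K))).
    by apply: measurable_funB; apply: measurable_funM => //; exact: measurable_cst.
  by apply/funext => x /=; rewrite reM.
- rewrite (_ : _ \o _ = (fun x => re a * im (f x : K) + im a * re (f x : K))).
    by apply: measurable_funD; apply: measurable_funM => //; exact: measurable_cst.
  by apply/funext => x /=; rewrite imM.
Qed.

Lemma Lp_submod_closed : submod_closed (Lp_pred p1).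
Proof.
split.
  apply/Lp_predP; split.
    split; [rewrite (_ : _ \o _ = cst (re (0 : K)))|
            rewrite (_ : _ \o _ = cst (im (0 : K)))] => //;
      exact: measurable_cst.
  rewrite pnormE (_ : (\int[mu]_x _ = 0)%E) ?poweR0r ?invr_neq0 ?gt_eqF//.
  by under eq_integral => x _ do rewrite rnorm0 powR0 ?gt_eqF//; rewrite integral0.
move=> a f g /Lp_predP[mf lf] /Lp_predP[mg lg]; apply/Lp_predP.
have maf := measurable_scalarZ a mf; have mafg := measurable_scalarD maf mg.
split => //; apply: le_lt_trans (pnormD maf mg mafg) _.
by rewrite lte_add_pinfty// pnormZ// lte_mul_pinfty ?lee_fin ?rnorm_ge0.
Qed.

Lemma pnorm_eq0 f : measurable_scalar f ->
  pnorm f = 0%E <-> {ae mu, forall x, f x = 0}.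
Proof.
move=> mf; split.
  move=> /Lnorm_eq0_eq0; case.
  - by apply/measurable_EFinP; exact: measurable_rnorm.
  - by rewrite lte_fin.
  move=> N [mN N0 h]; exists N; split => // x /= fx0; apply: h => /= /(_ I).
  by case=> /rnorm_eq0.
move=> f0; rewrite pnormE (ge0_ae_eq_integral (g := cst 0%E))//.
- by rewrite integral_cst// mul0e poweR0r// invr_neq0// gt_eqF.
- exact: measurable_powR_rnorm.
- by move=> x _; rewrite lee_fin powR_ge0.
- by apply: filterS f0 => x -> _; rewrite rnorm0 powR0// gt_eqF.
Qed.

HB.instance Definition _ := GRing.isSubmodClosed.Build _ _ (Lp_pred p1)
  Lp_submod_closed.

Record Lp_fun := LpFun { Lp_fun_val :> T -> K^o; _ : Lp_fun_val \in Lp_pred p1 }.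

HB.instance Definition _ := [isSub for Lp_fun_val].
HB.instance Definition _ := [Choice of Lp_fun by <:].
HB.instance Definition _ := [SubChoice_isSubLmodule of Lp_fun by <:].

Definition ae_null : {pred Lp_fun} :=
  mem [set F : Lp_fun | {ae mu, forall x, F x = 0}].

Lemma ae_nullP (F : Lp_fun) : reflect {ae mu, forall x, F x = 0} (F \in ae_null).
Proof. exact: (iffP (@asboolP _)). Qed.

Lemma ae_null_submod_closed : submod_closed ae_null.
Proof.
split; first by apply/ae_nullP; apply: aeW.
move=> a F G /ae_nullP F0 /ae_nullP G0; apply/ae_nullP.
apply: filterS2 F0 G0 => x Fx Gx.
rewrite -[LHS]/(a *: F x + G x) Fx Gx scaler0 addr0 //.
Qed.

HB.instance Definition _ := GRing.isSubmodClosed.Build _ _ ae_null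
  ae_null_submod_closed.

End Lp_functions.

Section Lp_space.
Context d (T : measurableType d) (R : realType) (k : scalar_kind).
Variables (mu : {measure set T -> \bar R}) (p : R) (p1 : 1 < p).
Local Notation K := (scalars R k).
Local Open Scope quotient_scope.

Definition Lp : Type := Quotient.quot (@ae_null _ T R k mu p p1).

HB.instance Definition _ := Choice.on Lp.
HB.instance Definition _ := GRing.Zmodule.on Lp.

Implicit Types x y : Lp.
Implicit Types F G : @Lp_fun _ T R k mu p p1.

Definition Lp_class F : Lp := \pi F.

Lemma Lp_classD F G : Lp_class (F + G) = Lp_class F + Lp_class G.
Proof. by rewrite /Lp_class !piE. Qed.

Lemma Lp_class_repr x : Lp_class (repr x) = x.
Proof. exact: reprK. Qed.

Lemma Lp_classP F G : Lp_class F = Lp_class G <-> {ae mu, forall t, F t = G t}.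
Proof.
have -> : Lp_class F = Lp_class G <-> F - G \in @ae_null _ T R k mu p p1.
  by rewrite Quotient.idealrBE; split => [/eqP|/eqP].
split=> [/ae_nullP|] h; last apply/ae_nullP.
  apply: filterS h => t; rewrite -[LHS]/(F t - G t) => /eqP.
  by rewrite subr_eq0 => /eqP.
apply: filterS h => t FG.
by rewrite -[LHS]/(F t - G t) FG subrr.
Qed.

Definition Lp_scale (a : K) x : Lp := Lp_class (a *: repr x).

Lemma Lp_class_scale a F : Lp_scale a (Lp_class F) = Lp_class (a *: F).
Proof.
apply/Lp_classP; have /Lp_classP := Lp_class_repr (Lp_class F).
set G := repr _; apply: filterS => t GF.
by rewrite -[LHS]/(a *: G t) GF.
Qed.

Let scaleA (a b : K) x : Lp_scale a (Lp_scale b x) = Lp_scale (a * b) x.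
Proof. by rewrite -[x]Lp_class_repr !Lp_class_scale scalerA. Qed.

Let scale1 : left_id (1 : K) Lp_scale.
Proof. by move=> x; rewrite -[x]Lp_class_repr !Lp_class_scale scale1r. Qed.

Let scaleDr : right_distributive Lp_scale +%R.
Proof.
move=> a x y; rewrite -[x]Lp_class_repr -[y]Lp_class_repr -Lp_classD.
by rewrite !Lp_class_scale -Lp_classD scalerDr.
Qed.

Let scaleDl x : {morph Lp_scale^~ x : a b / a + b}.
Proof.
by move=> a b; rewrite -[x]Lp_class_repr !Lp_class_scale -Lp_classD scalerDl.
Qed.

HB.instance Definition _ :=
  GRing.Zmodule_isLmodule.Build K Lp scaleA scale1 scaleDr scaleDl.

Definition Lp_norm x : K := ofR (fine (pnorm mu p (repr x))).

Let nm F : R := fine (pnorm mu p F).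

Let nmE F : (nm F)%:E = pnorm mu p F.
Proof.
have /Lp_predP[_ Foo] := valP F.
by rewrite fineK// ge0_fin_numE// pnorm_ge0.
Qed.

Lemma Lp_norm_class F : Lp_norm (Lp_class F) = ofR (fine (pnorm mu p F)).
Proof.
congr (ofR (fine _)); rewrite !pnormE; congr (_ `^ _)%E.
have /Lp_classP := Lp_class_repr (Lp_class F).
set G := repr _ => GF.
have [/Lp_predP[mG _] /Lp_predP[mF _]] := (valP G, valP F).
apply: ge0_ae_eq_integral => //.
- exact: measurable_powR_rnorm.
- exact: measurable_powR_rnorm.
- by move=> t _; rewrite lee_fin powR_ge0.
- by move=> t _; rewrite lee_fin powR_ge0.
- by apply: filterS GF => t /= ->.
Qed.

Let ler_normD x y : Lp_norm (x + y) <= Lp_norm x + Lp_norm y.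
Proof.
rewrite -[x]Lp_class_repr -[y]Lp_class_repr -Lp_classD !Lp_norm_class.
move: (repr x) (repr y) => F G.
rewrite -ofRD ler_ofR -lee_fin EFinD !nmE.
have [/Lp_predP[mF _] /Lp_predP[mG _]] := (valP F, valP G).
exact (pnormD mu p1 mF mG (measurable_scalarD mF mG)).
Qed.

Let normrZ (a : K) x : Lp_norm (a *: x) = `|a| * Lp_norm x.
Proof.
rewrite -[x]Lp_class_repr [a *: _]Lp_class_scale !Lp_norm_class.
move: (repr x) => F.
rewrite -rnormK -ofRM; congr ofR; apply: EFin_inj; rewrite EFinM !nmE.
by have /Lp_predP[mF _] := valP F; exact: (pnormZ mu p1 a mF).
Qed.

Let normr0_eq0 x : Lp_norm x = 0 -> x = 0.
Proof.
rewrite -[x]Lp_class_repr Lp_norm_class; move: (repr x) => F.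
move=> /(congr1 re); rewrite re_ofR => F0.
have {}F0 : pnorm mu p F = 0%E.
  by rewrite -nmE; congr EFin; rewrite [LHS]F0; case: (k).
have /Lp_predP[mF _] := valP F.
have {}F0 := (pnorm_eq0 mu p1 mF).1 F0.
rewrite (_ : 0 = Lp_class 0); last by rewrite /Lp_class piE.
by apply/Lp_classP; apply: filterS F0 => t /= ->.
Qed.

HB.instance Definition _ :=
  Lmodule_isNormed.Build K Lp ler_normD normrZ normr0_eq0.

Lemma rnorm_Lp_class F : rnorm (Lp_class F : Lp) = fine (pnorm mu p F).
Proof. by rewrite /rnorm [`|_|]Lp_norm_class re_ofR. Qed.

End Lp_space.

Arguments Lp {d T R} k mu {p} p1.

Section BPBp_nu.
Context {R : realType} {k : scalar_kind}.
Local Notation K := (scalars R k).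

Definition unit_ball (V : normedModType K) : set V := [set x | rnorm x <= 1].
Arguments unit_ball V : clear implicits.

(* As [sup] is real-valued, this is meaningful for bounded [f] only; it is
   applied below to compact operators, continuous functionals and their
   differences. *)
Definition opnorm (V W : normedModType K) (f : V -> W) : R :=
  sup [set rnorm (f x) | x in unit_ball V].

Definition compact_operator (V W : normedModType K) (f : {linear V -> W}) :=
  precompact (f @` unit_ball V).

Variable X : normedModType K.

(* [dual_pair x x'] is (x, x') \in \Pi(X) *)
Definition dual_pair (x : X) (x' : {linear X -> K^o}) : Prop :=
  [/\ rnorm x = 1, continuous x', opnorm x' = 1 & x' x = 1].

Definition numerical_radius (f : X -> X) : R :=
  sup [set r | exists (x : X) (x' : {linear X -> K^o}),
                 dual_pair x x' /\ r = rnorm (x' (f x))].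

Definition BPBp_nu_compact : Prop :=
  forall eps : R, 0 < eps < 1 ->
  exists eta : R, 0 < eta < 1 /\
  forall (T : {linear X -> X}) (x : X) (x' : {linear X -> K^o}),
    compact_operator T -> dual_pair x x' ->
    numerical_radius T = 1 -> 1 - eta < rnorm (x' (T x)) ->
  exists (S : {linear X -> X}) (y : X) (y' : {linear X -> K^o}),
    [/\ compact_operator S, dual_pair y y',
        numerical_radius S = 1 /\ rnorm (y' (S y)) = 1 &
        [/\ opnorm (T \- S) < eps, rnorm (x - y) < eps
          & opnorm (x' \- y') < eps]].

End BPBp_nu.

Arguments BPBp_nu_compact {R k} X.

(* Main.v *)
(** [L_p] is uniformly convex and uniformly smooth.  In such a space let [T] be compact
    with numerical radius [1 - kappa], and almost attain it at [(x, x')].  Adding to [T]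
    a small rotated multiple of the rank one operator [x' (x) x] forces every pair at
    which the new operator almost attains its numerical radius to be close to a rotation
    of [(x, x')]: uniform convexity controls the points, and uniform smoothness
    (Smulian) the functionals.  Iterating with geometrically decreasing sizes yields a
    compact limit that attains its numerical radius, which is at most [1], at a pair
    near [(x, x')]; one more rank one term makes it exactly [1].

    Bringing the numerical radius down from [1] to [1 - kappa] costs [kappa ||A||], for
    any [A] with the same numerical values as [T], so a bound on [||A||] is needed that
    does not depend on [T].  When [p <> 2] or the scalars are complex, [A = T] works:
    testing [T] on [f 1_Y + s f 1_Z] for complementary sets [Y], [Z] and two scalars [s]
    bounds the integral of [|f|^(p-1) |T f|], and this bounds [||T||].  When [p = 2] and
    the scalars are real, [A] is the symmetric part of [T]. *)

Require Import Defs.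
From HB Require Import structures.
From mathcomp Require Import all_boot all_order all_algebra.
From mathcomp Require Import complex.
From mathcomp Require Import all_classical all_reals all_analysis.
From mathcomp Require Import measurable_realfun finmap.
From mathcomp Require Import ring lra.

Set Implicit Arguments.
Unset Strict Implicit.
Unset Printing Implicit Defensive.
Import Order.TTheory GRing.Theory Num.Theory.
Import numFieldNormedType.Exports.
Local Open Scope classical_set_scope.
Local Open Scope ring_scope.

(** * Scalars, norms and completeness *)

(** On a real Hilbert space a skew operator has all numerical values 0, so the numerical radius does
    not control the norm and [T] cannot be rescaled at a bounded cost. Subtracting [kappa] times an
    [A] with the same numerical values multiplies these values by [1 - kappa] and, when [A] is the
    symmetric part, leaves the skew part alone. The room of [kappa] is there because the iteration
    may raise the numerical radius by that much: the limit still has numerical radius at most 1, and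
    a rank one term at the attaining pair lifts it to 1 without overshooting elsewhere. The required
    [eta] must be independent of [T]. Hence the tolerances of all stages are fixed before any
    operator is chosen, from the allowed errors and the moduli of convexity and smoothness alone.
    Points, functionals and operators then move by multiples of [pow2 n] at stage [n], so one notion
    of completeness yields all three limits. Compactness of operators is handled as total
    boundedness, which limits in norm preserve. *)

Section scalar_lemmas.
Context {R : realType} {k : scalar_kind}.
Local Notation K := (scalars R k).
Implicit Types a b : K.

Lemma scalar_eq a b : re a = re b -> im a = im b -> a = b.
Proof. by case: k a b => //= -[a1 a2] [b1 b2] /= -> ->. Qed.

Lemma im_ofR (x : R) : im (ofR x : K) = 0.
Proof. by case: k. Qed.

Lemma reN a : re (- a) = - re a.
Proof. by case: k a => //= -[a b]. Qed.

Lemma imN a : im (- a) = - im a.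
Proof. by case: k a => [a|[a b]] //=; rewrite oppr0. Qed.

Lemma ofR0 : ofR 0 = 0 :> K.
Proof. by case: k. Qed.

Lemma ofR1 : ofR 1 = 1 :> K.
Proof. by case: k. Qed.

Lemma ofRN (x : R) : ofR (- x) = - ofR x :> K.
Proof. by apply: scalar_eq; rewrite ?reN ?imN ?re_ofR ?im_ofR ?oppr0. Qed.

Lemma ofR_inj : injective (@ofR R k).
Proof. by move=> x y /(congr1 re); rewrite !re_ofR. Qed.

Lemma ltr_ofR (x y : R) : ((ofR x : K) < ofR y) = (x < y).
Proof. by rewrite !lt_def ler_ofR (inj_eq ofR_inj). Qed.

Lemma rnorm_ofR (x : R) : rnorm (ofR x : K) = `|x|.
Proof. by rewrite rnormE re_ofR im_ofR expr0n addr0 sqrtr_sqr. Qed.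

Lemma rnorm1 : rnorm (1 : K) = 1.
Proof. by rewrite -ofR1 rnorm_ofR normr1. Qed.

Lemma re_le_rnorm a : re a <= rnorm a.
Proof.
rewrite rnormE; apply: (le_trans (ler_norm _)).
by rewrite -sqrtr_sqr ler_sqrt ?lerDl ?addr_ge0 ?sqr_ge0.
Qed.

Lemma normr_re_le a : `|re a| <= rnorm a.
Proof. by rewrite ler_norml re_le_rnorm andbT lerNl -reN -rnormN re_le_rnorm. Qed.

Lemma normr_im_le a : `|im a| <= rnorm a.
Proof. by rewrite rnormE -sqrtr_sqr ler_sqrt ?lerDr ?addr_ge0 ?sqr_ge0. Qed.

Lemma rnorm_le_reim a : rnorm a <= `|re a| + `|im a|.
Proof.
rewrite rnormE -(ger0_norm (addr_ge0 (normr_ge0 _) (normr_ge0 _))) -sqrtr_sqr.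
rewrite ler_sqrt ?sqr_ge0// sqrrD !real_normK ?num_real//.
have := mulr_ge0 (normr_ge0 (re a)) (normr_ge0 (im a)); lra.
Qed.

Lemma sqr_rnorm a : rnorm a ^+ 2 = re a ^+ 2 + im a ^+ 2.
Proof. by rewrite rnormE sqr_sqrtr// addr_ge0 ?sqr_ge0. Qed.

Lemma rnorm_neq0 a : a != 0 -> rnorm a != 0.
Proof. by apply: contra_neq => /rnorm_eq0. Qed.

Lemma rnormV a : rnorm a^-1 = (rnorm a)^-1.
Proof.
have [->|a0] := eqVneq a 0; first by rewrite invr0 rnorm0 invr0.
have ra0 : rnorm a != 0 := rnorm_neq0 a0.
by apply: (mulIf ra0); rewrite -rnormM !mulVf// rnorm1.
Qed.

Lemma rnorm1_neq0 a : rnorm a = 1 -> a != 0.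
Proof. by move=> a1; apply/eqP => a0; move/eqP: a1; rewrite a0 rnorm0 eq_sym oner_eq0. Qed.

Lemma phaseP a : exists2 u : K, rnorm u = 1 & u * a = ofR (rnorm a).
Proof.
have [->|a0] := eqVneq a 0.
  by exists 1; rewrite ?rnorm1// mulr0 rnorm0 ofR0.
have ra0 : rnorm a != 0 := rnorm_neq0 a0.
exists (ofR (rnorm a) / a); last by rewrite -mulrA mulVf ?mulr1.
by rewrite rnormM rnorm_ofR rnormV ger0_norm ?rnorm_ge0// divff.
Qed.

(** For real scalars [y] is discarded, so both kinds of scalars are built from two coordinates in
    the same way. *)
Definition of_reim (x y : R) : K :=
  match k return scalars R k with real_scalars => x | complex_scalars => Complex x y end.

Lemma re_of_reim x y : re (of_reim x y) = x.
Proof. by rewrite /of_reim; case: k. Qed.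

Lemma im_of_reim x y : im (of_reim x y) = if k is real_scalars then 0 else y.
Proof. by rewrite /of_reim; case: k. Qed.

Lemma im_trivial : (forall a, im a = 0) \/
  (forall x : R, (if k is real_scalars then 0 else x) = x).
Proof. by case: k; [left|right]. Qed.

Lemma of_reimD x y x' y' : of_reim (x + x') (y + y') = of_reim x y + of_reim x' y'.
Proof.
by apply: scalar_eq; rewrite ?reD ?imD ?re_of_reim ?im_of_reim//; case: k; rewrite ?addr0.
Qed.

Lemma of_reimM a x y :
  of_reim (re a * x - im a * y) (re a * y + im a * x) = a * of_reim x y.
Proof.
by move: a; rewrite /of_reim; case: k => [a|[a b]] //=; rewrite mul0r subr0.
Qed.

End scalar_lemmas.

Section normed_lemmas.
Context {R : realType} {k : scalar_kind} {V : normedModType (scalars R k)}.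
Local Notation K := (scalars R k).
Implicit Types (x y z : V) (a : K).

Lemma nrmK x : ofR (rnorm x) = `|x| :> K.
Proof.
rewrite /rnorm; have := normr_ge0 x; move: (`|x|); case: k => //= -[a b].
by rewrite lecE /= => /andP[/eqP -> _].
Qed.

Lemma nrm_ge0 x : 0 <= rnorm x.
Proof. by rewrite -(@ler_ofR R k) nrmK ofR0. Qed.

Lemma nrmD x y : rnorm (x + y) <= rnorm x + rnorm y.
Proof. by rewrite -(@ler_ofR R k) ofRD !nrmK ler_normD. Qed.

Lemma nrmZ a x : rnorm (a *: x) = rnorm a * rnorm x.
Proof. by apply: (@ofR_inj R k); rewrite ofRM !nrmK normrZ rnormK. Qed.

Lemma nrmZR (r : R) x : rnorm (ofR r *: x) = `|r| * rnorm x.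
Proof. by rewrite nrmZ rnorm_ofR. Qed.

Lemma nrmN x : rnorm (- x) = rnorm x.
Proof. by rewrite /rnorm normrN. Qed.

Lemma nrm0 : rnorm (0 : V) = 0.
Proof. by apply: (@ofR_inj R k); rewrite nrmK normr0 ofR0. Qed.

Lemma nrm0_eq0 x : rnorm x = 0 -> x = 0.
Proof. by move=> h; apply/eqP; rewrite -normr_eq0 -nrmK h ofR0. Qed.

Lemma nrm_distC x y : rnorm (x - y) = rnorm (y - x).
Proof. by rewrite -opprB nrmN. Qed.

Lemma nrm_distD z x y : rnorm (x - y) <= rnorm (x - z) + rnorm (z - y).
Proof. by apply: le_trans (nrmD _ _); rewrite addrA subrK. Qed.

Lemma nrmB x y : rnorm (x - y) <= rnorm x + rnorm y.
Proof. by rewrite -[rnorm y]nrmN nrmD. Qed.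

Lemma nrm_leB x y : rnorm x - rnorm y <= rnorm (x - y).
Proof. by rewrite lerBlDr; apply: le_trans (nrmD _ _); rewrite subrK. Qed.

Lemma nrm_gt0 x : x != 0 -> 0 < rnorm x.
Proof. by rewrite lt_def nrm_ge0 andbT; apply: contra_neq => /nrm0_eq0. Qed.

Lemma nrm_unit x : x != 0 -> rnorm (ofR (rnorm x)^-1 *: x) = 1.
Proof.
move=> x0; have rx0 : rnorm x != 0 by rewrite gt_eqF// nrm_gt0.
by rewrite nrmZR ger0_norm ?invr_ge0 ?nrm_ge0// mulVf.
Qed.

Lemma nbhs_rnorm x (A : set V) :
  nbhs x A <-> exists2 e : R, 0 < e & forall y, rnorm (x - y) < e -> A y.
Proof.
split=> [/nbhs_ballP[e e0 eA]|[e e0 eA]]; last first.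
  apply/nbhs_ballP; exists (ofR e : K); first by rewrite /= -ofR0 ltr_ofR.
  by move=> y; rewrite -ball_normE /= -nrmK ltr_ofR; exact: eA.
have eE : e = ofR (re e).
  by rewrite -{1}(gtr0_norm e0) -rnormK /rnorm gtr0_norm.
exists (re e) => [|y h]; first by rewrite -(@ltr_ofR R k) -eE ofR0.
by apply: eA; rewrite -ball_normE /= -nrmK eE ltr_ofR.
Qed.

Lemma eq_of_rnorm x y : (forall e : R, 0 < e -> rnorm (x - y) <= e) -> x = y.
Proof.
move=> h; apply/eqP; rewrite -subr_eq0; apply/eqP/nrm0_eq0/le_anti.
by rewrite nrm_ge0 andbT; apply/ler_addgt0Pr => e e0; rewrite add0r h.
Qed.

End normed_lemmas.

Section dyadic.
Context {R : realType}.

(** A negative power of two, despite the name: the common rate of convergence. *)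
Definition pow2 (n : nat) : R := 2^-1 ^+ n.

Lemma pow2_gt0 n : 0 < pow2 n.
Proof. by rewrite exprn_gt0. Qed.

Lemma pow2S n : pow2 n.+1 = pow2 n / 2.
Proof. by rewrite /pow2 exprSr. Qed.

Lemma pow2_lt (c e : R) : 0 < e -> exists n, c * pow2 n < e.
Proof.
move=> e0; have /cvgrPdist_lt/(_ _ e0)[N _ /(_ N (leqnn N))] :
    (fun n => c * pow2 n) @ \oo --> c * 0.
  apply: cvgM; first exact: cvg_cst.
  by apply: (@cvg_expr R); rewrite ger0_norm// invf_lt1// ltr1n.
by rewrite /= mulr0 sub0r normrN => h; exists N; apply: le_lt_trans h; exact: ler_norm.
Qed.

Lemma pow2_lt_after (c e : R) : 0 < e -> 0 <= c ->
  exists N, forall n, (N <= n)%N -> c * pow2 n < e.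
Proof.
move=> e0 c0; have [N h] := pow2_lt c e0; exists N => n Nn; apply: le_lt_trans h.
rewrite ler_wpM2l// /pow2 -(subnK Nn) exprD ler_piMl ?exprn_ge0//.
by rewrite exprn_ile1// invf_le1// ler1n.
Qed.

End dyadic.

Section rapid_completeness.
Context {R : realType} {k : scalar_kind}.
Local Notation K := (scalars R k).

(* Completeness of a metric space is decided by its rapidly Cauchy sequences. *)
Definition rapidly_complete (V : normedModType K) := forall (u : nat -> V) (c : R),
  (forall n, rnorm (u n.+1 - u n) <= c * pow2 n) ->
  exists l, forall n, rnorm (l - u n) <= 2 * c * pow2 n.

(** The geometric sum is kept in exact form so that the induction on [m] closes. *)
Lemma rapid_dist (V : normedModType K) (u : nat -> V) (c : R) :
  (forall n, rnorm (u n.+1 - u n) <= c * pow2 n) ->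
  forall n m, rnorm (u (n + m)%N - u n) <= 2 * c * (pow2 n - pow2 (n + m)%N).
Proof.
move=> h n; elim=> [|m ih]; first by rewrite addn0 !subrr mulr0 nrm0.
apply: le_trans (nrm_distD (u (n + m)%N) _ _) _; rewrite addnS.
by have := h (n + m)%N; move: ih; rewrite pow2S; lra.
Qed.

Lemma rapid_coef_ge0 (V : normedModType K) (u : nat -> V) (c : R) :
  (forall n, rnorm (u n.+1 - u n) <= c * pow2 n) -> 0 <= c.
Proof.
by move=> /(_ 0%N); rewrite /pow2 expr0 mulr1; apply: le_trans; exact: nrm_ge0.
Qed.

(** The intervals of radius [2 * c * pow2 n] around [u n] meet pairwise, so the supremum of their
    left endpoints lies in all of them. *)
Lemma real_rapid_limit (u : nat -> R) (c : R) : 0 <= c ->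
  (forall n m, `|u (n + m)%N - u n| <= 2 * c * (pow2 n - pow2 (n + m)%N)) ->
  exists l, forall n, `|l - u n| <= 2 * c * pow2 n.
Proof.
move=> c0 h; pose E := range (fun n => u n - 2 * c * pow2 n).
have ub n m : u n - 2 * c * pow2 n <= u m + 2 * c * pow2 m.
  have := mulr_ge0 c0 (ltW (@pow2_gt0 R n)); have := mulr_ge0 c0 (ltW (@pow2_gt0 R m)).
  have [nm|/ltnW mn] := leqP n m.
    by have := h n (m - n)%N; rewrite subnKC// ler_norml => /andP[]; lra.
  by have := h m (n - m)%N; rewrite subnKC// ler_norml => /andP[]; lra.
have Esup : has_sup E.
  split; first by exists (u 0%N - 2 * c * pow2 0%N); exists 0%N.
  by exists (u 0%N + 2 * c * pow2 0%N) => _ [n _ <-]; exact: ub.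
exists (sup E) => n; rewrite ler_norml; apply/andP; split.
  have /ubP/(_ (u n - 2 * c * pow2 n)) := sup_upper_bound Esup.
  by move=> /(_ (ex_intro2 _ _ n I erefl)); lra.
rewrite lerBlDr addrC; apply: ge_sup; first by case: Esup.
by move=> _ [m _ <-]; exact: ub.
Qed.

Lemma scalar_rapidly_complete : rapidly_complete K^o.
Proof.
move=> u c h; have c0 := rapid_coef_ge0 h; have d := rapid_dist h.
have [||lr hr] := @real_rapid_limit (fun n => re (u n : K)) c => //.
  by move=> n m; rewrite -reN -reD; apply: le_trans (d n m); exact: normr_re_le.
have [||li hi] := @real_rapid_limit (fun n => im (u n : K)) c => //.
  by move=> n m; rewrite -imN -imD; apply: le_trans (d n m); exact: normr_im_le.
have [l [lre lim]] : exists l : K, re l = lr /\ im l = li.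
  clear d; case: k u h hr hi => /= u h hr hi; last by exists (Complex lr li).
  exists lr; split => //; apply/esym/eqP; rewrite -normr_eq0; apply/eqP/le_anti.
  rewrite normr_ge0 andbT; apply/ler_addgt0Pr => e e0; rewrite add0r.
  have [n hn] := pow2_lt (2 * c) e0; apply: le_trans (ltW hn).
  by have := hi n; rewrite subr0.
exists l => n; apply/ler_addgt0Pr => e e0.
(* Adding the errors of the two coordinates at [n] would double the constant. At the later index
   [n + N] this sum is below [e], and [rapid_dist] gives the sharp constant between [n] and
   [n + N]. *)
have [N hN] := pow2_lt_after e0 (mulr_ge0 (ler0n _ 4) c0).
have {}hN := hN (n + N)%N (leq_addl _ _).
apply: le_trans (nrm_distD (u (n + N)%N) _ _) _; rewrite addrC; apply: lerD.
  apply: le_trans (d n N) _; rewrite ler_wpM2l ?mulr_ge0//.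
  by rewrite lerBlDr lerDl ltW// pow2_gt0.
apply: le_trans (ltW hN); apply: le_trans (rnorm_le_reim _) _.
rewrite reD imD reN imN lre lim; have := hr (n + N)%N; have := hi (n + N)%N; lra.
Qed.

End rapid_completeness.

(** * Total boundedness and its equivalence with precompactness *)

Section total_boundedness.
Context {R : realType} {k : scalar_kind}.
Local Notation K := (scalars R k).

(** The centres may lie outside [E], which makes the notion pass to subsets at once. *)
Definition totally_bounded (V : normedModType K) (E : set V) := forall e : R, 0 < e ->
  exists s : seq V, forall v, E v -> exists2 c, c \in s & rnorm (v - c) < e.

Lemma precompact_totally_bounded (V : normedModType K) (E : set V) :
  precompact E -> totally_bounded E.
Proof.
rewrite precompactE compact_cover => cE e e0.
have [|x _|D _ cov] := cE V setT (fun x => interior [set y | rnorm (x - y) < e]).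
- by move=> x _; exact: open_interior.
- by exists x => //; apply/nbhs_rnorm; exists e.
exists D => v Ev; have [c Dc] := cov v (subset_closure Ev).
by move=> /interior_subset /= cv; exists c => //; rewrite nrm_distC.
Qed.

Lemma ultra_mem_seq (T : Type) (I : eqType) (F : set_system T) (s : seq I)
    (P : I -> set T) : UltraFilter F ->
  F [set v | exists2 c, c \in s & P c v] -> exists2 c, c \in s & F (P c).
Proof.
move=> FU; elim: s => [h|c s ih h].
  by have [v [c]] := filter_ex h.
have [Fc|Fc] := in_ultra_setVsetC (P c) FU; first by exists c; rewrite ?mem_head.
have [|c' c's Fc'] := ih; last by exists c' => //; rewrite inE c's orbT.
apply: filterS2 h Fc => v [c']; rewrite inE => /orP[/eqP ->//|c's Pc' _].
by exists c'.
Qed.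

(** An ultrafilter on the closure of [E] contains a ball of radius [pow2 n] for every [n], by
    pigeonhole on a finite net. Consecutive balls meet, so their centres are rapidly Cauchy, and the
    ultrafilter converges to the limit of the centres. *)
Lemma totally_bounded_precompact (V : normedModType K) (E : set V) :
  rapidly_complete V -> totally_bounded E -> precompact E.
Proof.
move=> Vc tE; rewrite precompactE compact_ultra => F FU FE.
have small n : exists c : V, F [set v | rnorm (v - c) < pow2 n].
  have [s hs] := tE _ (@pow2_gt0 R n.+1).
  have [|c _ Fc] := @ultra_mem_seq _ _ F s (fun c => [set v | rnorm (v - c) < pow2 n]).
    apply: filterS FE => v /(_ [set w | rnorm (v - w) < pow2 n.+1])[].
      by apply/nbhs_rnorm; exists (pow2 n.+1) => //; exact: pow2_gt0.
    move=> w [Ew] /= vw; have [c cs wc] := hs w Ew; exists c => //=.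
    by apply: le_lt_trans (nrm_distD w _ _) _; move: vw wc; rewrite pow2S; lra.
  by exists c.
have [c hc] := choice small.
(* Increments of at most [2 * pow2 n] put the limit within [4 * pow2 n] of [c n]; the radius of the
   ball makes this the 5 below. *)
have [n|l hl] := Vc c 2.
  have [v [/= v1 v2]] := filter_ex (filterI (hc n) (hc n.+1)).
  apply: le_trans (nrm_distD v _ _) _; rewrite nrm_distC.
  by move: v1 v2; rewrite pow2S; have := @pow2_gt0 R n; lra.
have Fl : F --> l.
  move=> A /nbhs_rnorm[e e0 eA]; have [n hn] := @pow2_lt R 5 e e0.
  apply: filterS (hc n) => v /= vc; apply: eA; apply: le_lt_trans hn.
  apply: le_trans (nrm_distD (c n) _ _) _; rewrite [rnorm (c n - v)]nrm_distC.
  by have := hl n; move: vc; lra.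
exists l; split => //; apply: (@closed_cvg _ _ F _ id (closure E)) => //.
exact: closed_closure.
Qed.

Lemma totally_bounded_sub (V : normedModType K) (E F : set V) :
  E `<=` F -> totally_bounded F -> totally_bounded E.
Proof. by move=> EF tF e e0; have [s hs] := tF e e0; exists s => v /EF/hs. Qed.

Lemma totally_bounded_approx (V : normedModType K) (E : set V) :
  (forall e : R, 0 < e -> exists2 F, totally_bounded F &
     forall v, E v -> exists2 w, F w & rnorm (v - w) < e) ->
  totally_bounded E.
Proof.
move=> h e e0; have [F tF EF] := h (e / 2) (divr_gt0 e0 (ltr0n _ 2)).
have [s hs] := tF (e / 2) (divr_gt0 e0 (ltr0n _ 2)).
exists s => v /EF[w Fw vw]; have [c cs wc] := hs w Fw; exists c => //.
by apply: le_lt_trans (nrm_distD w _ _) _; lra.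
Qed.

(** A net for [f] arises by choosing one index in each ball of radius [e' / 2] of a net for [g] and
    applying [f] to it; balls that contain no value of [g] get the dummy centre 0. *)
Lemma totally_bounded_pullback (V W : normedModType K) (I : Type) (E : set I)
    (f : I -> V) (g : I -> W) :
  (forall e : R, 0 < e -> exists2 e' : R, 0 < e' & forall i j, E i -> E j ->
     rnorm (g i - g j) < e' -> rnorm (f i - f j) < e) ->
  totally_bounded (g @` E) -> totally_bounded (f @` E).
Proof.
move=> h tg e e0; have [e' e'0 he] := h e e0.
have [s hs] := tg (e' / 2) (divr_gt0 e'0 (ltr0n _ 2)).
pose F (c : W) : V := if pselect (exists2 i, E i & rnorm (g i - c) < e' / 2) is left P
  then f (s2val (cid2 P)) else 0.
exists (map F s) => _ [i Ei <-]; have [|c cs ic] := hs (g i); first by exists i.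
exists (F c); first exact: map_f.
rewrite /F; case: pselect => [P|[]]; last by exists i.
case: (cid2 P) => /= j Ej jc; apply: he => //.
by apply: le_lt_trans (nrm_distD c _ _) _; rewrite (nrm_distC c); lra.
Qed.

Lemma totally_boundedD (V : normedModType K) (E F : set V) :
  totally_bounded E -> totally_bounded F ->
  totally_bounded [set x.1 + x.2 | x in E `*` F].
Proof.
move=> tE tF e e0; have e'0 : 0 < e / 2 by rewrite divr_gt0.
have [s hs] := tE _ e'0; have [t ht] := tF _ e'0.
exists [seq a + b | a <- s, b <- t] => _ [[u v] /= [Eu Fv] <-].
have [a sa ua] := hs _ Eu; have [b tb vb] := ht _ Fv.
exists (a + b); first by apply/allpairsP; exists (a, b).
rewrite opprD addrACA; apply: le_lt_trans (nrmD _ _) _; lra.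
Qed.

Lemma real_net (e : R) : 0 < e ->
  exists s : seq R, forall x, `|x| <= 1 -> exists2 c, c \in s & `|x - c| < e.
Proof.
move=> e0; exists [seq -1 + e * i%:R | i <- iota 0 (Num.truncn (2 / e)).+1].
move=> x; rewrite ler_norml => /andP[x1 x2].
have y0 : 0 <= (x + 1) / e by rewrite divr_ge0 ?(ltW e0)//; lra.
pose n := Num.truncn ((x + 1) / e); exists (-1 + e * n%:R).
  apply/mapP; exists n => //; rewrite mem_iota /= add0n ltnS.
  by apply: le_truncn; rewrite ler_pM2r ?invr_gt0//; lra.
have /andP[n1 n2] := truncn_itv y0.
rewrite (_ : x - _ = e * ((x + 1) / e - n%:R)); last by field; rewrite gt_eqF.
rewrite normrM gtr0_norm// gtr_pMr// ltr_norml; apply/andP; split; rewrite /n.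
  by lra.
by move: n2; rewrite -natr1; lra.
Qed.

Lemma totally_bounded_disc : totally_bounded (@unit_ball R k K^o).
Proof.
move=> e e0; have [t ht] := real_net (divr_gt0 e0 (ltr0n _ 2)).
suff [s hs] : exists s : seq K, forall a b : R, a \in t -> b \in t ->
    exists2 c, c \in s & forall v : K, `|re v - a| < e / 2 -> `|im v - b| < e / 2 ->
    rnorm (v - c) < e.
  exists s => v v1.
  have [a ta va] := ht _ (le_trans (normr_re_le (v : K)) v1).
  have [b tb vb] := ht _ (le_trans (normr_im_le (v : K)) v1).
  by have [c sc hc] := hs a b ta tb; exists c => //; exact: hc.
case: k => /=.
  exists t => a b ta tb; exists a => // v va _.
  by rewrite /rnorm /=; move: va; lra.
exists [seq Complex a b | a <- t, b <- t] => a b ta tb.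
exists (Complex a b); first by apply/allpairsP; exists (a, b).
move=> v va vb; apply: le_lt_trans (rnorm_le_reim (k := complex_scalars) _) _.
by move: va vb; rewrite !reD !imD !reN !imN /=; lra.
Qed.

End total_boundedness.

(** * Compact operators and dual pairs *)

Section operators.
Context {R : realType} {k : scalar_kind}.
Local Notation K := (scalars R k).

Lemma exists_linear (V W : normedModType K) (f : V -> W) :
  (forall a x y, f (a *: x + y) = a *: f x + f y) ->
  exists g : {linear V -> W}, forall x, g x = f x.
Proof.
move=> fl; pose m := GRing.isLinear.Build K V W _ f fl.
by exists (HB.pack_for {linear V -> W} f m).
Qed.

Lemma rnorm_linear_le (V W : normedModType K) (f : {linear V -> W}) (c : R) :
  (forall x, rnorm x = 1 -> rnorm (f x) <= c) -> forall x, rnorm (f x) <= c * rnorm x.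
Proof.
move=> h x; have [->|x0] := eqVneq x 0; first by rewrite linear0 !nrm0 mulr0.
have rx : 0 < rnorm x by exact: nrm_gt0.
have := h _ (nrm_unit x0); rewrite linearZ /= nrmZR ger0_norm ?invr_ge0 ?nrm_ge0//.
by rewrite mulrC ler_pdivrMr.
Qed.

Lemma rnorm_linear_ball (V W : normedModType K) (f : {linear V -> W}) (c : R) :
  (forall x, unit_ball x -> rnorm (f x) <= c) -> forall x, rnorm (f x) <= c * rnorm x.
Proof. by move=> h; apply: rnorm_linear_le => x x1; apply: h; rewrite /unit_ball /= x1. Qed.

Lemma opnorm_le (V W : normedModType K) (f : V -> W) (c : R) : 0 <= c ->
  (forall x, rnorm (f x) <= c * rnorm x) -> opnorm f <= c.
Proof.
move=> c0 h; apply: ge_sup.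
  by exists (rnorm (f 0)); exists 0; rewrite // /unit_ball /= nrm0.
by move=> _ [x x1 <-]; apply: le_trans (h x) _; exact: ler_piMr.
Qed.

(** [sup] is 0 on a set without supremum, so a nonzero value certifies that [f] is bounded. *)
Lemma opnorm_bound (V W : normedModType K) (f : {linear V -> W}) :
  opnorm f != 0 -> forall x, rnorm (f x) <= opnorm f * rnorm x.
Proof.
move=> f0; have [fs|/sup_out fs] := pselect (has_sup [set rnorm (f x) | x in @unit_ball R k V]).
  apply: rnorm_linear_ball => x x1.
  by have /ubP := sup_upper_bound fs; apply; exists x.
by move: f0; rewrite /opnorm fs eqxx.
Qed.

Lemma bounded_linear_continuous (V W : normedModType K) (f : {linear V -> W}) (c : R) :
  (forall x, rnorm (f x) <= c * rnorm x) -> continuous f.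
Proof.
move=> h x A /nbhs_rnorm[e e0 eA]; apply/nbhs_rnorm.
exists (e / (`|c| + 1)) => [|y xy]; first by rewrite divr_gt0// ltr_wpDl.
apply: eA; rewrite -linearB; apply: le_lt_trans (h _) _.
apply: (@le_lt_trans _ _ ((`|c| + 1) * rnorm (x - y))).
  by rewrite ler_wpM2r ?nrm_ge0// (le_trans (ler_norm _))// lerDl.
by rewrite mulrC -ltr_pdivlMr// ltr_wpDl.
Qed.

Lemma totally_bounded_norm (V : normedModType K) (E : set V) : totally_bounded E ->
  exists2 M : R, 0 <= M & forall v, E v -> rnorm v <= M.
Proof.
move=> /(_ 1 ltr01)[s hs]; exists (\sum_(c <- s) rnorm c + 1).
  by rewrite addr_ge0// sumr_ge0// => c _; exact: nrm_ge0.
move=> v /hs[c cs vc]; apply: (@le_trans _ _ (rnorm c + 1)).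
  by have := nrm_leB v c; lra.
rewrite lerD2r (big_rem c cs) /= lerDl sumr_ge0// => ? _; exact: nrm_ge0.
Qed.

(** The working form of [compact_operator], equivalent to it when the target is complete. It speaks
    of plain functions, so that limits and combinations can be treated before they are bundled as
    linear maps. *)
Definition compact_op (V W : normedModType K) (f : V -> W) :=
  totally_bounded (f @` @unit_ball R k V).

Lemma compact_op_bounded (V W : normedModType K) (f : {linear V -> W}) : compact_op f ->
  exists2 M : R, 0 <= M & forall x, rnorm (f x) <= M * rnorm x.
Proof.
move=> /totally_bounded_norm[M M0 hM]; exists M => //.
by apply: rnorm_linear_ball => x x1; apply: hM; exists x.
Qed.

Lemma compact_op_lincomb (V W : normedModType K) (f g h : V -> W) (a : K) :
  (forall x, h x = f x + a *: g x) -> compact_op f -> compact_op g -> compact_op h.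
Proof.
move=> hE tf tg; apply: totally_bounded_sub (totally_boundedD tf _); last first.
  apply: (totally_bounded_pullback (g := g) (f := fun x => a *: g x)) tg => e e0.
  exists (e / (rnorm a + 1)); first by rewrite divr_gt0// ltr_wpDl// rnorm_ge0.
  move=> i j _ _ ij; rewrite -scalerBr nrmZ.
  apply: (@le_lt_trans _ _ ((rnorm a + 1) * rnorm (g i - g j))).
    by rewrite ler_wpM2r ?nrm_ge0// lerDl.
  by rewrite mulrC -ltr_pdivlMr// ltr_wpDl// rnorm_ge0.
move=> _ [x x1 <-] /=; exists (f x, a *: g x); last by rewrite /= hE.
by split; exists x.
Qed.

Lemma compact_op_rank1 (V W : normedModType K) (phi : V -> K^o) (y : W) :
  (forall x, rnorm (phi x) <= rnorm x) -> compact_op (fun x => phi x *: y).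
Proof.
move=> h; apply: (totally_bounded_pullback (g := phi)) => [e e0|].
  exists (e / (rnorm y + 1)); first by rewrite divr_gt0// ltr_wpDl// nrm_ge0.
  move=> i j _ _ ij; rewrite -scalerBl nrmZ.
  apply: (@le_lt_trans _ _ (rnorm (phi i - phi j) * (rnorm y + 1))).
    by rewrite ler_wpM2l ?nrm_ge0// lerDl.
  by rewrite -ltr_pdivlMr// ltr_wpDl// nrm_ge0.
apply: totally_bounded_sub (@totally_bounded_disc R k) => _ [x x1 <-].
exact: le_trans (h x) x1.
Qed.

Lemma compact_op_limit (V W : normedModType K) (f : V -> W) :
  (forall e : R, 0 < e -> exists2 g : V -> W, compact_op g &
     forall x, unit_ball x -> rnorm (f x - g x) < e) -> compact_op f.
Proof.
move=> h; apply: totally_bounded_approx => e e0; have [g tg fg] := h e e0.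
exists (g @` @unit_ball R k V) => // _ [x x1 <-].
by exists (g x); [exists x|exact: fg].
Qed.

Lemma compact_operatorP (V W : normedModType K) (f : {linear V -> W}) :
  rapidly_complete W -> compact_operator f <-> compact_op f.
Proof.
move=> Wc; split; first exact: precompact_totally_bounded.
exact: totally_bounded_precompact.
Qed.

End operators.

(** * Numerical values, and what convexity and smoothness say about dual pairs *)

Section dual_pairs.
Context {R : realType} {k : scalar_kind} {X : normedModType (scalars R k)}.
Local Notation K := (scalars R k).
Implicit Types T : {linear X -> X}.

Lemma dual_pair_le (x : X) (x' : {linear X -> K^o}) : dual_pair x x' ->
  forall h, rnorm (x' h) <= rnorm h.
Proof.
move=> [_ _ n1 _] h; have := @opnorm_bound R k X K^o x'.
by rewrite n1 => /(_ (oner_neq0 _) h); rewrite mul1r.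
Qed.

Lemma dual_pairI (x : X) (x' : {linear X -> K^o}) :
  rnorm x = 1 -> (forall h, rnorm (x' h) <= rnorm h) ->
  x' x = 1 -> dual_pair x x'.
Proof.
move=> x1 h xx; have h1 z : rnorm (x' z) <= 1 * rnorm z by rewrite mul1r.
split => //; first exact: bounded_linear_continuous h1.
apply/le_anti; rewrite opnorm_le//=; apply: sup_ubound.
  by exists 1 => _ [z z1 <-]; apply: le_trans (h z) z1.
by exists x; [rewrite /unit_ball /= x1|rewrite xx /= rnorm1].
Qed.

(** The functional is divided by the factor that multiplies the point, so the numerical value of a
    linear operator at the pair is unchanged. *)
Lemma dual_pair_rotate (c : K) (x : X) (x' : {linear X -> K^o}) : rnorm c = 1 -> dual_pair x x' ->
  exists2 y', dual_pair (c *: x) y' & forall h, y' h = c^-1 * x' h.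
Proof.
move=> c1 p; have [|y' hy'] := @exists_linear R k X K^o (fun h => c^-1 *: x' h).
  by move=> a u v; rewrite /= linearP scalerDr !scalerA mulrC.
have c0 : c != 0 by exact: rnorm1_neq0.
exists y' => //; case: (p) => x1 _ _ xx; apply: dual_pairI.
- by rewrite nrmZ c1 x1 mul1r.
- move=> h; rewrite hy' nrmZ rnormV c1 invr1 mul1r; exact: dual_pair_le p h.
- by rewrite hy' linearZ /= xx scalerA mulVf// scale1r.
Qed.

Definition numerical_bound (f : X -> X) (c : R) :=
  forall (x : X) (x' : {linear X -> K^o}), dual_pair x x' -> rnorm (x' (f x)) <= c.

Lemma numerical_radius_attained (f : X -> X) (c : R) (x : X) (x' : {linear X -> K^o}) :
  numerical_bound f c ->
  dual_pair x x' -> rnorm (x' (f x)) = c -> numerical_radius f = c.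
Proof.
move=> fc p pc; apply/le_anti/andP; split.
  by apply: ge_sup => [|_ [y [y' [q ->]]]]; [exists c, x, x'|exact: fc].
apply: sup_ubound; last by exists x, x'.
by exists c => _ [y [y' [q ->]]]; exact: fc.
Qed.

(** The value 1 excludes the default 0 of [sup] on unbounded sets. *)
Lemma numerical_radius_bound T : numerical_radius T = 1 -> numerical_bound T 1.
Proof.
move=> n1 x x' p.
set E := [set r | exists (x : X) (x' : {linear X -> K^o}),
  dual_pair x x' /\ r = rnorm (x' (T x))].
have [/sup_upper_bound/ubP sE|/sup_out sE] := pselect (has_sup E).
  by rewrite -n1; apply: sE; exists x, x'.
by move/eqP: n1; rewrite /numerical_radius -/E sE eq_sym oner_eq0.
Qed.

Lemma exists_near_numerical_radius (f : X -> X) (c : R) (x : X) (x' : {linear X -> K^o}) :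
  dual_pair x x' ->
  numerical_bound f c -> exists N, [/\ N <= c, numerical_bound f N &
    forall e : R, 0 < e -> exists (z : X) (z' : {linear X -> K^o}),
      dual_pair z z' /\ N - e < rnorm (z' (f z))].
Proof.
move=> p fc; pose E := [set r | exists (z : X) (z' : {linear X -> K^o}),
  dual_pair z z' /\ r = rnorm (z' (f z))].
have sE : has_sup E.
  split; first by exists (rnorm (x' (f x))), x, x'.
  by exists c => _ [z [z' [q ->]]]; exact: fc.
exists (sup E); split.
- by apply: ge_sup => [|_ [z [z' [q ->]]]]; [case: sE|exact: fc].
- by move=> z z' q; have /ubP := sup_upper_bound sE; apply; exists z, z'.
- by move=> e e0; have [_ [z [z' [q ->]]] h] := sup_adherent e0 sE; exists z, z'.
Qed.

Definition uniformly_convex := forall e : R, 0 < e -> exists2 d : R, 0 < d &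
  forall x z : X, rnorm x = 1 -> rnorm z = 1 -> 2 - d < rnorm (x + z) -> rnorm (x - z) < e.

(** The modulus of smoothness at [t] is at most [t * e / 2]. One [t] for each [e] is what the
    pairing argument below consumes. *)
Definition uniformly_smooth := forall e : R, 0 < e -> exists2 t : R, 0 < t &
  forall x h : X, rnorm x = 1 -> rnorm h <= 1 ->
  rnorm (x + ofR t *: h) + rnorm (x - ofR t *: h) <= 2 + t * e.

(** The value of [x'] at [x + z] has real part above [2 - d], hence so has the norm of [x + z]. *)
Lemma uniformly_convex_dual : uniformly_convex ->
  forall e : R, 0 < e -> exists2 d : R, 0 < d &
    forall (x : X) (x' : {linear X -> K^o}) (z : X), dual_pair x x' ->
    rnorm z = 1 -> 1 - d < re (x' z : K) -> rnorm (x - z) < e.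
Proof.
move=> uc e e0; have [d d0 hd] := uc e e0; exists d => // x x' z p z1 xz.
have [x1 _ _ xx] := p; apply: hd => //.
apply: lt_le_trans (dual_pair_le p _); apply: lt_le_trans (re_le_rnorm _).
by rewrite linearD reD xx -(@ofR1 R k) re_ofR; lra.
Qed.

(* Smulian: pairing [x + t h] with [x'] and [y - t h] with [y'] bounds [t (x' - y') h]. *)
Lemma uniformly_smooth_dual : uniformly_smooth ->
  forall e : R, 0 < e -> exists2 d : R, 0 < d &
    forall (x : X) (x' : {linear X -> K^o}) (y : X) (y' : {linear X -> K^o}),
    dual_pair x x' ->
    dual_pair y y' -> rnorm (x - y) < d -> forall h, rnorm (x' h - y' h) <= e * rnorm h.
Proof.
move=> us e e0; have e20 : 0 < e / 2 by lra.
(* Half of [e] pays for the smoothness defect, half for replacing [y] by [x] in the second norm. *)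
have [t t0 ht] := us _ e20; exists (t * (e / 2)) => [|x x' y y' p q xy h].
  by rewrite mulr_gt0.
have [x1 _ _ xx] := p; have [y1 _ _ yy] := q.
have [|D hD] := @exists_linear R k X K^o (fun h => x' h - y' h).
  by move=> a u v; rewrite /= (linearP x') (linearP y') scalerBr opprD addrACA.
rewrite -hD; apply: rnorm_linear_le => {}h h1.
have [u u1 hu] := phaseP (D h : K).
have : t * rnorm (D h) <= t * e; last by rewrite ler_pM2l.
pose g := u *: h; have g1 : rnorm g <= 1 by rewrite nrmZ u1 h1 mulr1.
have Dg : x' g - y' g = ofR (rnorm (D h)).
  by rewrite -hu -hD linearZ.
have A : re (x' (x + ofR t *: g) : K) <= rnorm (x + ofR t *: g).
  by apply: le_trans (re_le_rnorm _) (dual_pair_le p _).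
have B : re (y' (y - ofR t *: g) : K) <= rnorm (y - ofR t *: g).
  by apply: le_trans (re_le_rnorm _) (dual_pair_le q _).
have C : rnorm (y - ofR t *: g) <= rnorm (x - y) + rnorm (x - ofR t *: g).
  have -> : y - ofR t *: g = (y - x) + (x - ofR t *: g) by rewrite addrA subrK.
  by rewrite (nrm_distC x y) nrmD.
have reZ (a : R) (b : K) : re (ofR a * b) = a * re b.
  by rewrite reM re_ofR im_ofR mul0r subr0.
have re1 : re (1 : K) = 1 by rewrite -(@ofR1 R k) re_ofR.
move: A; rewrite (linearD x') (linearZ_LR x') /= reD xx re1 reZ => A.
move: B; rewrite (linearB y') (linearZ_LR y') /= reD reN yy re1 reZ => B.
have := congr1 re Dg; rewrite reD reN re_ofR; move: A B C.
have := ht x g x1 g1; have := mulr_gt0 t0 e0.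
move: (re (x' g : K)) (re (y' g : K)) (rnorm (D h)) => a b c.
nra.
Qed.

End dual_pairs.

Arguments uniformly_convex {R k} X.
Arguments uniformly_smooth {R k} X.

(** * The perturbation argument *)

(** Dependent choice where the invariant [P] and the link [Q] vary with the stage, as the tolerances
    of the iteration do. *)
Lemma indexed_choice (S : Type) (P : nat -> S -> Prop) (Q : nat -> S -> S -> Prop) s0 :
  P 0%N s0 -> (forall n s, P n s -> exists s', P n.+1 s' /\ Q n s s') ->
  exists f : nat -> S, f 0%N = s0 /\ forall n, P n (f n) /\ Q n (f n) (f n.+1).
Proof.
move=> P0 h; pose next n (s : {s | P n s}) := cid (h n (sval s) (svalP s)).
pose g := nat_rect (fun n => {s | P n s}) (exist _ s0 P0)
  (fun n s => exist _ (sval (next n s)) (svalP (next n s)).1).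
exists (fun n => sval (g n)); split => // n; split; first exact: svalP.
exact: (svalP (next n (g n))).2.
Qed.

Lemma limit_linear (R : realType) (k : scalar_kind) (V W : normedModType (scalars R k))
    (f : nat -> {linear V -> W}) (g : V -> W) (c : V -> R) :
  (forall h n, rnorm (g h - f n h) <= c h * pow2 n) ->
  exists G : {linear V -> W}, forall h, G h = g h.
Proof.
move=> fg; apply: exists_linear => a u v; apply: eq_of_rnorm => e e0.
have [n hn] := pow2_lt (c (a *: u + v) + (rnorm a * c u + c v)) e0.
apply: ltW; apply: le_lt_trans hn.
have -> : g (a *: u + v) - (a *: g u + g v) = (g (a *: u + v) - f n (a *: u + v)) -
    (a *: (g u - f n u) + (g v - f n v)).
  have -> : a *: (g u - f n u) + (g v - f n v) = (a *: g u + g v) - f n (a *: u + v).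
    by rewrite (linearP (f n)) scalerBr opprD addrACA.
  by rewrite opprB addrA subrK.
apply: le_trans (nrmB _ _) _; rewrite mulrDl; apply: lerD; first exact: fg.
apply: le_trans (nrmD _ _) _; rewrite mulrDl; apply: lerD; last exact: fg.
by rewrite nrmZ -mulrA ler_wpM2l ?rnorm_ge0.
Qed.

Section perturbation.
Context {R : realType} {k : scalar_kind} {X : normedModType (scalars R k)}.
Local Notation K := (scalars R k).

Lemma numerical_boundD (f g : X -> X) (N c : R) : numerical_bound f N ->
  (forall h, rnorm (g h - f h) <= c * rnorm h) -> numerical_bound g (N + c).
Proof.
move=> fN h x x' p; rewrite -(subrK (f x) (g x)) linearD addrC.
apply: le_trans (nrmD _ _) _; apply: lerD; first exact: fN.
apply: le_trans (dual_pair_le p _) _; case: p => x1 _ _ _.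
by apply: le_trans (h x) _; rewrite x1 mulr1.
Qed.

(* Adding [delta] times a rotation of the rank one operator [x' (x) x] moves all
   near-maximizers of the numerical range next to [x], up to a rotation. *)
Lemma perturbation_step (L : {linear X -> X}) (x : X) (x' : {linear X -> K^o})
    (N theta theta' delta : R) :
  compact_op L -> dual_pair x x' -> numerical_bound L N ->
  N - theta < rnorm (x' (L x)) -> 0 < delta -> 0 < theta' <= theta ->
  exists (L' : {linear X -> X}) (y : X) (y' : {linear X -> K^o}) (N' : R),
  [/\ compact_op L', dual_pair y y', numerical_bound L' N',
      N' - theta' < rnorm (y' (L' y)) &
      (forall h, rnorm (L' h - L h) <= delta * rnorm h) /\
      1 - 2 * theta / delta < re (x' y : K)].
Proof.
move=> cL p LN near delta0 /andP[theta'0 theta'_le].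
have [u u1 hu] := phaseP (x' (L x) : K).
have [x1 _ _ xx] := p.
have u0 : u != 0 by exact: rnorm1_neq0.
(* [u^-1] has the phase of [x' (L x)], so at [(x, x')] the moduli of the old value and of the added
   term sum up; this is [lowN']. *)
pose c : K := ofR delta * u^-1.
have c1 : rnorm c = delta.
  by rewrite rnormM rnorm_ofR rnormV u1 invr1 mulr1 gtr0_norm.
have [|L' hL'] := @exists_linear R k X X (fun h => L h + c *: (x' h *: x)).
  move=> a v w; rewrite (linearP L) (linearP x') /= scalerDl !scalerDr !scalerA addrACA.
  by congr (_ + _ + _); congr (_ *: _); rewrite mulrCA !mulrA.
have L'L h : rnorm (L' h - L h) <= delta * rnorm h.
  rewrite hL' addrC addKr nrmZ c1 ler_wpM2l ?(ltW delta0)// nrmZ x1 mulr1.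
  exact: dual_pair_le p h.
have val (z : X) (z' : {linear X -> K^o}) : z' (L' z) = z' (L z) + c * (x' z * z' x).
  by rewrite hL' (linearD z') (linearZ_LR z') (linearZ_LR z').
have cL' : compact_op L'.
  by apply: compact_op_lincomb hL' cL _; apply: compact_op_rank1 => h; exact: dual_pair_le p h.
have [N' [_ L'N' sup]] := exists_near_numerical_radius p (numerical_boundD LN L'L).
have [z [z' [q hz]]] := sup _ theta'0.
have lowN' : rnorm (x' (L x)) + delta <= N'.
  apply: le_trans (L'N' x x' p); rewrite val xx !mulr1.
  have -> : x' (L x) + c = u^-1 * ofR (rnorm (x' (L x)) + delta).
    by rewrite ofRD -hu mulrDr mulrA mulVf// mul1r mulrC.
  rewrite rnormM rnormV u1 invr1 mul1r rnorm_ofR; exact: ler_norm.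
have z1 : rnorm z = 1 by case: q.
(* The near-maximizer satisfies [N - theta + delta - theta' < N + delta * rnorm (x' z)]; the 2 comes
   from [theta' <= theta]. *)
have xz : 1 - 2 * theta / delta < rnorm (x' z).
  have zx : rnorm (z' x) <= 1 by rewrite -x1; exact: dual_pair_le q x.
  have : rnorm (z' (L' z)) <= N + delta * rnorm (x' z).
    rewrite val; apply: le_trans (rnormD _ _) _; apply: lerD; first exact: LN.
    rewrite rnormM c1 ler_wpM2l ?(ltW delta0)// rnormM ler_piMr//; exact: rnorm_ge0.
  move: hz lowN' near => /= *; rewrite -(ltr_pM2l delta0) mulrBr mulr1.
  by rewrite [delta * (_ / _)]mulrC divfK ?gt_eqF//; lra.
have [b b1 hb] := phaseP (x' z : K).
have [z2' q' hz2'] := dual_pair_rotate b1 q.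
have b0 : b != 0 by exact: rnorm1_neq0.
exists L', (b *: z), z2', N'; split => //; last first.
  by split => //; rewrite (linearZ_LR x') /= [b *: _]hb re_ofR.
by rewrite hz2' (linearZ_LR L') (linearZ_LR z') /= mulrA mulVf// mul1r.
Qed.

Lemma numerical_radius_perturbation : rapidly_complete X -> uniformly_convex X ->
  uniformly_smooth X -> forall kappa e : R, 0 < kappa -> 0 < e ->
  exists2 theta : R, 0 < theta &
  forall (L : {linear X -> X}) (x : X) (x' : {linear X -> K^o}) (N : R),
    compact_op L -> dual_pair x x' -> numerical_bound L N ->
    N - theta < rnorm (x' (L x)) ->
  exists (S : {linear X -> X}) (y : X) (y' : {linear X -> K^o}),
  [/\ compact_op S, dual_pair y y', numerical_bound S (rnorm (y' (S y))),
      forall h, rnorm (S h - L h) <= kappa * rnorm h &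
      rnorm (x - y) <= e /\ forall h, rnorm (x' h - y' h) <= e * rnorm h].
Proof.
move=> Xc uc us kappa e kappa0 e0; pose en n : R := e / 2 * pow2 n.
have en0 n : 0 < en n by rewrite mulr_gt0 ?pow2_gt0//; lra.
have /choice[d hd] : forall n, exists d : R, 0 < d <= 1 /\
    forall (x : X) (x' : {linear X -> K^o}) (z : X) (z' : {linear X -> K^o}),
    dual_pair x x' -> dual_pair z z' -> 1 - d < re (x' z : K) ->
    rnorm (z - x) <= en n /\ forall h, rnorm (z' h - x' h) <= en n * rnorm h.
  move=> n; have [s s0 hs] := uniformly_smooth_dual us (en0 n).
  (* The points must be within [en n] for the conclusion and within [s] for smoothness to bring the
     functionals together. *)
  have [|c c0 hc] := uniformly_convex_dual uc (e := Num.min (en n) s).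
    by rewrite lt_min en0.
  exists (Num.min c 1); split; first by rewrite lt_min c0 ltr01 ge_min lexx orbT.
  move=> x x' z z' p q xz; have [z1 _ _ _] := q.
  have : rnorm (x - z) < Num.min (en n) s.
    apply: hc p z1 _; apply: le_lt_trans xz; rewrite lerB// ge_min lexx//.
  rewrite lt_min nrm_distC => /andP[/ltW zx zxs]; split => //; exact: (hs z z' x x' q p zxs).
(* [th n] is such that the loss [2 * th n / del n] in the perturbation step is exactly [d n]. The
   sizes [del n] sum to [kappa], as the [en n] sum to [e]. *)
pose del n : R := kappa / 2 * pow2 n; pose th n := del n * d n / 2.
have del0 n : 0 < del n by rewrite mulr_gt0 ?pow2_gt0//; lra.
have d0 n : 0 < d n by have [/andP[]] := hd n; move=> ? _ _.
have th0 n : 0 < th n by exact: divr_gt0 (mulr_gt0 (del0 n) (d0 n)) (ltr0n _ 2).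
have thE n : 2 * th n / del n = d n.
  by rewrite /th; field; rewrite gt_eqF.
exists (th 0%N) => // L0 x0 x0' N0 cL0 p0 LN0 near0.
pose S := ({linear X -> X} * X * {linear X -> K^o} * R)%type.
pose P n (s : S) := let: (L, x, x', N) := s in
  [/\ compact_op L, dual_pair x x', numerical_bound L N & N - th n < rnorm (x' (L x))].
pose Q n (s t : S) := let: (L, x, x', _) := s in let: (L2, x2, x2', _) := t in
  (forall h, rnorm (L2 h - L h) <= del n * rnorm h) /\ 1 - d n < re (x' x2 : K).
have [||f [f0 hf]] := @indexed_choice S P Q (L0, x0, x0', N0) => //.
  move=> n [[[L x] x'] N] [cL p LN near].
  (* In the minimum, [th n] meets the side condition of the step and [th n.+1] gives the invariant
     of the next stage. *)
  have [|L2 [y [y' [N' [cL2 q LN' near' [LL xy]]]]]] :=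
      @perturbation_step L x x' N (th n) (Num.min (th n) (th n.+1)) (del n) cL p LN near (del0 n).
    by rewrite lt_min !th0 ge_min lexx.
  exists (L2, y, y', N'); split; last by split => //; rewrite -thE.
  split => //; apply: le_lt_trans near'; rewrite lerB// ge_min lexx orbT//.
pose L n := (f n).1.1.1; pose x n := (f n).1.1.2; pose x' n := (f n).1.2; pose N n := (f n).2.
have hP n : [/\ compact_op (L n), dual_pair (x n) (x' n), numerical_bound (L n) (N n) &
    N n - th n < rnorm (x' n (L n (x n)))].
  by have [+ _] := hf n; rewrite /P /L /x /x' /N; case: (f n) => [[[? ?] ?] ?].
have hQ n : (forall h, rnorm (L n.+1 h - L n h) <= del n * rnorm h) /\
    1 - d n < re (x' n (x n.+1) : K).
  have [_ +] := hf n; rewrite /Q /L /x /x'.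
  by case: (f n) => [[[? ?] ?] ?]; case: (f n.+1) => [[[? ?] ?] ?].
have L00 : L 0%N = L0 by rewrite /L f0.
have x00 : x 0%N = x0 by rewrite /x f0.
have x00' : x' 0%N = x0' by rewrite /x' f0.
clearbody L x x' N; clear hf f0 f P Q S.
have step n : rnorm (x n.+1 - x n) <= en n /\
    forall h, rnorm (x' n.+1 h - x' n h) <= en n * rnorm h.
  have [_ hdn] := hd n; have [_ p _ _] := hP n; have [_ q _ _] := hP n.+1.
  by apply: hdn p q _; have [] := hQ n.
have [|y hy] := Xc x (e / 2); first by move=> n; have [] := step n.
have {}hy n : rnorm (y - x n) <= e * pow2 n by have := hy n; lra.
have /choice[y' hy'] : forall h, exists l : K^o, forall n,
    rnorm (l - x' n h) <= e * pow2 n * rnorm h.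
  move=> h; have [n|l hl] := scalar_rapidly_complete (u := fun n => x' n h) (c := e / 2 * rnorm h).
    by have [_ /(_ h)] := step n; rewrite /en; lra.
  by exists l => n; have := hl n; lra.
have /choice[S hS] : forall h, exists l : X, forall n,
    rnorm (l - L n h) <= kappa * pow2 n * rnorm h.
  move=> h; have [n|l hl] := Xc (fun n => L n h) (kappa / 2 * rnorm h).
    by have [/(_ h)] := hQ n; rewrite /del; lra.
  by exists l => n; have := hl n; lra.
have [|Y hY] := @limit_linear R k X K^o x' y' (fun h => e * rnorm h).
  by move=> h n; rewrite mulrAC.
have {}hy' h n : rnorm (Y h - x' n h) <= e * pow2 n * rnorm h by rewrite hY.
have [|F hF] := @limit_linear R k X X L S (fun h => kappa * rnorm h).
  by move=> h n; rewrite mulrAC.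
have {}hS h n : rnorm (F h - L n h) <= kappa * pow2 n * rnorm h by rewrite hF.
have cF : compact_op F.
  apply: compact_op_limit => c c0; have [n hn] := pow2_lt kappa c0.
  exists (L n); first by have [] := hP n.
  move=> h h1; apply: le_lt_trans (hS h n) (le_lt_trans _ hn).
  by rewrite ler_piMr// mulr_ge0 ?ltW ?pow2_gt0.
have [B B0 hB] := compact_op_bounded cF.
have pow20 n : 0 < pow2 n :> R := pow2_gt0 n.
have x1 n : rnorm (x n) = 1 by have [_ [->]] := hP n.
have y1 : rnorm y = 1.
  apply/le_anti/andP; split; apply/ler_addgt0Pr => c c0; have [n hn] := pow2_lt e c0.
    by have := nrm_leB y (x n); have := hy n; rewrite x1; lra.
  by have := nrm_leB (x n) y; rewrite nrm_distC; have := hy n; rewrite x1; lra.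
have q : dual_pair y Y.
  apply: dual_pairI => // [h|].
    apply/ler_addgt0Pr => c c0; have [n hn] := pow2_lt (e * rnorm h) c0.
    have := nrm_leB (Y h) (x' n h); have := hy' h n.
    by have [_ /dual_pair_le/(_ h) + _ _] := hP n; lra.
  apply: eq_of_rnorm => c c0; have [n hn] := pow2_lt (2 * e) c0.
  apply: ltW; apply: le_lt_trans hn; have [_ p _ _] := hP n; have [_ _ _ xx] := p.
  apply: le_trans (nrm_distD (x' n y) _ _) _; rewrite -xx -linearB.
  have := hy' y n; rewrite y1; have := dual_pair_le p (y - x n); have := hy n; lra.
exists F, y, Y; split => //; first last.
- split; first by have := hy 0%N; rewrite x00 nrm_distC /pow2 expr0 mulr1.
  by move=> h; have := hy' h 0%N; rewrite x00' nrm_distC /pow2 expr0 mulr1.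
- by move=> h; have := hS h 0%N; rewrite L00 /pow2 expr0 mulr1.
move=> z z' r; apply/ler_addgt0Pr => c c0.
(* Three errors of [kappa * pow2 n]: replacing [F] by [L n] at [z], near attainment within [th n],
   and returning from [L n] to [F] at [x n]. Two of [e * B * pow2 n]: moving [x n] to [y] and [x' n]
   to [Y]. *)
have [n hn] := pow2_lt (3 * kappa + 2 * e * B) c0.
have [_ p LN near] := hP n.
have thn : th n <= kappa * pow2 n.
  have [/andP[_ dn] _] := hd n; have := ler_wpM2l (ltW (del0 n)) dn.
  by have := mulr_gt0 kappa0 (pow20 n); rewrite /th /del; lra.
have z1 : rnorm z = 1 by case: r.
have A : rnorm (z' (F z)) <= rnorm (z' (L n z)) + kappa * pow2 n.
  rewrite -lerBlDl; apply: le_trans (nrm_leB (z' (F z)) _) _; rewrite -linearB.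
  by apply: le_trans (dual_pair_le r _) _; have := hS z n; rewrite z1 mulr1.
have A' : rnorm (x' n (L n (x n))) <= rnorm (x' n (F (x n))) + kappa * pow2 n.
  rewrite -lerBlDl; apply: le_trans (nrm_leB (x' n _) _) _; rewrite -linearB.
  by apply: le_trans (dual_pair_le p _) _; rewrite nrm_distC; have := hS (x n) n; rewrite x1 mulr1.
have Bx : rnorm (x' n (F (x n)) - x' n (F y)) <= B * (e * pow2 n).
  rewrite -linearB -linearB; apply: le_trans (dual_pair_le p _) (le_trans (hB _) _).
  by rewrite ler_wpM2l// nrm_distC hy.
have By : rnorm (x' n (F y) - Y (F y)) <= B * (e * pow2 n).
  rewrite nrm_distC; apply: le_trans (hy' _ n) _; rewrite mulrC ler_wpM2r//.
    by rewrite mulr_ge0 ?ltW.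
  by have := hB y; rewrite y1 mulr1.
have := nrm_leB (x' n (F (x n))) (x' n (F y)); have := nrm_leB (x' n (F y)) (Y (F y)).
by have := LN z z' r; move: near A A' Bx By thn hn; lra.
Qed.

(** With [A = T] this says that the numerical index for compact operators is positive. A general [A]
    allows for operators whose numerical values all vanish, and [T - kappa A] still has the
    numerical values of [T] multiplied by [1 - kappa]. *)
Definition compactly_reducible := exists2 M : R, 0 <= M &
  forall T : {linear X -> X}, compact_op T -> numerical_bound T 1 ->
  exists A : {linear X -> X}, [/\ compact_op A, forall h, rnorm (A h) <= M * rnorm h &
    forall (x : X) (x' : {linear X -> K^o}), dual_pair x x' -> x' (A x) = x' (T x)].

Theorem BPBp_nu_compact_criterion : rapidly_complete X -> uniformly_convex X ->
  uniformly_smooth X -> compactly_reducible -> BPBp_nu_compact X.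
Proof.
move=> Xc uc us [M M0 hM] e /andP[e0 e1].
(* The operator moves by [kappa * M] from [T] to [L], by [kappa] from [L] to [S] and by at most
   [3 * kappa] from [S] to [F]. *)
pose kappa := e / (2 * (M + 5)).
have kM : kappa * (M + 5) = e / 2 by rewrite /kappa; field; lra.
have kappa0 : 0 < kappa by rewrite divr_gt0// mulr_gt0//; lra.
have kappa1 : kappa < 1 by nra.
have [th th0 hth] := numerical_radius_perturbation Xc uc us kappa0 (divr_gt0 e0 (ltr0n _ 2)).
(* [th] lets the perturbation start from [(x, x')]; [kappa] limits how far [r] can fall below 1. *)
exists (Num.min th kappa); split; first by rewrite lt_min th0 kappa0 gt_min kappa1 orbT.
move=> T x x' /(compact_operatorP _ Xc) cT p /numerical_radius_bound nT near.
have [A [cA bA TA]] := hM T cT nT.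
have [|L hL] := @exists_linear R k X X (fun h => T h + ofR (- kappa) *: A h).
  move=> a u v; rewrite (linearP T) (linearP A) !scalerDr !scalerA addrACA.
  by congr (_ + _ + _); rewrite mulrC.
have cL := compact_op_lincomb hL cT cA.
have val (z : X) (z' : {linear X -> K^o}) : dual_pair z z' ->
    z' (L z) = ofR (1 - kappa) * z' (T z).
  by move=> q; rewrite hL (linearD z') (linearZ_LR z') TA// ofRD ofR1 mulrDl mul1r.
have k1 : `|1 - kappa| = 1 - kappa by rewrite ger0_norm//; lra.
have LN : numerical_bound L (1 - kappa).
  by move=> z z' q; rewrite val// rnormM rnorm_ofR k1 ler_piMr//; [lra|exact: nT].
have Lx : 1 - kappa - Num.min th kappa < rnorm (x' (L x)).
  rewrite val// rnormM rnorm_ofR k1.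
  have m0 : 0 < Num.min th kappa by rewrite lt_min th0.
  by move: near m0; move: (rnorm _) (Num.min _ _) => r m; nra.
have [|S [y [y' [cS q SN SL [xy xy']]]]] := hth L x x' (1 - kappa) cL p LN.
  by apply: le_lt_trans Lx; rewrite lerB// ge_min lexx.
set r := rnorm (y' (S y)) in SN.
have r1 : r <= 1 by have := numerical_boundD LN SL q; rewrite subrK.
have Sx : 1 - kappa - 2 * kappa <= r.
  apply: le_trans (SN x x' p); have [x1 _ _ _] := p.
  have := nrm_leB (x' (L x)) (x' (S x)); rewrite -linearB.
  have := dual_pair_le p (L x - S x); rewrite nrm_distC; have := SL x; rewrite x1.
  have := Lx; have : Num.min th kappa <= kappa by rewrite ge_min lexx orbT.
  lra.
have [u u1 hu] := phaseP (y' (S y) : K).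
have u0 : u != 0 by exact: rnorm1_neq0.
(* In phase with [y' (S y)], the rank one term raises the value at [(y, y')] to 1; its norm [1 - r]
   keeps all other numerical values at most 1. *)
pose c : K := ofR (1 - r) * u^-1.
have c1 : rnorm c = 1 - r.
  by rewrite rnormM rnorm_ofR rnormV u1 invr1 mulr1 ger0_norm//; lra.
have [y1 _ _ yy] := q.
have [|F hF] := @exists_linear R k X X (fun h => S h + c *: (y' h *: y)).
  move=> a v w; rewrite (linearP S) (linearP y') /= scalerDl !scalerDr !scalerA addrACA.
  by congr (_ + _ + _); congr (_ *: _); rewrite mulrCA !mulrA.
have cF : compact_op F.
  by apply: compact_op_lincomb hF cS _; apply: compact_op_rank1 => h; exact: dual_pair_le q h.
have FS h : rnorm (F h - S h) <= (1 - r) * rnorm h.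
  rewrite hF addrC addKr nrmZ c1 ler_wpM2l//; first lra.
  by rewrite nrmZ y1 mulr1; exact: dual_pair_le q h.
have Fy : rnorm (y' (F y)) = 1.
  rewrite hF (linearD y') (linearZ_LR y') (linearZ_LR y') yy /= /c.
  have -> : y' (S y) + (ofR (1 - r) * u^-1) *: (1 *: 1) = u^-1 * ofR (r + (1 - r)) :> K.
    rewrite (ofRD r) mulrDr -hu mulrA mulVf// mul1r.
    by rewrite scale1r /GRing.scale /= mulr1 (mulrC (ofR _)).
  by rewrite subrKC rnormM rnormV u1 invr1 rnorm_ofR normr1 mulr1.
exists F, y, y'; split => //.
- exact/compact_operatorP.
- split => //; apply: numerical_radius_attained q Fy.
  by have := numerical_boundD SN FS; rewrite subrKC.
split.
- apply: (@le_lt_trans _ _ (kappa * (M + 4))); last by nra.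
  apply: opnorm_le => [|h]; first by rewrite mulr_ge0//; lra.
  apply: le_trans (nrm_distD (S h) _ _) _; rewrite [rnorm (S h - _)]nrm_distC.
  apply: le_trans (lerD (nrm_distD (L h) _ _) (FS h)) _.
  have -> : rnorm (T h - L h) = kappa * rnorm (A h).
    by rewrite hL opprD addrA subrr add0r nrmN nrmZR normrN gtr0_norm.
  rewrite [rnorm (L h - _)]nrm_distC; have := SL h; have := ler_wpM2l (ltW kappa0) (bA h).
  have : (1 - r) * rnorm h <= 3 * kappa * rnorm h by rewrite ler_wpM2r ?nrm_ge0//; lra.
  lra.
- by apply: le_lt_trans xy _; lra.
- apply: (@le_lt_trans _ _ (e / 2)); last by lra.
  by apply: opnorm_le => //; lra.
Qed.

End perturbation.

(** * Convexity and smoothness of the p-th power *)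

Section powR_inequalities.
Context {R : realType}.
Implicit Types (p q x y a e : R).

(* [x^p = x * x^(p-1)] and [1 = x / x]: bound both exponentials of multiples of
   [ln x] by their tangents at 0. *)
Lemma powR_Bernoulli_lt p x : 1 < p -> 0 <= x -> x != 1 -> 1 + p * (x - 1) < x `^ p.
Proof.
move=> p1; rewrite le_eqVlt => /predU1P[<- _|x0 x1].
  by rewrite powR0 ?gt_eqF//; lra.
have u0 : ln x != 0 by rewrite ln_eq0.
rewrite /powR gt_eqF//; move: u0; set u := ln x => u0.
have xE : expR u = x by rewrite lnK.
have pu : (p - 1) * u != 0 by rewrite mulf_neq0// subr_eq0 gt_eqF.
have nu : - u != 0 by rewrite oppr_eq0.
have h1 := expR_gt1Dx pu; have h2 := expR_gt1Dx nu.
have -> : p * u = u + (p - 1) * u by ring.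
rewrite expRD xE; rewrite expRN xE in h2.
have h3 := ltr_pM2l x0 (1 + (p - 1) * u) (expR ((p - 1) * u)); rewrite h1 in h3.
have h4 := ltr_pM2l x0 (1 - u) x^-1; rewrite h2 mulfV ?gt_eqF// in h4.
have h5 : (p - 1) * (x * (1 - u)) <= p - 1 by rewrite ler_piMr ?ltW//; lra.
move: h3 h4; nra.
Qed.

Lemma powR_Bernoulli p x : 1 < p -> 0 <= x -> 1 + p * (x - 1) <= x `^ p.
Proof.
move=> p1 x0; have [->|x1] := eqVneq x 1; last by rewrite ltW// powR_Bernoulli_lt.
by rewrite powR1; lra.
Qed.

(** Bernoulli's inequality at [x / a], scaled by the p-th power of [a]. *)
Lemma powR_tangent p a x : 1 < p -> 0 < a -> 0 <= x ->
  a `^ p + p * a `^ (p - 1) * (x - a) <= x `^ p.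
Proof.
move=> p1 a0 x0; have xa : 0 <= x / a by rewrite divr_ge0// ltW.
have -> : x `^ p = a `^ p * (x / a) `^ p by rewrite -powRM ?(ltW a0)// mulrC divfK ?gt_eqF.
apply: le_trans (ler_wpM2l (powR_ge0 a p) (powR_Bernoulli p1 xa)).
have -> : a `^ p = a * a `^ (p - 1) by rewrite mulr_powRB1 ?ltW//; lra.
rewrite le_eqVlt; apply/orP; left; apply/eqP; by field; rewrite gt_eqF.
Qed.

Lemma powR_midpoint p x y : 1 < p -> 0 <= x -> 0 <= y ->
  ((x + y) / 2) `^ p <= (x `^ p + y `^ p) / 2.
Proof.
move=> p1 x0 y0; set m := (x + y) / 2.
have : 0 <= m by rewrite /m; lra.
rewrite le_eqVlt => /predU1P[<-|m0].
  by rewrite powR0 ?gt_eqF//; [rewrite divr_ge0 ?addr_ge0 ?powR_ge0|lra].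
have := powR_tangent p1 m0 x0; have := powR_tangent p1 m0 y0.
rewrite (_ : y - m = - (x - m)); last by rewrite /m; field.
lra.
Qed.

(** By the tangents at [1 + a] and [1 - a] the sum is at least its value at [a], so the gap there
    serves for all larger [x]; the strict Bernoulli inequality makes it positive. *)
Lemma powR_strict_convexity p a : 1 < p -> 0 < a < 1 -> exists2 g : R, 0 < g &
  forall x, a <= x <= 1 -> 2 + g <= (1 + x) `^ p + (1 - x) `^ p.
Proof.
move=> p1 /andP[a0 a1]; exists ((1 + a) `^ p + (1 - a) `^ p - 2).
  have h1 : 1 + p * (1 + a - 1) < (1 + a) `^ p.
    by apply: powR_Bernoulli_lt => //; [lra|rewrite gt_eqF//; lra].
  have h2 : 1 + p * (1 - a - 1) < (1 - a) `^ p.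
    by apply: powR_Bernoulli_lt => //; [lra|rewrite lt_eqF//; lra].
  lra.
move=> x /andP[ax x1].
have h1 := @powR_tangent p (1 + a) (1 + x) p1 ltac:(lra) ltac:(lra).
have h2 := @powR_tangent p (1 - a) (1 - x) p1 ltac:(lra) ltac:(lra).
have h3 : (1 - a) `^ (p - 1) <= (1 + a) `^ (p - 1).
  by apply: ge0_ler_powR; rewrite ?nnegrE; lra.
have h4 : 0 <= p * ((1 + a) `^ (p - 1) - (1 - a) `^ (p - 1)) * (x - a).
  by rewrite !mulr_ge0 ?subr_ge0//; lra.
lra.
Qed.

Lemma expR_le_quadratic x : `|x| <= 2^-1 -> expR x <= 1 + x + 2 * x ^+ 2.
Proof.
rewrite ler_norml => /andP[x1 x2].
have h := expR_ge1Dx (- x); have x0 : 0 < 1 - x by lra.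
have : expR x * (1 - x) <= 1.
  by rewrite -[leRHS](expRxMexpNx_1 x) ler_pM2l ?expR_gt0.
rewrite -ler_pdivlMr// => /le_trans; apply; rewrite ler_pdivrMr//.
have := sqr_ge0 x; nra.
Qed.

(** From [ln (1 + w) <= w] and the quadratic bound for the exponential. Exponents below 1 are
    included because [q = p / 2] may be one. *)
Lemma powR_le_quadratic q w : 0 < q -> `|w| <= 2^-1 -> `|q * w| <= 2^-1 ->
  (1 + w) `^ q <= 1 + q * w + 2 * (q * w) ^+ 2.
Proof.
move=> q0 w1 /expR_le_quadratic; apply: le_trans.
move: w1; rewrite ler_norml => /andP[w1 w2].
rewrite /powR gt_eqF ?ler_expR; last by lra.
by rewrite ler_pM2l// le_ln1Dx//; lra.
Qed.

Lemma powR_mixed p x y : 1 < p -> 0 <= x -> 0 <= y -> x * y `^ (p - 1) <= x `^ p + y `^ p.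
Proof.
move=> p1 x0 y0; have p0 : 0 < p by lra.
have xp := powR_ge0 x p; have yp := powR_ge0 y p.
have [xy|/ltW yx] := leP x y.
  apply: (@le_trans _ _ (y `^ p)); last by lra.
  by rewrite -(mulr_powRB1 y0 p0) ler_wpM2r ?powR_ge0.
apply: (@le_trans _ _ (x `^ p)); last by lra.
rewrite -(mulr_powRB1 x0 p0) ler_wpM2l//.
by apply: ge0_ler_powR; rewrite ?nnegrE//; lra.
Qed.

Lemma powR_small p c : 1 < p -> 0 < c -> exists2 t : R, 0 < t <= 1 & t `^ p <= c * t.
Proof.
move=> p1 c0; have q0 : 0 < p - 1 by lra.
pose t := Num.min 1 (c `^ (p - 1)^-1).
have t0 : 0 < t by rewrite lt_min ltr01 powR_gt0.
exists t; first by rewrite t0 ge_min lexx.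
rewrite -(mulr_powRB1 (ltW t0)) ?(lt_trans _ p1)// mulrC ler_pM2r//.
apply: (@le_trans _ _ ((c `^ (p - 1)^-1) `^ (p - 1))).
  by apply: ge0_ler_powR; rewrite ?nnegrE ?powR_ge0 ?(ltW t0) ?(ltW q0)// ge_min lexx orbT.
by rewrite -powRrM mulVf ?gt_eqF// powRr1// ltW.
Qed.

End powR_inequalities.

Section scalar_inequalities.
Context {R : realType} {k : scalar_kind}.
Local Notation K := (scalars R k).
Variables (p : R) (p1 : 1 < p).
Implicit Types a b z : K.

Let p0 : 0 < p. Proof. exact: lt_trans ltr01 p1. Qed.

Lemma powR_sqr_half (x : R) : 0 <= x -> x `^ p = (x ^+ 2) `^ (p / 2).
Proof. by move=> x0; rewrite -powR_mulrn// -powRrM mulrC divfK. Qed.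

Lemma sqr_rnormD1 z : rnorm (1 + z) ^+ 2 = 1 + (2 * re z + rnorm z ^+ 2).
Proof.
rewrite !sqr_rnorm reD imD -(@ofR1 R k) re_ofR im_ofR; ring.
Qed.

(** The squares of [|1 + z|] and [|1 - z|] are [1 + w] with [w] equal to [2 re z + |z|^2] and
    [- 2 re z + |z|^2]. In the sum of their powers [p / 2] the terms linear in [re z] cancel. *)
Lemma scalar_smooth_near1 : exists2 d : R, 0 < d & exists2 C : R, 0 < C & forall z,
  rnorm z <= d -> rnorm (1 + z) `^ p + rnorm (1 - z) `^ p <= 2 + C * rnorm z ^+ 2.
Proof.
pose q := p / 2; have q0 : 0 < q by rewrite divr_gt0.
(* With this radius [s] and [q * s] are at most 1/6, so [|w| <= 3 * s] keeps [w] and [q * w] within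
   1/2. The quadratic remainder is then at most [18 * q ^+ 2 * s ^+ 2], once for each sign. *)
exists (6 * (q + 1))^-1; first by rewrite invr_gt0; lra.
exists (2 * q + 36 * q ^+ 2) => [|z]; first by rewrite addr_gt0 ?mulr_gt0 ?exprn_gt0.
rewrite -[_^-1]mul1r ler_pdivlMr; last by lra.
set s := rnorm z => zd; have s0 : 0 <= s := rnorm_ge0 z.
have s1 : s <= 6^-1 by nra.
have qs : q * s <= 6^-1 by nra.
have rz := normr_re_le z; rewrite -/s in rz.
rewrite !(powR_sqr_half (rnorm_ge0 _)) !sqr_rnormD1 rnormN reN -/s -/q.
have key (r : R) : `|r| <= s -> (1 + (2 * r + s ^+ 2)) `^ q <=
    1 + q * (2 * r + s ^+ 2) + 18 * q ^+ 2 * s ^+ 2.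
  move=> rs; set w := 2 * r + s ^+ 2.
  have ws : `|w| <= 3 * s.
    by move: rs; rewrite !ler_norml /w => /andP[r1 r2]; apply/andP; split; nra.
  apply: le_trans (powR_le_quadratic q0 _ _) _.
  - by lra.
  - rewrite normrM gtr0_norm//; have := ler_wpM2l (ltW q0) ws; lra.
  rewrite lerD2l exprMn [2 * _]mulrCA -mulrA [18 * _]mulrCA ler_wpM2l ?sqr_ge0//.
  rewrite -(real_normK (num_real w)); have := ler_pM (normr_ge0 w) (normr_ge0 w) ws ws; lra.
have := key (re z) rz; have := key (- re z); rewrite normrN => /(_ rz); lra.
Qed.

(** If [t |b| <= d |a|], divide by [a] and use the expansion near 1; the bound [e / C] on [d] makes
    the quadratic term linear. Otherwise [|a| + t |b|] is at most a constant times [t |b|], and the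
    p-th power of a small [t] is negligible against [t]. *)
Lemma scalar_uniformly_smooth (e : R) : 0 < e -> exists2 t : R, 0 < t & forall a b,
  rnorm (a + ofR t * b) `^ p + rnorm (a - ofR t * b) `^ p <=
  2 * rnorm a `^ p + e * t * (rnorm a `^ p + rnorm b `^ p).
Proof.
move=> e0; have [d0 d00 [C C0 hC]] := scalar_smooth_near1.
pose d := Num.min d0 (e / C).
have d_gt0 : 0 < d by rewrite lt_min d00 divr_gt0.
pose D := (d^-1 + 1) `^ p; have D0 : 0 < D by rewrite powR_gt0// addr_gt0// invr_gt0.
have [t /andP[t0 t1] tp] := powR_small p1 (divr_gt0 e0 (mulr_gt0 (ltr0n _ 2) D0)).
exists t => // a b; have a0 := rnorm_ge0 a; have b0 := rnorm_ge0 b.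
have ap := powR_ge0 (rnorm a) p; have bp := powR_ge0 (rnorm b) p.
have tb : rnorm (ofR t * b : K) = t * rnorm b by rewrite rnormM rnorm_ofR gtr0_norm.
have [small|big] := leP (t * rnorm b) (d * rnorm a).
  have [a00|an0] := eqVneq a 0.
    move: small; rewrite a00 rnorm0 mulr0 => /(conj (mulr_ge0 (ltW t0) b0))/andP.
    move=> /le_anti/esym/eqP; rewrite mulf_eq0 (gt_eqF t0) /= => /eqP/rnorm_eq0 ->.
    by rewrite mulr0 subr0 addr0 rnorm0 powR0 ?gt_eqF//; lra.
  have ra0 : 0 < rnorm a.
    by rewrite lt_def a0 andbT; apply: contra_neq an0 => /rnorm_eq0.
  pose z : K := ofR t * b / a.
  have zE : rnorm z = t * rnorm b / rnorm a by rewrite rnormM rnormV tb.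
  have zd : rnorm z <= d by rewrite zE ler_pdivrMr.
  have -> : a + ofR t * b = a * (1 + z) by rewrite mulrDr mulr1 mulrCA divff// mulr1.
  have -> : a - ofR t * b = a * (1 - z) by rewrite mulrBr mulr1 mulrCA divff// mulr1.
  rewrite !rnormM !powRM ?rnorm_ge0// -mulrDr.
  apply: le_trans (ler_wpM2l ap (hC z _)) _; first by rewrite (le_trans zd)// ge_min lexx.
  have Cz : C * rnorm z ^+ 2 <= e * rnorm z.
    rewrite expr2 mulrA ler_wpM2r ?rnorm_ge0// mulrC -ler_pdivlMr//.
    by rewrite (le_trans zd)// ge_min lexx orbT.
  apply: le_trans (ler_wpM2l ap (lerD (lexx 2) Cz)) _.
  rewrite mulrDr [_ * 2]mulrC lerD2l zE -[rnorm a `^ p in leLHS](mulr_powRB1 a0 p0).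
  have -> : rnorm a * rnorm a `^ (p - 1) * (e * (t * rnorm b / rnorm a)) =
    e * t * (rnorm b * rnorm a `^ (p - 1)) by field; rewrite gt_eqF.
  apply: ler_wpM2l; first by rewrite mulr_ge0 ?ltW.
  by rewrite [leRHS]addrC; exact: powR_mixed p1 b0 a0.
have bnd (c : K) : rnorm c <= rnorm a + t * rnorm b -> rnorm c `^ p <= e * t / 2 * rnorm b `^ p.
  move=> hc; apply: (@le_trans _ _ (D * (t `^ p * rnorm b `^ p))).
    rewrite -powRM ?(ltW t0)// -powRM ?addr_ge0 ?invr_ge0 ?mulr_ge0 ?(ltW t0) ?(ltW d_gt0)//.
    apply: ge0_ler_powR; rewrite ?nnegrE ?rnorm_ge0 ?(ltW p0)//.
      by rewrite !mulr_ge0 ?addr_ge0 ?invr_ge0 ?(ltW d_gt0) ?(ltW t0).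
    apply: le_trans hc _; rewrite mulrDl mul1r lerD2r mulrC ler_pdivlMr// mulrC; exact: ltW.
  rewrite mulrA ler_wpM2r//; apply: le_trans (ler_wpM2l (ltW D0) tp) _.
  rewrite le_eqVlt; apply/orP; left; apply/eqP; by field; rewrite gt_eqF.
have A := bnd (a + ofR t * b); have B := bnd (a - ofR t * b).
rewrite -tb rnormD in A; rewrite -tb -[rnorm (ofR t * b)]rnormN rnormD in B.
have := mulr_ge0 (mulr_ge0 (ltW e0) (ltW t0)) ap; have := A isT; have := B isT; lra.
Qed.

Lemma rnorm_half_le a b : rnorm (ofR 2^-1 * (a + b)) `^ p <= (rnorm a `^ p + rnorm b `^ p) / 2.
Proof.
apply: le_trans (powR_midpoint p1 (rnorm_ge0 a) (rnorm_ge0 b)).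
apply: ge0_ler_powR; rewrite ?nnegrE ?rnorm_ge0 ?(ltW p0)//.
  by rewrite divr_ge0 ?addr_ge0 ?rnorm_ge0.
by rewrite rnormM rnorm_ofR ger0_norm ?invr_ge0// mulrC ler_wpM2r ?invr_ge0// rnormD.
Qed.

(* The parallelogram identity bounds [|1 + z| / 2] away from 1, which settles [|z|]
   near 1; for smaller [|z|] strict convexity of the power on the reals suffices. *)
Lemma disc_uniformly_convex (e : R) : 0 < e -> exists2 g : R, 0 < g & forall z,
  rnorm z <= 1 -> e <= rnorm (1 - z) `^ p ->
  g <= (1 + rnorm z `^ p) / 2 - rnorm (ofR 2^-1 * (1 + z)) `^ p.
Proof.
move=> e0; pose f := e `^ p^-1; have f0 : 0 < f by rewrite powR_gt0.
(* The first entry bounds the square of [|1 + z| / 2] by the parallelogram identity; 1/2 keeps [v]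
   positive. *)
pose v := Num.max (1 - f ^+ 2 / 4) 2^-1.
have v0 : 0 < v by rewrite lt_max [0 < 2^-1]invr_gt0 ltr0n orbT.
have v1 : v < 1 by rewrite gt_max; apply/andP; split; [have := exprn_gt0 2 f0|]; lra.
have sv1 : Num.sqrt v < 1 by rewrite -sqrtr1 ltr_sqrt.
have sv0 := sqrtr_ge0 v; pose w := Num.sqrt v `^ p.
have w1 : w < 1.
  by rewrite /w -[ltRHS](congr1 (fun f : R -> R => f p) (@powR1 R)) gt0_ltr_powR ?nnegrE.
have [|g0 g00 hg] := @powR_strict_convexity R p ((1 - Num.sqrt v) / 2) p1; first by lra.
pose c : R := 2^-1 `^ p; have c0 : 0 < c by rewrite powR_gt0 ?invr_gt0.
exists (Num.min ((1 - w) / 2) (c * g0 / 2)) => [|z z1 ez].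
  by rewrite lt_min !divr_gt0 ?mulr_gt0// subr_gt0.
set D := _ / 2 - _; set s := rnorm z in D z1 *; have s0 : 0 <= s := rnorm_ge0 z.
have mid : rnorm (ofR 2^-1 * (1 + z)) <= (1 + s) / 2.
  rewrite rnormM rnorm_ofR ger0_norm ?invr_ge0// mulrC ler_wpM2r ?invr_ge0//.
  by apply: le_trans (rnormD _ _) _; rewrite rnorm1.
have [ws|sw] := leP w (s `^ p).
  suff : rnorm (ofR 2^-1 * (1 + z)) `^ p <= w.
    by move=> h; rewrite ge_min; apply/orP; left; rewrite /D; lra.
  apply: ge0_ler_powR; rewrite ?nnegrE ?rnorm_ge0 ?(ltW p0)//.
  rewrite -(ger0_norm (rnorm_ge0 _)) -sqrtr_sqr ler_sqrt ?(ltW v0)//.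
  rewrite rnormM rnorm_ofR ger0_norm ?invr_ge0// exprMn sqr_rnormD1.
  have := sqr_rnormD1 (- z); rewrite rnormN reN -/s => h.
  have : f ^+ 2 <= rnorm (1 - z) ^+ 2.
    rewrite ler_pXn2r// ?nnegrE ?rnorm_ge0 ?(ltW f0)//.
    rewrite -[leRHS]powRr1 ?rnorm_ge0// -(mulfV (lt0r_neq0 p0)) powRrM.
    by apply: ge0_ler_powR; rewrite ?nnegrE ?invr_ge0 ?(ltW p0) ?(ltW e0) ?powR_ge0.
  rewrite h => fh; have s21 : s ^+ 2 <= 1 by rewrite expr_le1.
  apply: (@le_trans _ _ (1 - f ^+ 2 / 4)); last by rewrite le_max lexx.
  lra.
have sv : s < Num.sqrt v.
  rewrite ltNge; apply/negP => h; move: sw; apply/negP; rewrite -leNgt.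
  by apply: ge0_ler_powR; rewrite ?nnegrE ?(ltW p0).
(* This writes [1] and [s] as [m * (1 + h)] and [m * (1 - h)], symmetric about their midpoint [m],
   the shape of [powR_strict_convexity]. *)
pose h := (1 - s) / (1 + s); pose m := (1 + s) / 2.
have h1 : (1 - Num.sqrt v) / 2 <= h <= 1.
  rewrite /h ler_pdivlMr ?ler_pdivrMr; [|lra|lra]; apply/andP; split; nra.
have m0 : 2^-1 <= m by rewrite /m; lra.
have mh : m * (1 + h) = 1 by rewrite /m /h; field; rewrite gt_eqF//; lra.
have mh' : m * (1 - h) = s by rewrite /m /h; field; rewrite gt_eqF//; lra.
have /andP[_ hle1] := h1.
have h0 : 0 <= h by rewrite /h divr_ge0//; lra.
have cm : c <= m `^ p by apply: ge0_ler_powR; rewrite ?nnegrE ?invr_ge0 ?(ltW p0)//; lra.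
have E : 1 + s `^ p = m `^ p * ((1 + h) `^ p + (1 - h) `^ p).
  rewrite mulrDr -!powRM; [|lra..]; by rewrite mh mh' powR1.
rewrite ge_min; apply/orP; right; rewrite /D E.
have := ler_wpM2l (powR_ge0 m p) (hg h h1); have := ler_wpM2r (ltW g00) cm.
have : rnorm (ofR 2^-1 * (1 + z)) `^ p <= m `^ p.
  by apply: ge0_ler_powR; rewrite ?nnegrE ?rnorm_ge0 ?(ltW p0)//; lra.
move: (rnorm _ `^ p) (m `^ p) (_ + _ `^ p) => A B H; lra.
Qed.

(** Division by the larger modulus leads to the unit disc. Either [|1 - z|^p] is at most [e], or the
    midpoint defect is at least [g |a|^p], which pays for [2^p |a|^p]. The bound is linear in p-th
    powers so that it can be integrated. *)
Lemma scalar_uniformly_convex (e : R) : 0 < e -> exists2 C : R, 0 <= C & forall a b,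
  rnorm (a - b) `^ p <= e * (rnorm a `^ p + rnorm b `^ p) +
    C * ((rnorm a `^ p + rnorm b `^ p) / 2 - rnorm (ofR 2^-1 * (a + b)) `^ p).
Proof.
move=> e0; have [g g0 hg] := disc_uniformly_convex e0.
exists (2 `^ p / g) => [|a b]; first by rewrite divr_ge0 ?powR_ge0// ltW.
wlog ba : a b / rnorm b <= rnorm a.
  move=> H; have [/H//|/ltW/H] := leP (rnorm b) (rnorm a).
  by rewrite (addrC b a) -(rnormN (b - a)) opprB [rnorm b `^ p + _]addrC.
have D0 := rnorm_half_le a b; rewrite -subr_ge0 in D0.
have C0 : 0 <= 2 `^ p / g by rewrite divr_ge0 ?powR_ge0// ltW.
have a0 := rnorm_ge0 a; have b0 := rnorm_ge0 b.
have ap := powR_ge0 (rnorm a) p; have bp := powR_ge0 (rnorm b) p.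
have [a00|an0] := eqVneq a 0.
  move: ba; rewrite {1}a00 rnorm0 => /(conj b0)/andP/le_anti/esym/rnorm_eq0 b00.
  by rewrite a00 b00 subr0 addr0 mulr0 rnorm0 powR0 ?gt_eqF//; lra.
have ra0 : 0 < rnorm a by rewrite lt_def a0 andbT; apply: contra_neq an0 => /rnorm_eq0.
pose z : K := b / a; have z1 : rnorm z <= 1 by rewrite rnormM rnormV ler_pdivrMr// mul1r.
have bz : b = a * z by rewrite mulrCA divff// mulr1.
have abz : a - b = a * (1 - z) by rewrite mulrBr mulr1 -bz.
have abz' : ofR 2^-1 * (a + b) = a * (ofR 2^-1 * (1 + z)).
  by rewrite [RHS]mulrCA [a * (1 + z)]mulrDr mulr1 -bz.
have [small|big] := leP (rnorm (1 - z) `^ p) e.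
  have : rnorm (a - b) `^ p <= e * rnorm a `^ p.
    by rewrite abz rnormM powRM ?rnorm_ge0// mulrC ler_wpM2r.
  have := mulr_ge0 C0 D0; have := mulr_ge0 (ltW e0) bp; lra.
have := hg z z1 (ltW big).
set D := _ - rnorm (_ * (a + b)) `^ p in D0 *; set D' := _ / 2 - rnorm (_ * (1 + z)) `^ p => gD.
have DD : D = rnorm a `^ p * D'.
  have -> : D = (rnorm a `^ p + (rnorm a * rnorm z) `^ p) / 2 -
      (rnorm a * rnorm (ofR 2^-1 * (1 + z) : K)) `^ p.
    by rewrite /D abz' -!rnormM -bz.
  rewrite /D' !powRM ?rnorm_ge0//; move: (_ `^ p) (_ `^ p) (_ `^ p) => A B C; ring.
have : rnorm (a - b) `^ p <= 2 `^ p / g * D.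
  rewrite abz rnormM powRM ?rnorm_ge0// DD mulrCA ler_wpM2l//.
  apply: (@le_trans _ _ (2 `^ p)).
    apply: ge0_ler_powR; rewrite ?nnegrE ?rnorm_ge0 ?(ltW p0)//.
    by apply: le_trans (rnormD _ _) _; rewrite rnormN rnorm1; lra.
  by rewrite -mulrA ler_peMr ?powR_ge0// mulrC ler_pdivlMr// mul1r.
have := mulr_ge0 (ltW e0) (addr_ge0 ap bp); lra.
Qed.

End scalar_inequalities.

(** * Geometry and completeness of Lp *)

Section Lp_geometry.
Context {d : measure_display} {T : measurableType d} {R : realType} {k : scalar_kind}.
Context {mu : {measure set T -> \bar R}} {p : R} {p1 : 1 < p}.
Local Notation K := (scalars R k).
Local Notation X := (@Lp d T R k mu p p1).
Local Notation Fun := (@Lp_fun d T R k mu p p1).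
Local Notation cls := (@Lp_class d T R k mu p p1).
Implicit Types F G H : Fun.

Let p0 : 0 < p. Proof. exact: lt_trans ltr01 p1. Qed.

Lemma Lp_fun_measurable F : measurable_scalar (F : T -> K^o).
Proof. by have /Lp_predP[] := valP F. Qed.

Lemma Lp_fun_measurable_powR F :
  measurable_fun setT (fun t => ((rnorm (F t : K)) `^ p)%:E).
Proof. exact: measurable_powR_rnorm (Lp_fun_measurable F). Qed.

Lemma Lp_normE F : ((rnorm (cls F : X)) `^ p)%:E = (\int[mu]_t ((rnorm (F t : K)) `^ p)%:E)%E.
Proof.
have I0 : (0 <= \int[mu]_t ((rnorm (F t : K)) `^ p)%:E)%E.
  by apply: integral_ge0 => t _; rewrite lee_fin powR_ge0.
rewrite rnorm_Lp_class -poweR_EFin fineK; last first.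
  by rewrite ge0_fin_numE ?pnorm_ge0//; have /Lp_predP[] := valP F.
rewrite /pnorm (powR_Lnorm _ _ (lt0r_neq0 p0)); apply: eq_integral => t _ /=.
by rewrite ger0_norm ?rnorm_ge0.
Qed.

Lemma exists_Lp_fun (f : T -> K^o) : measurable_scalar f ->
  (\int[mu]_t ((rnorm (f t : K)) `^ p)%:E < +oo)%E -> exists F : Fun, forall t, F t = f t.
Proof.
move=> mf If; have h : f \in @Lp_pred d T R k mu p p1.
  by apply/Lp_predP; split => //; rewrite pnormE poweR_lty.
by exists (LpFun h).
Qed.

Lemma Lp_integral_comb F G (a b : R) : 0 <= a -> 0 <= b ->
  (a * rnorm (cls F : X) `^ p + b * rnorm (cls G : X) `^ p)%:E =
  (\int[mu]_t (a * rnorm (F t : K) `^ p + b * rnorm (G t : K) `^ p)%:E)%E.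
Proof.
move=> a0 b0; under eq_integral do rewrite EFinD !EFinM.
rewrite EFinD !EFinM !Lp_normE.
have pos H (c : R) t : 0 <= c -> (0 <= c%:E * (rnorm (H t : K) `^ p)%:E)%E.
  by move=> c0; rewrite mule_ge0 ?lee_fin ?powR_ge0.
have mea H (c : R) : measurable_fun setT (fun t => c%:E * (rnorm (H t : K) `^ p)%:E)%E.
  by apply: measurable_funeM; exact: Lp_fun_measurable_powR.
rewrite ge0_integralD//; [|by move=> t _; exact: pos..].
by rewrite !ge0_integralZl_EFin//; do ?[exact: Lp_fun_measurable_powR
  | by move=> t _; rewrite lee_fin powR_ge0].
Qed.

Lemma Lp_measurable_comb F G (a b : R) :
  measurable_fun setT (fun t => (a * rnorm (F t : K) `^ p + b * rnorm (G t : K) `^ p)%:E).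
Proof.
under eq_fun do rewrite EFinD !EFinM.
by apply: emeasurable_funD; apply: measurable_funeM; exact: Lp_fun_measurable_powR.
Qed.

Lemma Lp_norm_ineq (F1 F2 G1 G2 : Fun) (a1 a2 b1 b2 : R) :
  0 <= a1 -> 0 <= a2 -> 0 <= b1 -> 0 <= b2 ->
  (forall t, a1 * rnorm (F1 t : K) `^ p + a2 * rnorm (F2 t : K) `^ p <=
             b1 * rnorm (G1 t : K) `^ p + b2 * rnorm (G2 t : K) `^ p) ->
  a1 * rnorm (cls F1 : X) `^ p + a2 * rnorm (cls F2 : X) `^ p <=
  b1 * rnorm (cls G1 : X) `^ p + b2 * rnorm (cls G2 : X) `^ p.
Proof.
move=> a10 a20 b10 b20 h.
rewrite -lee_fin (Lp_integral_comb F1 F2 a10 a20) (Lp_integral_comb G1 G2 b10 b20).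
apply: ge0_le_integral => //.
- by move=> t _; rewrite lee_fin addr_ge0 ?mulr_ge0 ?powR_ge0.
- exact: Lp_measurable_comb.
- exact: Lp_measurable_comb.
- by move=> t _; rewrite lee_fin.
Qed.

Lemma Lp_classZ (a : K) F : a *: (cls F : X) = cls (a *: F).
Proof. exact: Lp_class_scale. Qed.

Lemma Lp_classB F G : (cls F : X) - cls G = cls (F - G).
Proof. by rewrite Lp_classD -scaleN1r -[- G]scaleN1r -Lp_classZ. Qed.

(** Integration bounds the p-th power of the distance by [e^p / 2] plus [C] times the defect of the
    p-th power of [rnorm (x + z) / 2] from 1. Bernoulli bounds this defect by [p] times that of the
    norm, hence the product [C * p] in [dl]. *)
Lemma Lp_uniformly_convex : uniformly_convex X.
Proof.
move=> e e0; have ep : 0 < e `^ p by rewrite powR_gt0.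
have [|C C0 hC] := @scalar_uniformly_convex R k p p1 (e `^ p / 4); first by rewrite divr_gt0.
pose dl := Num.min 1 (e `^ p / (C * p + 1)).
have Cp : 0 < C * p + 1 by rewrite ltr_wpDl// mulr_ge0// ltW.
have dl0 : 0 < dl by rewrite lt_min ltr01 divr_gt0.
exists dl => // x z x1 z1 xz; set F := repr x; set G := repr z.
have xF : x = cls F by rewrite /F Lp_class_repr.
have zG : z = cls G by rewrite /G Lp_class_repr.
pose M : Fun := ofR 2^-1 *: (F + G).
have Mxz : rnorm (cls M : X) = rnorm (x + z) / 2.
  by rewrite -Lp_classZ Lp_classD -xF -zG nrmZR ger0_norm ?invr_ge0// mulrC.
have := @Lp_norm_ineq (F - G) M F G 1 C (e `^ p / 4 + C / 2) (e `^ p / 4 + C / 2).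
rewrite -Lp_classB -xF -zG x1 z1 powR1 Mxz !mulr1 !mul1r => H.
have {}H : rnorm (x - z) `^ p + C * (rnorm (x + z) / 2) `^ p <= e `^ p / 2 + C.
  apply: (@le_trans _ _ (e `^ p / 4 + C / 2 + (e `^ p / 4 + C / 2))); last by lra.
  apply: H; [by []|by []|lra|lra|move=> t].
  by have := hC (F t) (G t); rewrite -[ofR 2^-1 * _]/(M t) -[F t - G t]/((F - G) t) mul1r; lra.
have B : 1 + p * (rnorm (x + z) / 2 - 1) <= (rnorm (x + z) / 2) `^ p.
  by apply: powR_Bernoulli => //; rewrite divr_ge0 ?nrm_ge0.
have CB := ler_wpM2l C0 B.
have dle : dl * (C * p + 1) <= e `^ p by rewrite -ler_pdivlMr// ge_min lexx orbT.
have Cpd : C * p * (dl / 2) < e `^ p / 2 by nra.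
have Cpx : C * p * (1 - rnorm (x + z) / 2) <= C * p * (dl / 2).
  by rewrite ler_wpM2l ?mulr_ge0 ?(ltW p0)//; lra.
have : rnorm (x - z) `^ p < e `^ p by lra.
rewrite !ltNge; apply: contraNN => ex.
by apply: ge0_ler_powR; rewrite ?nnegrE ?nrm_ge0 ?(ltW p0) ?(ltW e0).
Qed.

Lemma Lp_uniformly_smooth : uniformly_smooth X.
Proof.
move=> e e0; have e20 : 0 < e / 2 by rewrite divr_gt0.
have [t t0 ht] := @scalar_uniformly_smooth R k p p1 (e / 2) e20.
exists t => // x h x1 h1; set F := repr x; set G := repr h.
have xF : x = cls F by rewrite /F Lp_class_repr.
have hG : h = cls G by rewrite /G Lp_class_repr.
have te0 := mulr_gt0 e20 t0.
have := @Lp_norm_ineq (F + ofR t *: G) (F - ofR t *: G) F G 1 1 (2 + e / 2 * t) (e / 2 * t).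
rewrite Lp_classD -Lp_classB -Lp_classZ -xF -hG x1 powR1 !mulr1 !mul1r => H.
have {}H : rnorm (x + ofR t *: h) `^ p + rnorm (x - ofR t *: h) `^ p <=
    2 + e / 2 * t + e / 2 * t * rnorm h `^ p.
  apply: H => //; [lra|lra|move=> s].
  by have := ht (F s) (G s); rewrite !mul1r mulrDr mulrDl; lra.
have hp : rnorm h `^ p <= 1.
  rewrite -[leRHS](congr1 (fun f : R -> R => f p) (@powR1 R)).
  by apply: ge0_ler_powR; rewrite ?nnegrE ?nrm_ge0 ?(ltW p0).
(* Bernoulli leads from the integrated p-th powers back to the norms. *)
have B (y : X) : p * (rnorm y - 1) <= rnorm y `^ p - 1.
  by rewrite lerBrDl; apply: powR_Bernoulli => //; exact: nrm_ge0.
have := B (x + ofR t *: h); have := B (x - ofR t *: h).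
have := ler_wpM2l (ltW te0) hp; rewrite mulr1.
move: (rnorm (x + _)) (rnorm (x - _)) H => u v H h2 h3 h4.
have : p * (u + v - 2) <= e * t by lra.
move=> h5; rewrite -lerBlDl [t * e]mulrC.
have [u2|u2] := leP (u + v - 2) 0; first by rewrite (le_trans u2)// mulr_ge0 ?ltW.
by apply: le_trans h5; rewrite ler_peMl// ltW.
Qed.

End Lp_geometry.

(** * Limits of real sequences and functions, for the completeness of [Lp] *)

Lemma cvgn_bounded_variation (R : realType) (x : nat -> R) (M : R) :
  (forall m, \sum_(i < m) `|x i.+1 - x i| <= M) -> cvgn x.
Proof.
move=> xM; have : cvgn (series (fun i => x i.+1 - x i)).
  apply: normed_cvg.
  rewrite (_ : [normed series _] = fun n => \sum_(i < n) `|x i.+1 - x i|); last first.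
    by apply/funext => n; rewrite /normed_series_of /series/= big_mkord.
  apply: nondecreasing_is_cvgn; last by exists M => _ [m _ <-].
  by apply/nondecreasing_seqP => n; rewrite big_ord_recr/= lerDl.
rewrite (_ : series _ = (fun n => x n - x 0%N)); last first.
  by apply/funext => n; rewrite seriesEnat/= telescope_sumr.
move=> cx; rewrite (_ : x = (fun n => (x n - x 0%N) + x 0%N)); last first.
  by apply/funext => n; rewrite subrK.
by apply: is_cvgD => //; exact: is_cvg_cst.
Qed.

Lemma powR_lipschitz (R : realType) (p a b M : R) : 1 < p -> 0 <= a <= M -> 0 <= b <= M ->
  `|a `^ p - b `^ p| <= p * M `^ (p - 1) * `|a - b|.
Proof.
move=> p1; have q0 : 0 <= p - 1 by lra.
wlog ba : a b / b <= a.
  move=> H ha hb; have [/H/(_ ha hb)//|/ltW/H/(_ hb ha)] := leP b a.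
  by rewrite distrC (distrC a).
move=> /andP[a0 aM] /andP[b0 bM].
rewrite !ger0_norm ?subr_ge0//; last by apply: ge0_ler_powR; rewrite ?nnegrE//; lra.
have [a00|an0] := eqVneq a 0.
  have -> : b = a by apply/le_anti; rewrite ba a00 b0.
  by rewrite !subrr mulr0.
have ag : 0 < a by rewrite lt_def an0.
have := powR_tangent p1 ag b0.
have : a `^ (p - 1) <= M `^ (p - 1).
  by apply: ge0_ler_powR; rewrite ?nnegrE// (le_trans a0 aM).
move=> aM'; have : p * a `^ (p - 1) * (a - b) <= p * M `^ (p - 1) * (a - b).
  by rewrite ler_wpM2r ?subr_ge0// ler_wpM2l//; lra.
lra.
Qed.

Lemma cvgn_powR (R : realType) (p : R) (x : nat -> R) (l : R) : 1 < p ->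
  (forall n, 0 <= x n) -> 0 <= l -> x @ \oo --> l -> (fun n => x n `^ p) @ \oo --> l `^ p.
Proof.
move=> p1 x0 l0 xl; apply/cvgrPdist_le => e e0.
pose C := p * (l + 1) `^ (p - 1) + 1.
have C0 : 0 < C by rewrite ltr_wpDl// mulr_ge0 ?powR_ge0//; lra.
have /cvgrPdist_le/(_ _ (divr_gt0 e0 C0)) h := xl.
have /cvgrPdist_le/(_ _ ltr01) h1 := xl.
near=> n.
have A : `|l - x n| <= e / C by near: n.
have B : `|l - x n| <= 1 by near: n.
apply: le_trans (@powR_lipschitz R p l (x n) (l + 1) p1 _ _) _.
- by rewrite l0 lerDl ler01.
- by rewrite x0 /=; move: B; rewrite ler_norml => /andP[]; lra.
apply: (@le_trans _ _ (C * `|l - x n|)); first by rewrite ler_wpM2r// lerDl.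
by rewrite mulrC -ler_pdivlMr.
Unshelve. all: by end_near. Qed.

Lemma limn_einf_le (R : realType) (u : nat -> \bar R) (b : \bar R) :
  (forall n, (u n <= b)%E) -> (limn_einf u <= b)%E.
Proof.
move=> ub; rewrite limn_einf_lim; apply: lime_le; first exact: is_cvg_einfs.
near=> n; apply: le_trans (ub n); apply: ereal_inf_lbound; exists n => //=.
Unshelve. all: by end_near. Qed.

Lemma limn_einf_ge0 (R : realType) (u : nat -> \bar R) :
  (forall n, (0 <= u n)%E) -> (0 <= limn_einf u)%E.
Proof.
move=> u0; rewrite limn_einf_lim; apply: lime_ge; first exact: is_cvg_einfs.
by near=> n; apply: le_ereal_inf_tmp => _ [m _ <-].
Unshelve. all: by end_near. Qed.

Lemma measurable_limn_einf (d : measure_display) (T : measurableType d) (R : realType)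
    (f : nat -> T -> \bar R) : (forall n, measurable_fun setT (f n)) ->
  measurable_fun setT (fun t => limn_einf (f^~ t)).
Proof.
move=> mf; apply: (emeasurable_fun_cvg (fun n t => einfs (f^~ t) n)).
  exact: measurable_fun_einfs.
by move=> t _; rewrite limn_einf_lim; exact: is_cvg_einfs.
Qed.

Section Lp_complete.
Context {d : measure_display} {T : measurableType d} {R : realType} {k : scalar_kind}.
Context {mu : {measure set T -> \bar R}} {p : R} {p1 : 1 < p}.
Local Notation K := (scalars R k).
Local Notation X := (@Lp d T R k mu p p1).
Local Notation Fun := (@Lp_fun d T R k mu p p1).
Local Notation cls := (@Lp_class d T R k mu p p1).
Implicit Types F G H : Fun.

Let p0 : 0 < p. Proof. exact: lt_trans ltr01 p1. Qed.

Lemma measurable_scalar_ofR (g : T -> R) : measurable_fun setT g ->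
  measurable_scalar (fun t => ofR (g t) : K^o).
Proof.
move=> mg; split; first by rewrite (_ : _ \o _ = g)//; apply/funext => t /=; rewrite re_ofR.
rewrite (_ : _ \o _ = cst 0); first exact: measurable_cst.
by apply/funext => t /=; rewrite im_ofR.
Qed.

Lemma Lp_norm_le F G : (forall t, rnorm (F t : K) <= rnorm (G t : K)) ->
  rnorm (cls F : X) <= rnorm (cls G : X).
Proof.
move=> FG; suff : rnorm (cls F : X) `^ p <= rnorm (cls G : X) `^ p.
  apply: contraTT; rewrite -!ltNge => h.
  by apply: gt0_ltr_powR; rewrite ?nnegrE ?nrm_ge0.
rewrite -lee_fin !Lp_normE; apply: ge0_le_integral => //.
- by move=> t _; rewrite lee_fin powR_ge0.
- exact: Lp_fun_measurable_powR.
- exact: Lp_fun_measurable_powR.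
- by move=> t _; rewrite lee_fin; apply: ge0_ler_powR; rewrite ?nnegrE ?rnorm_ge0 ?(ltW p0).
Qed.

Lemma exists_Lp_fun_le (f : T -> K^o) G : measurable_scalar f ->
  (forall t, rnorm (f t : K) <= rnorm (G t : K)) -> exists F : Fun, forall t, F t = f t.
Proof.
move=> mf fG; apply: exists_Lp_fun => //.
apply: (@le_lt_trans _ _ ((rnorm (cls G : X) `^ p)%:E)); last exact: ltry.
rewrite Lp_normE; apply: ge0_le_integral => //.
- by move=> t _; rewrite lee_fin powR_ge0.
- exact: measurable_powR_rnorm.
- exact: Lp_fun_measurable_powR.
- by move=> t _; rewrite lee_fin; apply: ge0_ler_powR; rewrite ?nnegrE ?rnorm_ge0 ?(ltW p0).
Qed.

Lemma exists_Lp_abs F : exists2 G : Fun, forall t, G t = ofR (rnorm (F t : K)) &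
  rnorm (cls G : X) = rnorm (cls F : X).
Proof.
have [||G hG] := @exists_Lp_fun_le (fun t => ofR (rnorm (F t : K))) F.
- apply: measurable_scalar_ofR; apply: measurable_rnorm; exact: Lp_fun_measurable.
- by move=> t; rewrite rnorm_ofR ger0_norm ?rnorm_ge0.
exists G => //; apply/le_anti; apply/andP; split; apply: Lp_norm_le => t;
  by rewrite hG rnorm_ofR ger0_norm ?rnorm_ge0.
Qed.

Let cvg_rnorm_powR (z : nat -> K) (l w : K) :
  (fun n => re (z n)) @ \oo --> re l -> (fun n => im (z n)) @ \oo --> im l ->
  (fun n => rnorm (z n - w) `^ p) @ \oo --> rnorm (l - w) `^ p.
Proof.
move=> zr zi; apply: cvgn_powR => // [n||]; rewrite ?rnorm_ge0//.
rewrite rnormE; under eq_fun do rewrite rnormE.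
apply: continuous_cvg; first exact: sqrt_continuous.
rewrite !reD !imD !reN !imN; under eq_fun do rewrite !reD !imD !reN !imN.
by apply: cvgD; rewrite expr2; under eq_fun do rewrite expr2; apply: cvgM; apply: cvgD => //;
  exact: cvg_cst.
Qed.

(* A pointwise limit exists almost everywhere; the upper limits make it measurable
   without isolating the set of convergence. *)
Lemma Lp_ae_limit (f : nat -> Fun) (c : R) :
  (forall n, rnorm (cls (f n.+1) - cls (f n) : X) <= c * pow2 n) ->
  exists2 g : T -> K^o, measurable_scalar g & {ae mu, forall t,
    (fun n => re (f n t : K)) @ \oo --> re (g t : K) /\
    (fun n => im (f n t : K)) @ \oo --> im (g t : K)}.
Proof.
move=> h; have c0 : 0 <= c by apply: (rapid_coef_ge0 (u := fun n => cls (f n) : X)).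
have /choice[A hA] : forall n, exists G : Fun,
    (forall t, G t = ofR (rnorm (f n.+1 t - f n t : K))) /\
    rnorm (cls G : X) <= c * pow2 n.
  move=> n; have [G G1 G2] := exists_Lp_abs (f n.+1 - f n).
  by exists G; split => //; rewrite G2 -Lp_classB.
pose H := nat_rect (fun=> Fun) 0 (fun n G => G + A n).
pose S m t : R := \sum_(i < m) rnorm (f i.+1 t - f i t : K).
have HS m t : H m t = ofR (S m t).
  elim: m => [|m ih]; first by rewrite /S big_ord0 ofR0.
  by rewrite -[H m.+1 t]/(H m t + A m t) ih (hA m).1 /S big_ord_recr ofRD.
have S0 m t : 0 <= S m t by apply: sumr_ge0 => i _; exact: rnorm_ge0.
have nH m : rnorm (cls (H m) : X) <= 2 * c * (1 - pow2 m).
  elim: m => [|m ih].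
    rewrite /pow2 expr0 subrr mulr0 (_ : cls (H 0%N) = 0) ?nrm0//.
    by rewrite -(scale0r (cls 0 : X)) Lp_classZ scale0r.
  rewrite -[H m.+1]/(H m + A m) Lp_classD; apply: le_trans (nrmD _ _) _.
  by have [_] := hA m; move: ih; rewrite pow2S; lra.
pose V m t : \bar R := (S m t `^ p)%:E.
have VH m t : V m t = ((rnorm (H m t : K)) `^ p)%:E.
  by rewrite HS rnorm_ofR ger0_norm.
have mV m : measurable_fun setT (V m).
  rewrite (_ : V m = fun t => ((rnorm (H m t : K)) `^ p)%:E); last exact/funext.
  exact: Lp_fun_measurable_powR.
have homoV t : {homo V^~ t : n m / (n <= m)%N >-> (n <= m)%E}.
  move=> n m nm; rewrite lee_fin; apply: ge0_ler_powR; rewrite ?nnegrE ?(ltW p0)//.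
  rewrite /S -(subnKC nm) big_split_ord /= lerDl sumr_ge0// => i _; exact: rnorm_ge0.
have V0 m t : (0 <= V m t)%E by rewrite lee_fin powR_ge0.
have cV t := ereal_nondecreasing_is_cvgn (homoV t).
(* By monotone convergence the total variation of the sequence at [t] has an integrable p-th power,
   so it is finite almost everywhere, and there the values converge. *)
have Ilim : (\int[mu]_t limn (V^~ t) <= ((2 * c) `^ p)%:E)%E.
  rewrite monotone_convergence//; apply: lime_le.
    apply: ereal_nondecreasing_is_cvgn => n m nm.
    by apply: ge0_le_integral => // t _; exact: homoV.
  apply: nearW => m; under eq_integral do rewrite VH.
  rewrite -Lp_normE lee_fin; apply: ge0_ler_powR; rewrite ?nnegrE ?nrm_ge0 ?(ltW p0) ?mulr_ge0//.
  by apply: le_trans (nH m) _; rewrite ler_piMr ?mulr_ge0//; have := @pow2_gt0 R m; lra.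
have lim0 t : (0 <= limn (V^~ t))%E by apply: lime_ge => //; exact: nearW.
have mlim : measurable_fun setT (fun t => limn (V^~ t)).
  by apply: (emeasurable_fun_cvg V) => // t _; exact: cV.
have : mu.-integrable setT (fun t => limn (V^~ t)).
  apply/integrableP; split => //; under eq_integral do rewrite gee0_abs//.
  exact: le_lt_trans Ilim (ltry _).
move=> /(integrable_ae measurableT) fin.
pose r t := fine (limn_esup (fun n => (re (f n t : K))%:E)).
pose i t := fine (limn_esup (fun n => (im (f n t : K))%:E)).
have mr : measurable_fun setT r.
  apply: measurableT_comp => //; apply: measurable_fun_limn_esup => n.
  by apply/measurable_EFinP; have [] := Lp_fun_measurable (f n).
have mi : measurable_fun setT i.
  apply: measurableT_comp => //; apply: measurable_fun_limn_esup => n.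
  by apply/measurable_EFinP; have [] := Lp_fun_measurable (f n).
exists (fun t => of_reim (r t) (i t)).
  split; first by rewrite (_ : _ \o _ = r)//; apply/funext => t /=; rewrite re_of_reim.
  rewrite (_ : _ \o _ = fun t => if k is real_scalars then 0 else i t); last first.
    by apply/funext => t /=; rewrite im_of_reim.
  by case: k; [exact: measurable_cst|].
apply: filterS fin => t /(_ I); rewrite ge0_fin_numE// => ft.
(* If [S m t] exceeds 1, Bernoulli bounds it by its own p-th power; the summand 1 covers the other
   case. *)
pose M := 1 + fine (limn (V^~ t)).
have SM m : S m t <= M.
  have : (V m t <= limn (V^~ t))%E.
    rewrite (cvg_lim _ (ereal_nondecreasing_cvgn (homoV t)))//.
    by apply: ereal_sup_ubound; exists m.
  rewrite -(@fineK _ (limn _)) ?ge0_fin_numE// lee_fin => Vm.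
  have := powR_Bernoulli p1 (S0 m t).
  have [S1|S1] := leP (S m t) 1; first by rewrite (le_trans S1)// lerDl fine_ge0.
  have : S m t - 1 <= p * (S m t - 1) by rewrite ler_peMl ?(ltW p1)// subr_ge0 ltW.
  by move=> S1' B; rewrite /M -lerBlDl; apply: le_trans _ Vm; lra.
have conv (q : K -> R) : (forall a b, q (a - b) = q a - q b) ->
    (forall a, `|q a| <= rnorm a) ->
    (fun n => q (f n t)) @ \oo --> fine (limn_esup (fun n => (q (f n t))%:E)).
  move=> qB qle; have cq : cvgn (fun n => q (f n t)).
    apply: (@cvgn_bounded_variation R _ M) => m; apply: le_trans (SM m).
    by apply: ler_sum => j _; rewrite -qB.
  have cqE : (fun n => (q (f n t))%:E) @ \oo --> (limn (fun n => q (f n t)))%:E.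
    by apply/fine_cvgP; split; [exact: nearW|exact: cq].
  by have [_ ->] := cvg_limn_einf_sup cqE.
rewrite re_of_reim im_of_reim; split.
  by apply: conv => [a b|a]; [rewrite reD reN|exact: normr_re_le].
have imt : (fun n => im (f n t : K)) @ \oo --> i t.
  by apply: conv => [a b|a]; [rewrite imD imN|exact: normr_im_le].
have [im0|->//] := @im_trivial R k.
by rewrite -(im_of_reim (r t)) im0; under eq_fun do rewrite im0; exact: cvg_cst.
Qed.

(** Fatou's lemma along the differences [f (n + m) - f n] turns the almost everywhere limit [g] into
    a norm bound on [g - f n]. For [n = 0] it shows that [g - f 0] is in [L_p], and this function
    plus [f 0] represents the limit. *)
Lemma Lp_rapidly_complete : rapidly_complete X.
Proof.
move=> u c h; have c0 := rapid_coef_ge0 h.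
pose f n : Fun := repr (u n); have uf n : u n = cls (f n) by rewrite /f Lp_class_repr.
have [|g mg fg] := @Lp_ae_limit f c; first by move=> n; rewrite -!uf.
have mgf n : measurable_scalar (fun t => g t - f n t : K^o).
  have := measurable_scalarD mg (measurable_scalarZ (-1) (Lp_fun_measurable (f n))).
  rewrite (_ : g + _ = fun t => g t - f n t)//.
  by apply/funext => t; rewrite /GRing.add /= scaleN1r.
have key n : (\int[mu]_t (rnorm (g t - f n t : K) `^ p)%:E <= ((2 * c * pow2 n) `^ p)%:E)%E.
  pose V m t : \bar R := (rnorm ((f (n + m)%N - f n) t : K) `^ p)%:E.
  have mV m : measurable_fun setT (V m) by exact: Lp_fun_measurable_powR.
  apply: (@le_trans _ _ (\int[mu]_t limn_einf (V^~ t))%E).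
    apply: ae_ge0_le_integral => //.
    - by move=> t _; rewrite lee_fin powR_ge0.
    - exact: measurable_powR_rnorm (mgf n).
    - by move=> t _; apply: limn_einf_ge0 => m; rewrite lee_fin powR_ge0.
    - exact: measurable_limn_einf.
    apply: filterS fg => t [fr fi] _.
    have -> : limn_einf (V^~ t) = (rnorm (g t - f n t : K) `^ p)%:E; last by [].
    have cV : (fun m => rnorm (f (n + m)%N t - f n t : K) `^ p) @ \oo -->
        rnorm (g t - f n t : K) `^ p.
      have sh (q : K -> R) (l : R) : (fun m => q (f m t)) @ \oo --> l ->
          (fun m => q (f (n + m)%N t)) @ \oo --> l.
        rewrite -(cvg_shiftn n) /=.
        rewrite (_ : (fun m => q (f (n + m)%N t)) = fun m => q (f (m + n)%N t))//.
        by apply/funext => m; rewrite addnC.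
      by apply: cvg_rnorm_powR; exact: sh.
    have cVE : V^~ t @ \oo --> (rnorm (g t - f n t : K) `^ p)%:E.
      by apply/fine_cvgP; split; [exact: nearW|exact: cV].
    by have [-> _] := cvg_limn_einf_sup cVE.
  apply: le_trans (fatou _ _ _ _) _ => //.
    by move=> m t _; rewrite lee_fin powR_ge0.
  apply: limn_einf_le => m; rewrite -Lp_normE -Lp_classB -!uf lee_fin.
  apply: ge0_ler_powR; rewrite ?nnegrE ?nrm_ge0 ?(ltW p0) ?mulr_ge0 ?(ltW (pow2_gt0 _))//.
  apply: le_trans (rapid_dist h n m) _; rewrite ler_wpM2l ?mulr_ge0//.
  by rewrite lerBlDr lerDl ltW// pow2_gt0.
have [||G hG] := @exists_Lp_fun _ _ _ _ mu p p1 (fun t => g t - f 0%N t : K^o) => //.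
  exact: le_lt_trans (key 0%N) (ltry _).
exists (cls (G + f 0%N)) => n; rewrite uf Lp_classB.
have : rnorm (cls (G + f 0%N - f n) : X) `^ p <= (2 * c * pow2 n) `^ p.
  rewrite -lee_fin Lp_normE; apply: le_trans (key n); rewrite le_eqVlt; apply/orP; left.
  apply/eqP/eq_integral => t _.
  by rewrite -[(G + f 0%N - f n) t]/(G t + f 0%N t - f n t) hG subrK.
apply: contraTT; rewrite -!ltNge => lt.
by apply: gt0_ltr_powR; rewrite ?nnegrE ?nrm_ge0 ?mulr_ge0 ?(ltW (pow2_gt0 _)).
Qed.

End Lp_complete.

(** * Duality in Lp *)

Section scalar_integral.
Context {d : measure_display} {T : measurableType d} {R : realType} {k : scalar_kind}.
Variable mu : {measure set T -> \bar R}.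
Local Notation K := (scalars R k).
Implicit Types (h g : T -> K) (a : K).

Definition scalar_integrable h :=
  mu.-integrable setT (EFin \o (fun t => re (h t))) /\
  mu.-integrable setT (EFin \o (fun t => im (h t))).

Definition scalar_integral h : K :=
  of_reim (\int[mu]_t re (h t)) (\int[mu]_t im (h t)).

Lemma re_scalar_integral h : re (scalar_integral h) = \int[mu]_t re (h t).
Proof. exact: re_of_reim. Qed.

Lemma scalar_integrable_le h (g : T -> \bar R) : measurable_scalar (h : T -> K^o) ->
  mu.-integrable setT g -> (forall t, ((rnorm (h t))%:E <= g t)%E) -> scalar_integrable h.
Proof.
move=> [mr mi] ig hg; split.
- apply: (le_integrable measurableT _ _ ig); first exact/measurable_EFinP.
  move=> t _; rewrite /= (le_trans _ (lee_abs _))//; apply: le_trans (hg t).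
  by rewrite lee_fin normr_re_le.
- apply: (le_integrable measurableT _ _ ig); first exact/measurable_EFinP.
  move=> t _; rewrite /= (le_trans _ (lee_abs _))//; apply: le_trans (hg t).
  by rewrite lee_fin normr_im_le.
Qed.

Lemma scalar_integralD h g : scalar_integrable h -> scalar_integrable g ->
  scalar_integral (fun t => h t + g t) = scalar_integral h + scalar_integral g.
Proof.
move=> [hr hi] [gr gi]; rewrite /scalar_integral -of_reimD; congr of_reim.
  by under eq_Rintegral do rewrite reD; rewrite RintegralD.
by under eq_Rintegral do rewrite imD; rewrite RintegralD.
Qed.

Lemma scalar_integralZ a h : scalar_integrable h ->
  scalar_integral (fun t => a * h t) = a * scalar_integral h.
Proof.
move=> [hr hi]; rewrite /scalar_integral -of_reimM.
have ir (c : R) : mu.-integrable setT (EFin \o (fun t => c * re (h t))).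
  by rewrite (_ : _ \o _ = fun t => c%:E * (re (h t))%:E)%E; [exact: integrableZl|exact/funext].
have ii (c : R) : mu.-integrable setT (EFin \o (fun t => c * im (h t))).
  by rewrite (_ : _ \o _ = fun t => c%:E * (im (h t))%:E)%E; [exact: integrableZl|exact/funext].
congr of_reim.
  by under eq_Rintegral do rewrite reM; rewrite RintegralB// !RintegralZl.
by under eq_Rintegral do rewrite imM; rewrite RintegralD// !RintegralZl.
Qed.

Lemma scalar_integral_ae h g : measurable_scalar (h : T -> K^o) ->
  measurable_scalar (g : T -> K^o) -> {ae mu, forall t, h t = g t} ->
  scalar_integral h = scalar_integral g.
Proof.
move=> [hr hi] [gr gi] hg; congr of_reim.
  congr fine; apply: ae_eq_integral => //; try exact/measurable_EFinP.
  by apply: filterS hg => t -> _.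
congr fine; apply: ae_eq_integral => //; try exact/measurable_EFinP.
by apply: filterS hg => t -> _.
Qed.

Lemma rnorm_scalar_integral h : measurable_scalar (h : T -> K^o) -> scalar_integrable h ->
  ((rnorm (scalar_integral h))%:E <= \int[mu]_t (rnorm (h t))%:E)%E.
Proof.
move=> mh ih; have [u u1 hu] := phaseP (scalar_integral h).
have := congr1 re hu; rewrite re_ofR -(scalar_integralZ u ih) re_scalar_integral => <-.
have ifin : mu.-integrable setT (EFin \o (fun t => re (u * h t))).
  have [hr hi] := ih; rewrite (_ : _ \o _ = fun t =>
      (re u)%:E * (re (h t))%:E - (im u)%:E * (im (h t))%:E)%E; last first.
    by apply/funext => t; rewrite /= reM EFinB !EFinM.
  by apply: integrableB => //; exact: integrableZl.
rewrite /Rintegral fineK; last exact: integrable_fin_num.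
apply: (@le_trans _ _ (\int[mu]_t `|(re (u * h t))%:E|)%E).
  apply: le_trans (le_abse_integral _ _ _) => //; first exact: lee_abs.
  exact: measurable_int ifin.
apply: ge0_le_integral => //.
- by apply: measurableT_comp => //; exact: measurable_int ifin.
- by apply/measurable_EFinP; exact: measurable_rnorm.
- by move=> t _; rewrite lee_fin (le_trans (normr_re_le _))// rnormM u1 mul1r.
Qed.

End scalar_integral.

Section dual_map.
Context {R : realType} {k : scalar_kind} (p : R) (p1 : 1 < p).
Local Notation K := (scalars R k).
Implicit Types a b : K.

(* The scalar duality map [|a|^(p-2) a^*], in a form that needs no conjugation and
   vanishes at [0] since [0^-1 = 0]. *)
Definition dualf a : K := ofR (rnorm a `^ p) / a.

Lemma dualf0 : dualf 0 = 0.
Proof. by rewrite /dualf invr0 mulr0. Qed.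

Lemma dualfM a b : dualf (a * b) = dualf a * dualf b.
Proof.
by rewrite /dualf rnormM powRM ?rnorm_ge0// ofRM invfM mulrACA.
Qed.

Lemma dualfN a : dualf (- a) = - dualf a.
Proof. by rewrite /dualf rnormN invrN mulrN. Qed.

Lemma dualfK a : dualf a * a = ofR (rnorm a `^ p).
Proof.
have [->|a0] := eqVneq a 0; last by rewrite /dualf mulfVK.
by rewrite mulr0 rnorm0 powR0 ?ofR0// gt_eqF// (lt_trans ltr01 p1).
Qed.

Lemma rnorm_dualf a : rnorm (dualf a) = rnorm a `^ (p - 1).
Proof.
have [->|a0] := eqVneq a 0.
  by rewrite dualf0 rnorm0 powR0// subr_eq0 gt_eqF.
have ra : rnorm a != 0 := rnorm_neq0 a0.
rewrite /dualf rnormM rnorm_ofR rnormV ger0_norm ?powR_ge0//.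
rewrite -(mulr_powRB1 (rnorm_ge0 a) (lt_trans ltr01 p1)).
by rewrite mulrAC divff// mul1r.
Qed.

(** The conjugate form of the duality map in coordinates, from which its measurability is read off.
    Away from 0 it comes from solving [a * dualf a = ofR (rnorm a ^p)] for the two coordinates. *)
Lemma reim_dualf a : re (dualf a) = rnorm a `^ (p - 2) * re a /\
  im (dualf a) = - (rnorm a `^ (p - 2) * im a).
Proof.
have [->|a0] := eqVneq a 0.
  rewrite dualf0 -(@ofR0 R k) re_ofR im_ofR !mulr0 oppr0//.
have ra : rnorm a != 0 := rnorm_neq0 a0.
have h : a * dualf a = ofR (rnorm a `^ p) by rewrite mulrC dualfK.
have hr := congr1 re h; have hi := congr1 im h.
move: hr hi; rewrite reM imM re_ofR im_ofR.
have -> : rnorm a `^ p = rnorm a ^+ 2 * rnorm a `^ (p - 2).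
  by rewrite -powR_mulrn ?rnorm_ge0// -powRD ?ra ?implybT//; congr (_ `^ _); ring.
move: (re (dualf a)) (im (dualf a)) (rnorm a `^ (p - 2)) => x y q.
have s := sqr_rnorm a; have sn : rnorm a ^+ 2 != 0 by rewrite sqrf_eq0.
move=> h1 h2; split; apply: (mulfI sn).
  have : re a * (re a * x - im a * y) + im a * (re a * y + im a * x) = re a * (rnorm a ^+ 2 * q).
    by rewrite h1 h2 mulr0 addr0.
  by rewrite s; lra.
have : re a * (re a * y + im a * x) - im a * (re a * x - im a * y) = - im a * (rnorm a ^+ 2 * q).
  by rewrite h1 h2 mulr0 sub0r mulNr.
by rewrite s; lra.
Qed.

(** The tangent of the p-th power at [x], evaluated at [y] and divided by [p]. Unlike in
    [powR_mixed] the coefficients sum to 1, which makes the pairing a functional of norm at most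
    1. *)
Lemma powR_young (x y : R) : 0 <= x -> 0 <= y ->
  x `^ (p - 1) * y <= (p - 1) / p * x `^ p + p^-1 * y `^ p.
Proof.
move=> x0 y0; have p0 := lt_trans ltr01 p1.
have [->|xn] := eqVneq x 0.
  rewrite !powR0 ?gt_eqF ?subr_gt0// mul0r mulr0 add0r mulr_ge0 ?powR_ge0 ?invr_ge0 ?ltW//.
have xg : 0 < x by rewrite lt_def xn.
have := powR_tangent p1 xg y0; rewrite -(mulr_powRB1 x0 p0) => h.
rewrite -(ler_pM2l p0) mulrDr !mulrA mulfV ?gt_eqF// mul1r.
rewrite (_ : p * (p - 1) / p = p - 1); last by field; rewrite gt_eqF.
lra.
Qed.

Lemma measurable_dualf (d : measure_display) (T : measurableType d) (f : T -> K^o) :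
  measurable_scalar f -> measurable_scalar (fun t => dualf (f t) : K^o).
Proof.
move=> mf; have [mr mi] := mf.
have mp : measurable_fun setT (fun t => rnorm (f t : K) `^ (p - 2)).
  by apply: (@measurableT_comp _ _ _ _ _ _ (@powR R ^~ (p - 2))) => //; exact: measurable_rnorm.
split.
  rewrite (_ : _ \o _ = fun t => rnorm (f t : K) `^ (p - 2) * re (f t : K)).
    exact: measurable_funM.
  by apply/funext => t /=; rewrite (reim_dualf _).1.
rewrite (_ : _ \o _ = fun t => - (rnorm (f t : K) `^ (p - 2) * im (f t : K))).
  by apply: measurableT_comp => //; exact: measurable_funM.
by apply/funext => t /=; rewrite (reim_dualf _).2.
Qed.

Lemma measurable_scalarM (d : measure_display) (T : measurableType d) (f g : T -> K^o) :
  measurable_scalar f -> measurable_scalar g ->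
  measurable_scalar (fun t => (f t : K) * (g t : K) : K^o).
Proof.
move=> [fr fi] [gr gi]; split.
  rewrite (_ : _ \o _ = fun t => re (f t : K) * re (g t : K) - im (f t : K) * im (g t : K)).
    by apply: measurable_funB; exact: measurable_funM.
  by apply/funext => t /=; rewrite reM.
rewrite (_ : _ \o _ = fun t => re (f t : K) * im (g t : K) + im (f t : K) * re (g t : K)).
  by apply: measurable_funD; exact: measurable_funM.
by apply/funext => t /=; rewrite imM.
Qed.

End dual_map.

Section Lp_duality.
Context {d : measure_display} {T : measurableType d} {R : realType} {k : scalar_kind}.
Context {mu : {measure set T -> \bar R}} {p : R} {p1 : 1 < p}.
Local Notation K := (scalars R k).
Local Notation X := (@Lp d T R k mu p p1).
Local Notation Fun := (@Lp_fun d T R k mu p p1).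
Local Notation cls := (@Lp_class d T R k mu p p1).
Implicit Types (F G H : Fun) (w v : T -> K) (x y : X).

Let p0 : 0 < p. Proof. exact: lt_trans ltr01 p1. Qed.

(* A condition for [w] to pair with all of [L_p] that needs no conjugate exponent. *)
Definition dual_weight w := measurable_scalar (w : T -> K^o) /\
  exists G, forall t, rnorm (w t) <= rnorm (G t : K) `^ (p - 1).

Lemma dual_weight_integrable w F : dual_weight w ->
  scalar_integrable mu (fun t => w t * F t).
Proof.
move=> [mw [G wG]]; pose g t := (1 * rnorm (F t : K) `^ p + 1 * rnorm (G t : K) `^ p)%:E.
apply: (@scalar_integrable_le _ _ _ _ _ _ g).
- exact: measurable_scalarM mw (Lp_fun_measurable F).
- apply/integrableP; split; first exact: Lp_measurable_comb.
  under eq_integral do rewrite gee0_abs ?lee_fin ?addr_ge0 ?mulr_ge0 ?powR_ge0//.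
  by rewrite -Lp_integral_comb// ltry.
- move=> t; rewrite lee_fin rnormM !mul1r mulrC.
  apply: le_trans (powR_mixed p1 (rnorm_ge0 _) (rnorm_ge0 _)).
  by rewrite ler_wpM2l ?rnorm_ge0.
Qed.

Definition Lp_pair w x : K := scalar_integral mu (fun t => w t * (repr x : Fun) t).

Lemma Lp_pair_class w F : dual_weight w ->
  Lp_pair w (cls F) = scalar_integral mu (fun t => w t * F t).
Proof.
move=> [mw _]; apply: scalar_integral_ae.
- exact: measurable_scalarM mw (Lp_fun_measurable _).
- exact: measurable_scalarM mw (Lp_fun_measurable _).
- have /Lp_classP := Lp_class_repr (cls F : X).
  by apply: filterS => t ->.
Qed.

Lemma Lp_pairP w a x y : dual_weight w ->
  Lp_pair w (a *: x + y) = a * Lp_pair w x + Lp_pair w y.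
Proof.
move=> aw; rewrite -[x]Lp_class_repr -[y]Lp_class_repr Lp_classZ -Lp_classD.
move: (repr x) (repr y) => F G; rewrite !Lp_pair_class//.
rewrite -scalar_integralZ; last exact: dual_weight_integrable.
rewrite -scalar_integralD; first last.
- exact: dual_weight_integrable.
- rewrite (_ : (fun t => _) = fun t => w t * (a *: F) t); first exact: dual_weight_integrable.
  by apply/funext => t; rewrite mulrCA.
by congr scalar_integral; apply/funext => t; rewrite mulrCA -mulrDr.
Qed.

Lemma Lp_pair0 w : dual_weight w -> Lp_pair w 0 = 0.
Proof.
by move=> aw; have := Lp_pairP 0 0 0 aw; rewrite scale0r addr0 mul0r add0r => /eqP;
  rewrite -subr_eq0 => _; have := Lp_pairP (-1) 0 0 aw; rewrite scaler0 addr0 mulN1r addNr.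
Qed.

Lemma Lp_pairZ w a x : dual_weight w -> Lp_pair w (a *: x) = a * Lp_pair w x.
Proof. by move=> aw; rewrite -[a *: x]addr0 Lp_pairP// Lp_pair0// addr0. Qed.

Lemma Lp_pair_weightD w v x : dual_weight w -> dual_weight v ->
  Lp_pair (fun t => w t + v t) x = Lp_pair w x + Lp_pair v x.
Proof.
move=> aw av; rewrite -[x]Lp_class_repr /Lp_pair.
set F := repr _.
rewrite -scalar_integralD; [|exact: dual_weight_integrable..].
by congr scalar_integral; apply/funext => t; rewrite mulrDl.
Qed.

Lemma Lp_pair_weightZ a w x : dual_weight w -> Lp_pair (fun t => a * w t) x = a * Lp_pair w x.
Proof.
move=> aw; rewrite -[x]Lp_class_repr /Lp_pair; set F := repr _.
rewrite -scalar_integralZ; last exact: dual_weight_integrable.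
by congr scalar_integral; apply/funext => t; rewrite mulrA.
Qed.

Lemma dual_weight_dualf F : dual_weight (fun t => dualf p (F t : K)).
Proof.
split; first exact: measurable_dualf (Lp_fun_measurable F).
by exists F => t; rewrite rnorm_dualf.
Qed.

Lemma Lp_pair_dualf_le F x : rnorm (cls F : X) = 1 ->
  rnorm (Lp_pair (fun t => dualf p (F t : K)) x) <= rnorm x.
Proof.
move=> F1; have aF := dual_weight_dualf F.
have [f hf] := @exists_linear R k X K^o (Lp_pair (fun t => dualf p (F t : K)))
  (fun a x y => Lp_pairP a x y aF).
rewrite -hf -[rnorm x]mul1r; apply: rnorm_linear_le => {}x x1; rewrite hf.
rewrite -lee_fin; apply: le_trans (rnorm_scalar_integral _ _) _.
- exact: measurable_scalarM aF.1 (Lp_fun_measurable _).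
- exact: dual_weight_integrable.
have := @Lp_integral_comb _ _ _ _ mu _ p1 F (repr x) ((p - 1) / p) p^-1.
rewrite F1 Lp_class_repr x1 powR1 !mulr1.
have -> : (p - 1) / p + p^-1 = 1 by field; rewrite gt_eqF.
move=> ->; last 2 first.
- by rewrite divr_ge0 ?subr_ge0 ?ltW.
- by rewrite invr_ge0 ltW.
apply: ge0_le_integral => //.
- by move=> t _; rewrite lee_fin rnorm_ge0.
- apply/measurable_EFinP; apply: measurable_rnorm.
  exact: measurable_scalarM aF.1 (Lp_fun_measurable _).
- exact: Lp_measurable_comb.
- by move=> t _; rewrite lee_fin rnormM rnorm_dualf// powR_young ?rnorm_ge0.
Qed.

Lemma Lp_pair_dualfK F : Lp_pair (fun t => dualf p (F t : K)) (cls F) =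
  ofR (rnorm (cls F : X) `^ p).
Proof.
rewrite Lp_pair_class; last exact: dual_weight_dualf.
apply: scalar_eq; rewrite ?re_ofR ?im_ofR.
  rewrite re_scalar_integral; apply: EFin_inj; rewrite Lp_normE.
  under eq_Rintegral do rewrite dualfK// re_ofR.
  rewrite /Rintegral fineK// ge0_fin_numE; first by rewrite -Lp_normE ltry.
  by apply: integral_ge0 => t _; rewrite lee_fin powR_ge0.
rewrite im_of_reim; under eq_Rintegral do rewrite dualfK// im_ofR.
by rewrite /Rintegral integral0 /=; case: k.
Qed.

Lemma Lp_dual_pair F : rnorm (cls F : X) = 1 -> exists2 f : {linear X -> K^o},
  dual_pair (cls F) f & forall x, f x = Lp_pair (fun t => dualf p (F t : K)) x.
Proof.
move=> F1; have aF := dual_weight_dualf F.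
have [f hf] := @exists_linear R k X K^o (Lp_pair (fun t => dualf p (F t : K)))
  (fun a x y => Lp_pairP a x y aF).
exists f => //; apply: dual_pairI => //.
  by move=> x; rewrite hf; exact: Lp_pair_dualf_le.
by rewrite hf Lp_pair_dualfK F1 powR1 ofR1.
Qed.

(** Both sides are homogeneous of degree [p] in [F], so test functions can be used without
    normalization. *)
Lemma Lp_numerical_bound (A : {linear X -> X}) (N : R) F : numerical_bound A N ->
  rnorm (Lp_pair (fun t => dualf p (F t : K)) (A (cls F))) <= N * rnorm (cls F : X) `^ p.
Proof.
move=> AN; have aF := dual_weight_dualf F.
have [F0|F0] := eqVneq (cls F : X) 0.
  by rewrite F0 linear0 Lp_pair0// rnorm0 nrm0 powR0 ?gt_eqF// mulr0.
have rF : 0 < rnorm (cls F : X) by exact: nrm_gt0.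
pose c : K := ofR (rnorm (cls F : X))^-1.
have c1 : rnorm (cls (c *: F) : X) = 1 by rewrite -Lp_classZ; exact: nrm_unit.
have [f pf hf] := Lp_dual_pair c1.
have := AN _ _ pf; rewrite hf -Lp_classZ (linearZ_LR A).
rewrite Lp_pairZ; last exact: dual_weight_dualf.
have -> : (fun t => dualf p ((c *: F) t : K)) = fun t => dualf p c * dualf p (F t : K).
  by apply/funext => t; rewrite -dualfM.
rewrite Lp_pair_weightZ//.
rewrite mulrA [c * _]mulrC dualfK// rnormM rnorm_ofR ger0_norm ?powR_ge0//.
rewrite /c rnorm_ofR ger0_norm ?invr_ge0 ?nrm_ge0// => h.
have rp : (rnorm (cls F : X))^-1 `^ p * rnorm (cls F : X) `^ p = 1.
  by rewrite -powRM ?invr_ge0 ?nrm_ge0// mulVf ?gt_eqF// powR1.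
by have := ler_wpM2r (powR_ge0 (rnorm (cls F : X)) p) h; rewrite mulrAC rp mul1r.
Qed.

End Lp_duality.

(** * The numerical index of Lp *)

Section dualf_independence.
Context {d : measure_display} {T : measurableType d} {R : realType} {k : scalar_kind}.
Context {mu : {measure set T -> \bar R}} {p : R} {p1 : 1 < p}.
Local Notation K := (scalars R k).
Local Notation X := (@Lp d T R k mu p p1).
Local Notation Fun := (@Lp_fun d T R k mu p p1).
Local Notation cls := (@Lp_class d T R k mu p p1).
Implicit Types (F G H : Fun) (w v : T -> K) (x y : X).

Let p0 : 0 < p. Proof. exact: lt_trans ltr01 p1. Qed.

(* What distinguishes [L_p] from a real Hilbert space: [s] and its dual are not
   proportional along the unit disc. *)
Definition dualf_independent (c : R) := forall (a b : K) (Q : R),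
  (forall s : K, rnorm s <= 1 -> rnorm (s * a + dualf p s * b) <= Q) -> rnorm a <= c * Q.

Lemma dualf_ofR (x : R) : 0 <= x -> dualf p (ofR x : K) = ofR (x `^ (p - 1)).
Proof.
rewrite le_eqVlt => /predU1P[<-|x0].
  by rewrite powR0 ?subr_eq0 ?gt_eqF// !ofR0 dualf0.
have xn : (ofR x : K) != 0 by rewrite -ofR0 (inj_eq (@ofR_inj R k)) gt_eqF.
apply: (mulIf xn); rewrite dualfK// rnorm_ofR gtr0_norm// -ofRM mulrC mulr_powRB1// ltW//.
Qed.

(** The tests [s = 1] and [s = 1/2] give two combinations of [a] and [b]; eliminating [b] leaves
    [h - q] as the coefficient of [a], which vanishes only for [p = 2]. *)
Lemma dualf_independent_neq2 : p != 2 -> exists2 c : R, 0 <= c & dualf_independent c.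
Proof.
move=> p2; pose h : R := 2^-1; pose q := h `^ (p - 1).
have h0 : 0 < h by rewrite /h invr_gt0.
have q0 : 0 <= q by exact: powR_ge0.
have hq : h - q != 0.
  rewrite subr_eq0; apply/eqP => /(congr1 (@ln R)); rewrite ln_powR => E.
  have l0 : ln h != 0 by rewrite ln_eq0// lt_eqF// invf_lt1// ltr1n.
  have : p - 1 = 1 by apply: (mulIf l0); rewrite mul1r -E.
  by move=> E'; move: p2; have -> : p = 2; [lra|rewrite eqxx].
have nhq : 0 < `|h - q| by rewrite normr_gt0.
exists ((1 + q) / `|h - q|) => [|a b Q H]; first by rewrite divr_ge0 ?addr_ge0.
have H1 := H 1; rewrite rnorm1 mul1r in H1.
have H2 := H (ofR h); rewrite rnorm_ofR gtr0_norm// dualf_ofR ?(ltW h0)// -/q in H2.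
have {}H1 : rnorm (a + b) <= Q.
  move: H1; rewrite -[in dualf p 1](@ofR1 R k) dualf_ofR// powR1 ofR1 mul1r; exact.
have {}H2 : rnorm (ofR h * a + ofR q * b) <= Q.
  by apply: H2; rewrite invf_le1// ler1n.
have E : ofR (h - q) * a = (ofR h * a + ofR q * b) - ofR q * (a + b).
  by rewrite ofRD ofRN; ring.
rewrite mulrAC ler_pdivlMr// mulrC -(@rnorm_ofR R k (h - q)) -rnormM E.
apply: le_trans (rnormD _ _) _; rewrite rnormN rnormM rnorm_ofR (ger0_norm q0) mulrDl mul1r.
by rewrite lerD// ler_wpM2l.
Qed.

End dualf_independence.

(** The tests [s = 1] and [s = i] bound [a + b] and [a - b], since [dualf p i = - i]. *)
Lemma dualf_independent_complex (R : realType) (p : R) : 1 < p ->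
  @dualf_independent R complex_scalars p 1.
Proof.
move=> p1 a b Q H; pose i : scalars R complex_scalars := Complex 0 1.
have i1 : rnorm i = 1 by rewrite rnormE /= expr0n expr1n add0r sqrtr1.
have ii : dualf p i = - i.
  rewrite /dualf i1 powR1 ofR1; apply/eqP; rewrite -subr_eq0 opprK; apply/eqP.
  have i0 : i != 0 by exact: rnorm1_neq0.
  apply: (mulIf i0); rewrite mul0r mulrDl mulfVK//.
  by apply: scalar_eq; rewrite /= ?mulr0 ?mul0r ?mulr1 ?addr0 ?sub0r ?add0r ?subrr.
have j1 : dualf p (1 : scalars R complex_scalars) = 1.
  by rewrite /dualf rnorm1 powR1 ofR1 divr1.
have H1 : rnorm (a + b) <= Q by have := H 1; rewrite j1 !mul1r rnorm1; exact.
have H2 : rnorm (a - b) <= Q.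
  by have := H i; rewrite ii mulNr -mulrBr rnormM i1 mul1r; exact.
have : rnorm (ofR 2 * a) <= 2 * Q.
  have -> : ofR 2 * a = (a + b) + (a - b).
    by rewrite (ofRD 1 1) ofR1; ring.
  by apply: le_trans (rnormD _ _) _; lra.
by rewrite rnormM rnorm_ofR ger0_norm// mul1r ler_pM2l.
Qed.

(** * From numerical values to the operator norm *)

Section Lp_norm_bound.
Context {d : measure_display} {T : measurableType d} {R : realType} {k : scalar_kind}.
Context {mu : {measure set T -> \bar R}} {p : R} {p1 : 1 < p}.
Local Notation K := (scalars R k).
Local Notation X := (@Lp d T R k mu p p1).
Local Notation Fun := (@Lp_fun d T R k mu p p1).
Local Notation cls := (@Lp_class d T R k mu p p1).
Local Notation dweight := (@dual_weight d T R k mu p p1).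
Implicit Types (F G H : Fun) (w v : T -> K) (x y : X).

Let p0 : 0 < p. Proof. exact: lt_trans ltr01 p1. Qed.

Definition cut (A : set T) w : T -> K := fun t => ofR (\1_A t) * w t.

Lemma rnorm_cut (A : set T) w t : rnorm (cut A w t) <= rnorm (w t).
Proof.
rewrite /cut rnormM rnorm_ofR indicE; case: (t \in A); first by rewrite normr1 mul1r.
by rewrite normr0 mul0r rnorm_ge0.
Qed.

Lemma measurable_cut (A : set T) w : measurable A -> measurable_scalar (w : T -> K^o) ->
  measurable_scalar (cut A w : T -> K^o).
Proof.
by move=> mA mw; apply: measurable_scalarM => //; apply: measurable_scalar_ofR;
  exact: measurable_indic.
Qed.

Lemma dual_weight_cut (A : set T) w : measurable A -> dweight w ->
  dweight (cut A w).
Proof.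
move=> mA [mw [G wG]]; split; first exact: measurable_cut.
by exists G => t; apply: le_trans (rnorm_cut A w t) (wG t).
Qed.

Lemma cutC (A : set T) w t : cut A w t + cut (~` A) w t = w t.
Proof.
rewrite /cut -mulrDl -ofRD !indicE in_setC; case: (t \in A) => /=.
  by rewrite addr0 ofR1 mul1r.
by rewrite add0r ofR1 mul1r.
Qed.

Lemma Lp_restrict (A : set T) F : measurable A -> exists F' : Fun, forall t, F' t = cut A F t.
Proof.
move=> mA; apply: (exists_Lp_fun_le (G := F)) => [|t]; last exact: rnorm_cut.
exact: measurable_cut (Lp_fun_measurable F).
Qed.

Lemma dualf_cut (A : set T) w t : dualf p (cut A w t) = cut A (fun t => dualf p (w t)) t.
Proof.
rewrite /cut dualfM indicE; congr (_ * _); case: (t \in A).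
  by rewrite ofR1 /dualf rnorm1 powR1 ofR1 divr1.
by rewrite ofR0 dualf0.
Qed.

(** Split [F] into [Y] on [A] and [Z] off [A]. By disjointness the duality map of [Y + s Z] is
    [wY + dualf s wZ], and for [|s| <= 1] the norm of [Y + s Z] is at most that of [F]. So the
    numerical bound controls an expression in [s] whose coefficients are the four pairings [a], [b],
    [e], [g]; the claim concerns [a + b]. *)
Lemma Lp_pair_cut_le (L : {linear X -> X}) (N c : R) F (A : set T) : measurable A ->
  numerical_bound L N -> 0 <= N -> @dualf_independent R k p c ->
  rnorm (Lp_pair (cut A (fun t => dualf p (F t : K))) (L (cls F))) <=
  (1 + c) * (N * rnorm (cls F : X) `^ p).
Proof.
move=> mA LN N0 hc; set Q := N * _.
have [Y hY] := Lp_restrict F mA; have [Z hZ] := Lp_restrict F (measurableC mA).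
pose wY t : K := dualf p (Y t : K); pose wZ t : K := dualf p (Z t : K).
have aY : dweight wY := dual_weight_dualf Y.
have aZ : dweight wZ := dual_weight_dualf Z.
pose b := Lp_pair wY (L (cls Z)); pose e := Lp_pair wZ (L (cls Y)).
pose a := Lp_pair wY (L (cls Y)); pose g := Lp_pair wZ (L (cls Z)).
have val (s : K) : rnorm s <= 1 ->
    rnorm (a + (s * b + dualf p s * e) + dualf p s * s * g) <= Q.
  move=> s1; have := Lp_numerical_bound (Y + s *: Z) LN.
  have -> : (fun t => dualf p ((Y + s *: Z) t : K)) = fun t => wY t + dualf p s * wZ t.
    apply/funext => t; rewrite -[(Y + s *: Z) t]/(Y t + s * Z t) /wY /wZ hY hZ /cut !indicE in_setC.
    case: (t \in A); rewrite /= ofR0 ofR1 !(mul1r, mul0r, mulr0, dualf0, addr0, add0r)//.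
    by rewrite dualfM.
  have az : dweight (fun t => dualf p s * wZ t).
    have := dual_weight_dualf (s *: Z).
    rewrite (_ : (fun t => dualf p ((s *: Z) t)) = fun t => dualf p s * wZ t)//.
    by apply/funext => t; rewrite -dualfM.
  rewrite Lp_pair_weightD// Lp_pair_weightZ// addrC.
  rewrite [cls (Y + _)](_ : _ = s *: cls Z + cls Y); last first.
    by rewrite Lp_classZ -Lp_classD addrC.
  rewrite (linearP L) !Lp_pairP// -/a -/b -/e -/g => h.
  have -> : a + (s * b + dualf p s * e) + dualf p s * s * g =
    dualf p s * (s * g + e) + (s * b + a) by ring.
  apply: le_trans h _; rewrite ler_wpM2l//.
  apply: ge0_ler_powR; rewrite ?nnegrE ?nrm_ge0 ?(ltW p0)//.
  rewrite Lp_classZ -Lp_classD; apply: Lp_norm_le => t.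
  rewrite -[(s *: Z + Y) t]/(s * Z t + Y t) hY hZ /cut !indicE in_setC.
  case: (t \in A); rewrite /= ofR0 ofR1 !(mul1r, mul0r, mulr0, addr0, add0r)//.
  by rewrite rnormM ler_piMl ?rnorm_ge0.
have ha : rnorm a <= Q.
  by have := val 0; rewrite rnorm0 !(mul0r, mulr0) dualf0 !(mul0r, mulr0) !addr0 ler01; exact.
have hb : rnorm b <= c * Q.
  (* Passing from [s] to [- s] changes the sign of the mixed term [m] only, so half the difference
     isolates it. *)
  apply: (hc b e) => s s1; have := val s s1; have := val (- s).
  rewrite rnormN dualfN mulrNN !mulNr -opprD => /(_ s1).
  set m := s * b + _; set n := _ * s * g => v1 v2.
  have : rnorm (ofR 2 * m) <= 2 * Q.
    have -> : ofR 2 * m = (a + m + n) - (a - m + n) by rewrite (ofRD 1 1) ofR1; ring.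
    by apply: le_trans (rnormD _ _) _; rewrite rnormN; lra.
  by rewrite rnormM rnorm_ofR ger0_norm// ler_pM2l.
have -> : Lp_pair (cut A (fun t => dualf p (F t : K))) (L (cls F)) = a + b.
  have -> : cut A (fun t => dualf p (F t : K)) = wY.
    by apply/funext => t; rewrite -dualf_cut /wY hY.
  have -> : cls F = (1 : K) *: cls Z + cls Y.
    rewrite Lp_classZ -Lp_classD; congr cls; apply/val_inj/funext => t /=.
    by rewrite -[RHS]/(1 * Z t + Y t) mul1r hZ hY addrC (cutC A F).
  by rewrite (linearP L) Lp_pairP// mul1r addrC.
by apply: le_trans (rnormD _ _) _; rewrite mulrDl mul1r lerD.
Qed.

Lemma im_scalar_integral (h : T -> K) : im (scalar_integral mu h) = \int[mu]_t im (h t).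
Proof.
rewrite im_of_reim; have [h0|->//] := @im_trivial R k.
under [RHS]eq_Rintegral do rewrite h0.
by rewrite /Rintegral integral0 /= -(im_of_reim 0 (\int[mu]_t im (h t))) h0.
Qed.

(** Applied to [q = re] and [q = im]. Cutting along the set where the integrand is nonnegative and
    along its complement writes the integral of its absolute value as a difference of two integrals
    bounded by [B]. *)
Let part_bound (q : K -> R) w x (B : R) :
  (forall r a, q (ofR r * a) = r * q a) ->
  (forall g, q (scalar_integral mu g) = \int[mu]_t q (g t)) ->
  (forall a, `|q a| <= rnorm a) ->
  (forall g, scalar_integrable mu g -> mu.-integrable setT (EFin \o (fun t => q (g t)))) ->
  dweight w -> (forall A, measurable A -> rnorm (Lp_pair (cut A w) x) <= B) ->
  (\int[mu]_t (`|q (w t * (repr x : Fun) t)|)%:E <= (2 * B)%:E)%E.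
Proof.
move=> qZ qint qle qi aw hB; set F : Fun := repr x.
pose h t := q (w t * F t).
have ih A : measurable A -> mu.-integrable setT (EFin \o (fun t => \1_A t * h t)).
  move=> mA; have := qi _ (dual_weight_integrable F (dual_weight_cut mA aw)).
  rewrite (_ : _ \o _ = EFin \o (fun t => \1_A t * h t))//.
  by apply/funext => t /=; rewrite /cut -mulrA qZ.
have mh : measurable_fun setT h.
  by apply/measurable_EFinP; apply: measurable_int (qi _ (dual_weight_integrable F aw)).
pose A := [set t | 0 <= h t].
have mA : measurable A.
  rewrite (_ : A = setT `&` h @^-1` `[0, +oo[); first exact: mh.
  by apply/seteqP; split => t /=; rewrite in_itv /= andbT; [split|case].
have val (C : set T) : measurable C -> `|\int[mu]_t (\1_C t * h t)| <= B.
  move=> mC; apply: le_trans (hB C mC).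
  have -> : \int[mu]_t (\1_C t * h t) = q (Lp_pair (cut C w) x).
    by rewrite qint; apply: eq_Rintegral => t _; rewrite /cut -mulrA qZ.
  exact: qle.
have -> : (\int[mu]_t (`|h t|)%:E)%E =
    ((\int[mu]_t (\1_A t * h t)) - (\int[mu]_t (\1_(~` A) t * h t)))%:E.
  rewrite -RintegralB//; [|exact: ih|exact/ih/measurableC].
  rewrite /Rintegral fineK; last first.
    apply: integrable_fin_num => //.
    rewrite (_ : (fun t => _) = (fun t => (\1_A t * h t)%:E - (\1_(~` A) t * h t)%:E)%E)//.
    by apply: integrableB => //; [exact: ih|exact/ih/measurableC].
  apply: eq_integral => t _; congr EFin; rewrite !indicE in_setC.
  have [h0|h0] := leP 0 (h t).
    by rewrite ger0_norm// mem_set//= mul1r mul0r subr0.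
  rewrite ltr0_norm// memNset/=; first by rewrite mul1r mul0r sub0r.
  by apply/negP; rewrite -ltNge.
rewrite lee_fin; have := val A mA; have := val _ (measurableC mA).
rewrite !ler_norml => /andP[? ?] /andP[? ?]; lra.
Qed.

(** The 4 counts real and imaginary part, each split by sign. *)
Lemma Lp_pair_abs w x (B : R) : dweight w ->
  (forall A, measurable A -> rnorm (Lp_pair (cut A w) x) <= B) ->
  (\int[mu]_t (rnorm (w t * (repr x : Fun) t))%:E <= (4 * B)%:E)%E.
Proof.
move=> aw hB; set F : Fun := repr x.
have mh : measurable_scalar (fun t => w t * F t : K^o).
  exact: measurable_scalarM aw.1 (Lp_fun_measurable F).
have [mr mi] := mh.
have := @part_bound re w x B; have := @part_bound im w x B; rewrite -/F => hi hr.
apply: (@le_trans _ _ (\int[mu]_t ((`|re (w t * F t)|)%:E + (`|im (w t * F t)|)%:E))%E).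
  apply: ge0_le_integral => //.
  - by move=> t _; rewrite lee_fin rnorm_ge0.
  - by apply/measurable_EFinP; exact: measurable_rnorm.
  - by apply: emeasurable_funD; apply/measurable_EFinP; apply: measurableT_comp.
  - by move=> t _; rewrite -EFinD lee_fin rnorm_le_reim.
rewrite ge0_integralD//; do ?[by apply/measurable_EFinP; apply: measurableT_comp].
rewrite (_ : 4 * B = 2 * B + 2 * B) ?EFinD; last by ring.
apply: leeD.
  apply: hr => // [r a|g|a|g [] //]; [|exact: re_scalar_integral|exact: normr_re_le].
  by rewrite reM re_ofR im_ofR mul0r subr0.
apply: hi => // [r a|g|a|g [] //]; [|exact: im_scalar_integral|exact: normr_im_le].
by rewrite imM re_ofR im_ofR mul0r addr0.
Qed.

(* Bounding [|g|^(p-1) |L x|] for unit [g] and [x]: write [x = (x + m) - m] with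
   [m = |g| + |x|], so that both [|x + m|] and [|m|] dominate [|g|]. *)
Lemma operator_norm_le_numerical_bound (L : {linear X -> X}) (N c : R) :
  numerical_bound L N -> 0 <= N -> 0 <= c -> @dualf_independent R k p c ->
  forall x, rnorm (L x) <= 4 * (1 + c) * (3 `^ p + 2 `^ p) * N * rnorm x.
Proof.
move=> LN N0 c0 hc; apply: rnorm_linear_le => x x1.
have C0 : 0 <= 4 * (1 + c) * (3 `^ p + 2 `^ p) * N.
  by rewrite !mulr_ge0 ?addr_ge0 ?powR_ge0.
have [->|Lx0] := eqVneq (L x) 0; first by rewrite nrm0.
pose r := rnorm (L x); have r0 : 0 < r by exact: nrm_gt0.
pose U : Fun := repr (L x); pose H : Fun := repr x.
pose g : Fun := (ofR r^-1 : K) *: U.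
have xH : x = cls H by rewrite /H Lp_class_repr.
have g1 : rnorm (cls g : X) = 1.
  by rewrite -Lp_classZ [cls U]Lp_class_repr; exact: nrm_unit.
have [ga hga nga] := exists_Lp_abs g; have [Ha hHa nHa] := exists_Lp_abs H.
pose M : Fun := ga + Ha; pose E : Fun := H + M.
have nH : rnorm (cls H : X) = 1 by rewrite -xH.
have {}nga : rnorm (cls ga : X) = 1 := etrans nga g1.
have {}nHa : rnorm (cls Ha : X) = 1 := etrans nHa nH.
have nM : rnorm (cls M : X) <= 2.
  have := nrmD (cls ga : X) (cls Ha); rewrite nga nHa -(Lp_classD ga Ha).
  exact.
have nE : rnorm (cls E : X) <= 3.
  have := nrmD (cls H : X) (cls M); rewrite nH -(Lp_classD H M).
  by move=> /le_trans; apply; rewrite (_ : 3 = 1 + 2) ?lerD2l// -(natrD _ 1 2).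
have Mt t : rnorm (M t : K) = rnorm (g t : K) + rnorm (H t : K).
  by rewrite -[M t]/(ga t + Ha t) hga hHa -ofRD rnorm_ofR ger0_norm ?addr_ge0 ?rnorm_ge0.
have gM t : rnorm (g t : K) <= rnorm (M t : K) by rewrite Mt lerDl rnorm_ge0.
have gE t : rnorm (g t : K) <= rnorm (E t : K).
  rewrite -[E t]/(H t + M t) -[H t]opprK addrC; apply: le_trans (nrm_leB (V := K^o) (M t) (- H t)).
  by rewrite rnormN Mt addrK.
pose UE : Fun := repr (L (cls E)); pose UM : Fun := repr (L (cls M)).
have /Lp_classP Uae : cls U = cls (UE - UM).
  have uU : cls U = L x := Lp_class_repr _.
  have uE : cls UE = L (cls E) := Lp_class_repr _.
  have uM : cls UM = L (cls M) := Lp_class_repr _.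
  rewrite uU -Lp_classB uE uM -(linearB L); congr (L _).
  by rewrite Lp_classD -xH addrK.
pose wE t : K := dualf p (E t : K); pose wM t : K := dualf p (M t : K).
have IE : (\int[mu]_t (rnorm (wE t * UE t))%:E <= (4 * ((1 + c) * (N * 3 `^ p)))%:E)%E.
  apply: Lp_pair_abs; first exact: dual_weight_dualf.
  move=> A mA; apply: le_trans (Lp_pair_cut_le E mA LN N0 hc) _.
  rewrite ler_wpM2l ?addr_ge0// ler_wpM2l//.
  by apply: ge0_ler_powR; rewrite ?nnegrE ?nrm_ge0 ?(ltW p0).
have IM : (\int[mu]_t (rnorm (wM t * UM t))%:E <= (4 * ((1 + c) * (N * 2 `^ p)))%:E)%E.
  apply: Lp_pair_abs; first exact: dual_weight_dualf.
  move=> A mA; apply: le_trans (Lp_pair_cut_le M mA LN N0 hc) _.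
  rewrite ler_wpM2l ?addr_ge0// ler_wpM2l//.
  by apply: ge0_ler_powR; rewrite ?nnegrE ?nrm_ge0 ?(ltW p0).
have mE : measurable_fun setT (fun t => (rnorm (wE t * UE t))%:E).
  apply/measurable_EFinP; apply: measurable_rnorm.
  exact: measurable_scalarM (dual_weight_dualf E).1 (Lp_fun_measurable UE).
have mM : measurable_fun setT (fun t => (rnorm (wM t * UM t))%:E).
  apply/measurable_EFinP; apply: measurable_rnorm.
  exact: measurable_scalarM (dual_weight_dualf M).1 (Lp_fun_measurable UM).
(* As [|U| = r |g|] and [g] has norm 1, [r] is the integral of [|g|^(p-1) |U|]. The coefficient 0
   pads the formula for two functions. *)
have := @Lp_integral_comb _ _ _ _ mu _ p1 g g r 0 (ltW r0) (lexx 0).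
rewrite g1 powR1 mulr1 mul0r addr0 => Ir; rewrite -lee_fin Ir.
apply: (@le_trans _ _ (\int[mu]_t ((rnorm (wE t * UE t))%:E + (rnorm (wM t * UM t))%:E))%E).
  apply: ae_ge0_le_integral => //.
  - by move=> t _; rewrite lee_fin mul0r addr0 mulr_ge0 ?powR_ge0 ?ltW.
  - exact: Lp_measurable_comb.
  - by move=> t _; rewrite -EFinD lee_fin addr_ge0 ?rnorm_ge0.
  - exact: emeasurable_funD.
  apply: filterS Uae => t Ut _; rewrite -EFinD lee_fin mul0r addr0.
  have rU : rnorm (U t : K) = r * rnorm (g t : K).
    rewrite -[g t]/(ofR r^-1 * U t) rnormM rnorm_ofR gtr0_norm ?invr_gt0//.
    by rewrite mulrA mulfV ?gt_eqF// mul1r.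
  rewrite -(mulr_powRB1 (rnorm_ge0 (g t : K)) p0) mulrA -rU Ut.
  have nwE : rnorm (wE t) = rnorm (E t : K) `^ (p - 1) := rnorm_dualf p1 _.
  have nwM : rnorm (wM t) = rnorm (M t : K) `^ (p - 1) := rnorm_dualf p1 _.
  rewrite -[(UE - UM) t]/(UE t - UM t) (rnormM (wE t)) (rnormM (wM t)) nwE nwM.
  have q0 : 0 <= p - 1 by rewrite subr_ge0 ltW.
  have B1 : rnorm (g t : K) `^ (p - 1) <= rnorm (E t : K) `^ (p - 1).
    by apply: ge0_ler_powR; rewrite ?nnegrE ?rnorm_ge0.
  have B2 : rnorm (g t : K) `^ (p - 1) <= rnorm (M t : K) `^ (p - 1).
    by apply: ge0_ler_powR; rewrite ?nnegrE ?rnorm_ge0.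
  apply: le_trans (ler_wpM2r (powR_ge0 _ _) (rnormD _ _)) _; rewrite rnormN mulrDl.
  by apply: lerD; rewrite mulrC ler_wpM2r ?rnorm_ge0.
rewrite ge0_integralD//; [|by move=> t _; rewrite lee_fin rnorm_ge0..].
apply: le_trans (leeD IE IM) _; rewrite -EFinD lee_fin le_eqVlt; apply/orP; left.
by apply/eqP; ring.
Qed.

Lemma Lp_compactly_reducible (c : R) : 0 <= c -> @dualf_independent R k p c ->
  compactly_reducible (X := X).
Proof.
move=> c0 hc; exists (4 * (1 + c) * (3 `^ p + 2 `^ p)).
  by rewrite !mulr_ge0 ?addr_ge0 ?powR_ge0.
move=> L cL LN; exists L; split => // h.
by have := operator_norm_le_numerical_bound LN ler01 c0 hc h; rewrite mulr1.
Qed.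

End Lp_norm_bound.

(** * Real Hilbert spaces *)

(** Smulian's estimate with both points equal to [x]. *)
Lemma dual_pair_unique (R : realType) (k : scalar_kind) (X : normedModType (scalars R k))
    (x : X) (f g : {linear X -> (scalars R k)^o}) : uniformly_smooth X ->
  dual_pair x f -> dual_pair x g -> forall h, f h = g h.
Proof.
move=> us pf pg h; apply: eq_of_rnorm => e e0.
have h1 : 0 < rnorm h + 1 by rewrite ltr_wpDl// nrm_ge0.
have [s s0 hs] := uniformly_smooth_dual us (divr_gt0 e0 h1).
apply: le_trans (hs x f x g pf pg _ h) _; first by rewrite subrr nrm0.
by rewrite mulrAC ler_pdivrMr// ler_wpM2l ?(ltW e0)// lerDl.
Qed.

(** Unit vectors at which [f] nearly reaches its norm [s], rotated so that its values there are
    real, have sums of norm close to 2. Uniform convexity makes them rapidly Cauchy. *)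
Lemma exists_norming_limit (R : realType) (k : scalar_kind) (X : normedModType (scalars R k))
    (f : {linear X -> (scalars R k)^o}) (c : R) : rapidly_complete X -> uniformly_convex X ->
  (forall h, rnorm (f h) <= c * rnorm h) -> (exists h, f h != 0) ->
  exists (z : X) (s : R), [/\ 0 < s, rnorm z = 1, f z = ofR s :> scalars R k &
    forall h, rnorm (f h) <= s * rnorm h].
Proof.
move=> Xc uc fc [h0 fh0].
have h00 : h0 != 0 by apply: contra_neq fh0 => ->; rewrite linear0.
pose E := [set rnorm (f x) | x in [set x : X | rnorm x = 1]].
have supE : has_sup E.
  pose u := ofR (rnorm h0)^-1 *: h0.
  split; first by exists (rnorm (f u)), u => //=; exact: nrm_unit.
  by exists c => _ [x /= x1 <-]; have := fc x; rewrite x1 mulr1.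
pose s := sup E.
have fs h : rnorm (f h) <= s * rnorm h.
  by apply: rnorm_linear_le => x x1; have /ubP := sup_upper_bound supE; apply; exists x.
have s0 : 0 < s.
  have h1 : 0 < rnorm (f h0) by exact: nrm_gt0.
  by rewrite -(pmulr_lgt0 _ (nrm_gt0 h00)); apply: lt_le_trans h1 _.
have /choice[d hd] : forall n, exists d : R, 0 < d /\
    forall x z : X, rnorm x = 1 -> rnorm z = 1 -> 2 - d < rnorm (x + z) -> rnorm (x - z) < pow2 n.
  by move=> n; have [d d0 hd] := uc _ (@pow2_gt0 R n); exists d.
(* The comparison of [z n] with [z n.+1] needs both defects below [d n], hence [d n.-1] in the
   minimum; [pow2 n] makes the values converge to [s]. *)
pose e n := Num.min (Num.min (d n) (d n.-1)) (pow2 n).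
have e0 n : 0 < e n by rewrite !lt_min (hd _).1 (hd _).1 pow2_gt0.
have /choice[z hz] : forall n, exists z : X, rnorm z = 1 /\
    exists2 r : R, f z = ofR r :> scalars R k & s * (1 - e n / 2) < r.
  move=> n; have [|_ [x /= x1 <-] hx] := @sup_adherent _ E (s * (e n / 2)) _ supE.
    by rewrite mulr_gt0// divr_gt0.
  have [u u1 hu] := phaseP (f x : scalars R k).
  exists (u *: x); split; first by rewrite nrmZ u1 x1 mulr1.
  exists (rnorm (f x)); first by rewrite linearZ_LR.
  by rewrite mulrBr mulr1.
have zz n : rnorm (z n.+1 - z n) <= 1 * pow2 n.
  have [z1 [r fr rn]] := hz n; have [z1' [r' fr' rn']] := hz n.+1.
  rewrite mul1r ltW//; apply: (hd n).2 => //.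
  rewrite -(ltr_pM2l s0); apply: lt_le_trans (fs _).
  apply: lt_le_trans (re_le_rnorm _); rewrite linearD reD fr fr' !re_ofR.
  have en : s * e n <= s * d n by rewrite ler_pM2l// /e ge_min ge_min lexx.
  have en' : s * e n.+1 <= s * d n by rewrite ler_pM2l// /e !ge_min /= lexx !orbT.
  by move: rn rn' en en'; lra.
have [l hl] := Xc z 1 zz.
exists l, s; split => //.
  apply/le_anti/andP; split; apply/ler_addgt0Pr => a a0; have [n hn] := @pow2_lt R 2 a a0.
    by have := nrm_leB l (z n); have := hl n; rewrite (hz n).1; lra.
  by have := nrm_leB (z n) l; rewrite nrm_distC; have := hl n; rewrite (hz n).1; lra.
apply: eq_of_rnorm => a a0; have [n hn] := @pow2_lt R (3 * s) a a0.
apply: ltW; apply: le_lt_trans hn.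
have [z1 [r fr rn]] := hz n.
apply: le_trans (nrm_distD (f (z n)) _ _) _; rewrite -linearB.
have A := le_trans (fs (l - z n)) (ler_wpM2l (ltW s0) (hl n)).
have rs : r <= s.
  by have := fs (z n); rewrite z1 mulr1 fr; apply: le_trans; rewrite rnorm_ofR ler_norm.
have B : rnorm (f (z n) - ofR s : scalars R k) = s - r.
  by rewrite fr -ofRN -ofRD rnorm_ofR distrC ger0_norm// subr_ge0.
have C : s * e n <= s * pow2 n by rewrite ler_pM2l// /e ge_min lexx orbT.
rewrite [X in _ + X <= _]B.
have := mulr_gt0 s0 (@pow2_gt0 R n); move: rn A C; lra.
Qed.

Section real_hilbert.
Context {R : realType} {X : normedModType (scalars R real_scalars)}.
Local Notation K := (scalars R real_scalars).
Variable ip : X -> X -> R.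
Hypothesis ipC : forall x y, ip x y = ip y x.
Hypothesis ipP : forall x a y z, ip x (ofR a *: y + z) = a * ip x y + ip x z.
Hypothesis ipE : forall x, ip x x = rnorm x ^+ 2.

Lemma real_scalarE (a : K) : a = ofR (re a).
Proof. by []. Qed.

Lemma ip0 x : ip x 0 = 0.
Proof.
have := ipP x (-1) 0 0; rewrite scaler0 addr0; lra.
Qed.

Lemma ipD x y z : ip x (y + z) = ip x y + ip x z.
Proof. by have := ipP x 1 y z; rewrite ofR1 scale1r mul1r. Qed.

Lemma ipZ x a y : ip x (ofR a *: y) = a * ip x y.
Proof. by rewrite -[ofR a *: y]addr0 ipP ip0 addr0. Qed.

Lemma ipN x y : ip x (- y) = - ip x y.
Proof. by rewrite -scaleN1r -(@ofR1 R real_scalars) -ofRN ipZ mulN1r. Qed.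

Lemma ip_nondeg x y : (forall h, ip x h = ip y h) -> x = y.
Proof.
move=> h; apply/eqP; rewrite -subr_eq0; apply/eqP/nrm0_eq0/eqP.
by rewrite -sqrf_eq0 -ipE ipD ipN ![ip (x - y) _]ipC !ipD !ipN (h x) (h y) subrr.
Qed.

Lemma ip_cauchy x y : `|ip x y| <= rnorm x * rnorm y.
Proof.
have le1 (u v : X) : rnorm u = 1 -> ip u v <= rnorm v.
  move=> u1; set a := ip u v.
  have := sqr_ge0 (rnorm (v - ofR a *: u)).
  rewrite -ipE ipD ipN ipZ ![ip (v - _) _]ipC !ipD !ipN !ipZ [ip v u]ipC -/a !ipE u1 expr1n => h.
  have {h} : a ^+ 2 <= rnorm v ^+ 2 by lra.
  move=> h; apply: le_trans (ler_norm a) _.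
  by rewrite -(ler_pXn2r (n := 2))// ?nnegrE ?nrm_ge0// real_normK ?num_real.
have [->|x0] := eqVneq x 0; first by rewrite ipC ip0 normr0 nrm0 mul0r.
have rx : 0 < rnorm x by exact: nrm_gt0.
have xE (v : X) : ip x v <= rnorm x * rnorm v.
  have := le1 _ v (nrm_unit x0); rewrite ipC ipZ ipC => h.
  by rewrite -ler_pdivrMl// mulrC mulrC.
by rewrite ler_norml xE andbT lerNl -ipN (le_trans (xE _))// nrmN.
Qed.

Lemma ip_dual_pair x : rnorm x = 1 -> exists2 f : {linear X -> K^o},
  dual_pair x f & forall h, f h = ofR (ip x h) :> K.
Proof.
move=> x1; have [|f hf] := @exists_linear R real_scalars X K^o (fun h => ofR (ip x h) : K).
  by move=> a u v; rewrite [a]real_scalarE ipP.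
exists f => //; apply: dual_pairI => //.
  by move=> h; rewrite hf [X in X <= _]rnorm_ofR; have := ip_cauchy x h; rewrite x1 mul1r.
by rewrite hf ipE x1 expr1n.
Qed.

Hypothesis Xc : rapidly_complete X.
Hypothesis uc : uniformly_convex X.
Hypothesis us : uniformly_smooth X.

(** At a norming point [z] of [f], both [f / s] and the inner product with [z] form dual pairs with
    [z], so smoothness identifies them. *)
Lemma ip_riesz (f : {linear X -> K^o}) (c : R) : (forall h, rnorm (f h) <= c * rnorm h) ->
  exists z, forall h, f h = ofR (ip z h) :> K.
Proof.
move=> fc; have [f0|/existsNP[h0 /eqP fh0]] := pselect (forall h, f h = 0).
  by exists 0 => h; rewrite f0 ipC ip0 ofR0.
have [z [s [s0 z1 fz fs]]] := exists_norming_limit Xc uc fc (ex_intro _ h0 fh0).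
have sn : (ofR s : K) != 0 by rewrite gt_eqF.
have [|g hg] := @exists_linear R real_scalars X K^o (fun h => (ofR s)^-1 *: f h).
  by move=> a u v; rewrite linearP scalerDr !scalerA mulrC.
have pg : dual_pair z g.
  apply: dual_pairI => // [h|]; rewrite hg.
    rewrite nrmZ rnormV rnorm_ofR gtr0_norm// mulrC ler_pdivrMr// mulrC; exact: fs.
  by rewrite fz /GRing.scale /= mulVf.
have [f' pf' hf'] := ip_dual_pair z1.
exists (ofR s *: z) => h; have := dual_pair_unique us pg pf' h; rewrite hg hf' => E.
by rewrite ipC ipZ [ip h z]ipC ofRM -E /GRing.scale /= mulrA mulfV ?mul1r.
Qed.

Lemma ip_adjoint (L : {linear X -> X}) (M : R) : (forall h, rnorm (L h) <= M * rnorm h) ->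
  exists L' : {linear X -> X}, forall x y, ip x (L y) = ip (L' x) y.
Proof.
move=> LM; have /choice[g hg] : forall x, exists z, forall y, ip x (L y) = ip z y.
  move=> x; have [|f hf] := @exists_linear R real_scalars X K^o (fun h => ofR (ip x (L h)) : K).
    by move=> a u v; rewrite linearP [a]real_scalarE ipP.
  have [|z hz] := @ip_riesz f (rnorm x * M).
    move=> h; rewrite hf [X in X <= _]rnorm_ofR; apply: le_trans (ip_cauchy _ _) _.
    by rewrite -mulrA ler_wpM2l ?nrm_ge0.
  by exists z => h; apply: (@ofR_inj R real_scalars); rewrite -hz -hf.
have [|L' hL'] := @exists_linear R real_scalars X X g.
  move=> a u v; apply: ip_nondeg => h; rewrite -hg [a]real_scalarE.
  by rewrite ![ip _ h]ipC [ip _ (L h)]ipC !ipP ![ip (L h) _]ipC ![ip h _]ipC !hg.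
by exists L' => x y; rewrite hL'.
Qed.

(* [|L' y|^2 = <y, L (L' y)>], so distances under [L'] are controlled by those under
   the totally bounded [L L']. *)
Lemma adjoint_compact (L L' : {linear X -> X}) : compact_op L ->
  (forall x y, ip x (L y) = ip (L' x) y) -> compact_op L'.
Proof.
move=> cL adj; have [M0 M00 LM0] := compact_op_bounded cL.
pose M := M0 + 1; have M1 : 0 < M by rewrite ltr_wpDl.
have LM h : rnorm (L h) <= M * rnorm h.
  by apply: le_trans (LM0 h) _; rewrite ler_wpM2r ?nrm_ge0// lerDl.
have sq y : rnorm (L' y) ^+ 2 <= rnorm y * rnorm (L (L' y)).
  by rewrite -ipE -adj; apply: le_trans (ler_norm _) (ip_cauchy _ _).
have L'M y : rnorm (L' y) <= M * rnorm y.
  have [z|z] := leP (rnorm (L' y)) 0; first by apply: le_trans z _; rewrite mulr_ge0 ?nrm_ge0 ?ltW.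
  rewrite -(ler_pM2l z) -expr2; apply: le_trans (sq y) _.
  rewrite (_ : rnorm (L' y) * (M * rnorm y) = rnorm y * (M * rnorm (L' y))); last by ring.
  by rewrite ler_wpM2l ?nrm_ge0.
(* Division by [M] puts [L' y] into the unit ball for [y] in the unit ball, so [g] takes its values
   in the totally bounded image under [L]. *)
pose g y := L (ofR M^-1 *: L' y).
apply: (totally_bounded_pullback (g := g)) => [e e0|].
  exists (e ^+ 2 / (2 * M)) => [|i j i1 j1 gij]; first by rewrite divr_gt0 ?exprn_gt0// mulr_gt0.
  rewrite -linearB -(ltr_pXn2r (n := 2)) ?nnegrE ?nrm_ge0 ?(ltW e0)//.
  apply: le_lt_trans (sq _) _.
  have ij : rnorm (i - j) <= 2.
    by apply: le_trans (nrmB _ _) _; move: i1 j1; rewrite /unit_ball /=; lra.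
  have gE : rnorm (g i - g j) = M^-1 * rnorm (L (L' (i - j))).
    rewrite /g -linearB -scalerBr -linearB (linearZ_LR L) nrmZR gtr0_norm ?invr_gt0//.
  move: gij; rewrite gE (_ : e ^+ 2 / (2 * M) = M^-1 * (e ^+ 2 / 2)); last first.
    by field; rewrite gt_eqF.
  rewrite ltr_pM2l ?invr_gt0// => LL.
  apply: (@le_lt_trans _ _ (2 * rnorm (L (L' (i - j))))); last by lra.
  by rewrite ler_wpM2r ?nrm_ge0.
apply: totally_bounded_sub cL => _ [y y1 <-]; exists (ofR M^-1 *: L' y) => //.
suff : rnorm (ofR M^-1 *: L' y) <= 1 by [].
rewrite nrmZR gtr0_norm ?invr_gt0// mulrC ler_pdivrMr// mul1r.
by apply: le_trans (L'M y) _; rewrite ler_piMr// ltW.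
Qed.

(** The symmetric part [A] has the same quadratic form as [L], hence the same numerical values, and
    the norm of a symmetric operator is governed by its quadratic form; so [M = 1] suffices. *)
Lemma real_hilbert_compactly_reducible : compactly_reducible (X := X).
Proof.
exists 1 => // L cL LN; have [M M0 LM] := compact_op_bounded cL.
have [L' adj] := ip_adjoint LM.
have cL' := adjoint_compact cL adj.
have c0 : compact_op (fun h => (ofR 2^-1 : K) *: L h).
  apply: (@compact_op_lincomb R real_scalars X X L L _ (ofR (- 2^-1))) => // h.
  have E : 2^-1 = 1 + - 2^-1 :> R by lra.
  by rewrite [in LHS]E ofRD ofR1 scalerDl scale1r.
have [|A hA] := @exists_linear R real_scalars X X (fun h => ofR 2^-1 *: L h + ofR 2^-1 *: L' h).
  move=> a u v; rewrite (linearP L) (linearP L') !scalerDr !scalerA addrACA.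
  by congr (_ + _ + _); congr (_ *: _); rewrite mulrC.
have q x : ip x (A x) = ip x (L x).
  by rewrite hA ipD !ipZ [ip x (L' x)]ipC -adj; lra.
have sym x y : ip x (A y) = ip y (A x).
  by rewrite !hA !ipD !ipZ (adj x) (adj y) [ip (L' x) y]ipC [ip (L' y) x]ipC; lra.
have q1 x : `|ip x (A x)| <= rnorm x ^+ 2.
  have [->|x0] := eqVneq x 0; first by rewrite ipC ip0 normr0 sqr_ge0.
  have rx : 0 < rnorm x by exact: nrm_gt0.
  have [f pf hf] := ip_dual_pair (nrm_unit x0).
  have := LN _ _ pf; rewrite hf [X in X <= _]rnorm_ofR -q.
  rewrite (linearZ_LR A) /= ipZ ipC ipZ [ip (A x) x]ipC mulrA normrM.
  rewrite ger0_norm ?mulr_ge0 ?invr_ge0 ?nrm_ge0// -invfM mulrC ler_pdivrMr ?mulr_gt0// mul1r.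
  by rewrite expr2.
exists A; split.
- by apply: (compact_op_lincomb (a := ofR 2^-1)) c0 cL' => h; rewrite hA.
- move=> h; apply: rnorm_linear_le => {}h h1.
  have [->|Ah0] := eqVneq (A h) 0; first by rewrite nrm0.
  pose y : X := ofR (rnorm (A h))^-1 *: A h.
  have y1 : rnorm y = 1 by exact: nrm_unit.
  have yA : ip y (A h) = rnorm (A h).
    rewrite ipC ipZ ipE expr2 mulrA mulVf ?mul1r//.
    by apply: contra_neq Ah0 => /nrm0_eq0.
  (* With [y] the direction of [A h], polarization gives [4 * rnorm (A h)] as a difference of two
     values of the quadratic form. These are bounded by the squared norms of [h + y] and [h - y],
     whose sum is 4 by the parallelogram identity. *)
  have pol : ip (h + y) (A (h + y)) - ip (h - y) (A (h - y)) = 4 * ip y (A h).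
    rewrite linearD linearB !ipD !ipN ![ip (h + y) _]ipC ![ip (h - y) _]ipC !ipD !ipN.
    rewrite ![ip (A _) _]ipC (sym h y); lra.
  have par : rnorm (h + y) ^+ 2 + rnorm (h - y) ^+ 2 = 4.
    rewrite -!ipE !ipD !ipN ![ip (h + y) _]ipC ![ip (h - y) _]ipC !ipD !ipN !ipE h1 y1 !expr1n.
    by rewrite [ip y h]ipC; lra.
  have := q1 (h + y); have := q1 (h - y); rewrite !ler_norml => /andP[? ?] /andP[? ?]; lra.
- move=> x x' px; have [x1 _ _ _] := px; have [f pf hf] := ip_dual_pair x1.
  by rewrite !(dual_pair_unique us px pf) !hf q.
Qed.

End real_hilbert.

(** For real scalars [dualf 2] is the identity, so pairing with a representative of [x] is the inner
    product of [L_2], and the facts on dual weights provide its laws. *)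
Lemma Lp2_real_compactly_reducible (R : realType) (d : measure_display)
    (T : measurableType d) (mu : {measure set T -> \bar R}) (p1 : 1 < 2 :> R) :
  compactly_reducible (X := Lp real_scalars mu p1).
Proof.
pose X := Lp real_scalars mu p1; pose K := scalars R real_scalars.
have dualf2 (a : K) : dualf 2 a = a.
  have [->|a0] := eqVneq a 0; first exact: dualf0.
  apply: (mulIf a0); rewrite dualfK// powR_mulrn ?rnorm_ge0// sqr_rnorm.
  by rewrite /= expr0n addr0 expr2.
have wE (x : X) : (fun t => repr x t : K) = fun t => dualf 2 (repr x t : K).
  by apply/funext => t; rewrite dualf2.
have aw (x : X) : @dual_weight d T R real_scalars mu 2 p1 (fun t => repr x t : K).
  by rewrite wE; exact: dual_weight_dualf.
pose ip (x y : X) : R := re (Lp_pair (fun t => repr x t : K) y).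
apply: (@real_hilbert_compactly_reducible R X ip).
- by move=> x y; congr (re (scalar_integral _ _)); apply/funext => t; rewrite mulrC.
- move=> x a y z; rewrite /ip Lp_pairP; last exact: aw.
  by rewrite reD reM re_ofR im_ofR mul0r subr0.
- move=> x; rewrite /ip wE -[x in Lp_pair _ x]Lp_class_repr Lp_pair_dualfK re_ofR.
  by rewrite Lp_class_repr powR_mulrn ?nrm_ge0.
- exact: Lp_rapidly_complete.
- exact: Lp_uniformly_convex.
- exact: Lp_uniformly_smooth.
Qed.

Theorem proposition1p5 (R : realType) (k : scalar_kind) (d : measure_display)
    (T : measurableType d) (mu : {measure set T -> \bar R}) (p : R) (p1 : 1 < p) :
  BPBp_nu_compact (Lp k mu p1).
Proof.
apply: BPBp_nu_compact_criterion.
- exact: Lp_rapidly_complete.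
- exact: Lp_uniformly_convex.
- exact: Lp_uniformly_smooth.
have [p2|p2] := eqVneq p 2; last first.
  have [c c0 hc] := @dualf_independent_neq2 R k p p1 p2.
  exact: Lp_compactly_reducible c0 hc.
case: k; first by move: p1; rewrite p2; exact: Lp2_real_compactly_reducible.
exact: Lp_compactly_reducible ler01 (dualf_independent_complex p1).
Qed.
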